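(* For $n\geq 1$, the closure mapping induces a $(2n+2)$-to-$4$ correspondence between the set $\mathcal{A}_n'$ of rooted ternary trees with $n$ nodes and the set $\mathcal{T}_n'$ of rooted irreducible triangulations with $n$ inner vertices. In other words, $\mathcal{A}_n'\times\{1,\dots,4\}$ is in bijection with $\mathcal{T}_n'\times\{1,\dots,2n+2\}$.
   Context: An irreducible triangulation is a plane graph (up to orientation-preserving homeomorphism) with quadrangular outer face, triangular inner faces, and no separating triangle; it is rooted by marking one of its four outer edges. A ternary tree is a plane tree with vertex degrees in $\{1,4\}$ (degree-4 vertices are nodes, degree-1 vertices leaves); it is rooted by marking a leaf. The closure mapping sends a ternary tree to an irreducible triangulation as follows: closed edges join two nodes, stems join a node to a leaf (viewed as dangling half-edges). Walking counterclockwise around the figure with the outer face on the right, whenever a stem $s$ is followed by two sides of closed edges $e_1,e_2$, attach a half-edge opposite to $s$ to the extremity of $e_2$ farthest from $s$, closing a triangle; repeat until impossible. The remaining stems form four intervals $I_1,\dots,I_4$ around the outer face; add an outer 4-cycle $v_1v_2v_3v_4$ and attach each stem of $I_i$ to $v_i$. *)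

(* Defs.v *)
From mathcomp Require Import all_boot all_fingroup generic_quotient.

Local Open Scope quotient_scope.

Set Implicit Arguments.
Unset Strict Implicit.
Unset Printing Implicit Defensive.

(* A map (graph embedded in the oriented sphere) is given by two permutations
   of its darts (half-edges): [vrot m d] is the next dart counterclockwise
   around the origin of d, and [erev m d] is the opposite half of the edge of
   d.  Hence vertices, edges and faces are the cycles of vrot, erev and face;
   a dart is read as going away from its origin.  [face m d] is the dart that
   follows d when one walks along d and keeps the same face on the right. *)
Definition cmap (D : finType) : finType := ({perm D} * {perm D})%type.

Section Maps.
Variables (D : finType) (m : cmap D).

Definition vrot : {perm D} := m.1.
Definition erev : {perm D} := m.2.
Definition face (d : D) : D := vrot (erev d).

Definition edges_ok : bool :=
  [forall d, (erev d != d) && (erev (erev d) == d)].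

Definition connected_map : bool :=
  [forall x, forall y, connect [rel a b | (b == vrot a) || (b == erev a)] x y].

(* Euler's formula V + F = E + 2. *)
Definition planar_map : bool :=
  [&& edges_ok, connected_map &
      fcard vrot D + fcard face D == fcard erev D + 2].

Definition plane_tree : bool := planar_map && (fcard face D == 1).

(* [leaf d]: the origin of d is a vertex of degree 1. *)
Definition leaf (d : D) : bool := vrot d == d.

Definition ternary_tree (n : nat) : bool :=
  [&& plane_tree,
      [forall d, (fingraph.order vrot d == 1) || (fingraph.order vrot d == 4)] &
      fcard vrot [pred d | fingraph.order vrot d == 4] == n].

Definition simple_map : bool :=
  [forall d, ~~ fconnect vrot d (erev d)] &&
  [forall d, forall d',
     fconnect vrot d d' && fconnect vrot (erev d) (erev d') ==> (d == d')].

Definition triangle (d1 d2 d3 : D) : bool :=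
  [&& fconnect vrot (erev d1) d2, fconnect vrot (erev d2) d3 &
      fconnect vrot (erev d3) d1].

(* The sides of the closed curve d1 d2 d3: two darts are on the same side if
   one goes from one to the other by following faces and by crossing edges
   that are not on the curve. *)
Definition same_side (d1 d2 d3 : D) : rel D :=
  connect [rel x y | (y == face x) || (y == erev x) &&
    (x \notin [:: d1; d2; d3; erev d1; erev d2; erev d3])].

Definition off_triangle (d1 d2 d3 x : D) : bool :=
  [&& ~~ fconnect vrot d1 x, ~~ fconnect vrot d2 x & ~~ fconnect vrot d3 x].

(* Both sides of the triangle contain a vertex, viz. the origins of x and y. *)
Definition separating_triangle (d1 d2 d3 : D) : bool :=
  triangle d1 d2 d3 &&
  [exists x, exists y, [&& off_triangle d1 d2 d3 x, off_triangle d1 d2 d3 y &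
                           ~~ same_side d1 d2 d3 x y]].

(* The outer face is the one on the right of the dart o. *)
Definition irreducible_triangulation (o : D) : bool :=
  [&& planar_map, simple_map, fingraph.order face o == 4,
      [forall d, ~~ fconnect face o d ==> (fingraph.order face d == 3)] &
      [forall d1, forall d2, forall d3, ~~ separating_triangle d1 d2 d3]].

Definition inner_vertex (o d : D) : bool :=
  [forall y, fconnect face o y ==> ~~ fconnect vrot y d].

Definition inner_vertices (o : D) : nat := fcard vrot (inner_vertex o).

(* A stem is the dart of a node whose opposite half is the dart of a leaf;
   the leaf stands for the dangling end of the stem.  A dart d of a closed
   edge is read as the side of that edge on the right of d. *)
Definition closed_side (d : D) : bool := ~~ leaf d && ~~ leaf (erev d).

(* The outer face contains the walk: stem [erev l], then l (back from the
   leaf), then d1 = face l, then d2 = face d1.  If d1 and d2 are sides of closed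
   edges, the leaf is merged with the end of d2: l is inserted right after
   [erev d2] around that vertex, so that the new face (d1 d2 l) is a triangle
   on the right of d1 and d2. *)
Definition glue_leaf (l : D) : cmap D :=
  ((tperm l (erev (face (face l))) * vrot)%g, erev).

Definition closable (l : D) : bool :=
  [&& leaf l, closed_side (face l) & closed_side (face (face l))].

End Maps.

Definition local_closure (D : finType) : rel (cmap D) :=
  [rel m m' | [exists l, closable m l && (m' == glue_leaf m l)]].

(* No order is imposed on the local closures. *)
Definition partial_closure (D : finType) (m m' : cmap D) : bool :=
  connect (@local_closure D) m m' && [forall l, ~~ closable m' l].

(* Eight new darts for the outer 4-cycle v_0 v_1 v_2 v_3 (indices in cyclic
   order, counterclockwise): [to_next i] goes from v_i to v_(i+1) and
   [to_prev i] from v_i to v_(i-1). *)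
Definition outer_darts (D : finType) : finType := (D + 'I_4 * bool)%type.
Definition to_next (D : finType) (i : 'I_4) : outer_darts D := inr (i, true).
Definition to_prev (D : finType) (i : 'I_4) : outer_darts D := inr (i, false).
Definition old_dart (D : finType) (d : D) : outer_darts D := inl d.

(* [lab l] is the index of the interval of the stem ending at the leaf l.  In a
   partial closure, a stem is separated from the next one along the outer face
   either by exactly one side of a closed edge, and then both are in the same
   interval, or by none, and then the next one starts the next interval.  The
   darts around v_i are, counterclockwise: to_next i, the ends of the stems of
   the interval from the last one to the first one, to_prev i. *)
Definition attach_stems (D : finType) (m : cmap D) (lab : D -> 'I_4)
    (M : cmap (outer_darts D)) : Prop :=
  [/\ forall d, erev M (old_dart d) = old_dart (erev m d),
      forall i, erev M (to_next D i) = to_prev D (ordS i) /\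
                erev M (to_prev D (ordS i)) = to_next D i,
      forall d, ~~ leaf m d -> vrot M (old_dart d) = old_dart (vrot m d),
      forall i, vrot M (to_prev D i) = to_next D i &
      forall l, leaf m l ->
        if leaf m (erev m (face m l)) then
          let l' := erev m (face m l) in
          [/\ lab l' = ordS (lab l),
              vrot M (to_next D (lab l)) = old_dart l &
              vrot M (old_dart l') = to_prev D (lab l')]
        else
          let l' := erev m (face m (face m l)) in
          lab l' = lab l /\ vrot M (old_dart l') = old_dart l].

(* As f commutes with the counterclockwise rotations, it preserves the
   orientation. *)
Definition is_iso (D D' : finType) (m : cmap D) (m' : cmap D')
    (f : {ffun D -> D'}) : bool :=
  [&& #|D| == #|D'|, injectiveb f,
      [forall d, f (vrot m d) == vrot m' (f d)] &
      [forall d, f (erev m d) == erev m' (f d)]].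

Definition iso (D D' : finType) (m : cmap D) (m' : cmap D') : bool :=
  [exists f, is_iso m m' f].

(* M is, up to isomorphism, the image of m by the closure mapping. *)
Definition closure_of (D D' : finType) (m : cmap D) (M : cmap D') : Prop :=
  exists (p : cmap D) (lab : D -> 'I_4) (C : cmap (outer_darts D)),
    [/\ partial_closure m p, attach_stems p lab C & iso C M].

Definition rooted_map : choiceType := {k : nat & (cmap 'I_k * 'I_k)%type}.

Definition Rooted (k : nat) (m : cmap 'I_k) (r : 'I_k) : rooted_map :=
  existT (fun k => (cmap 'I_k * 'I_k)%type) k (m, r).

Definition rmap (M : rooted_map) : cmap 'I_(tag M) := (tagged M).1.
Definition root_dart (M : rooted_map) : 'I_(tag M) := (tagged M).2.

Definition rooted_iso : rel rooted_map := fun M M' =>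
  [exists f, is_iso (rmap M) (rmap M') f && (f (root_dart M) == root_dart M')].

Lemma is_isoP (D D' : finType) (m : cmap D) (m' : cmap D')
    (f : {ffun D -> D'}) :
  reflect [/\ bijective f, forall d, f (vrot m d) = vrot m' (f d) &
              forall d, f (erev m d) = erev m' (f d)]
          (is_iso m m' f).
Proof.
apply: (iffP and4P) => [[/eqP cD /injectiveP fI /forallP fv /forallP fe]|].
  split; [by apply: inj_card_bij => //; rewrite cD | |] => d; exact/eqP.
case=> fB fv fe; split; first by rewrite (bij_eq_card fB).
- exact/injectiveP/bij_inj.
- by apply/forallP => d; rewrite fv.
- by apply/forallP => d; rewrite fe.
Qed.

Lemma rooted_iso_refl : reflexive rooted_iso.
Proof.
move=> M; apply/existsP; exists [ffun x => x]; rewrite ffunE eqxx andbT.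
apply/is_isoP; split=> [|d|d]; rewrite ?ffunE //.
by exists id => x; rewrite ?ffunE.
Qed.

Lemma rooted_iso_sym : symmetric rooted_iso.
Proof.
suff H M M' : rooted_iso M M' -> rooted_iso M' M.
  by move=> M M'; apply/idP/idP; apply: H.
case/existsP=> f /andP[/is_isoP[[g fK gK] fv fe] /eqP fr].
apply/existsP; exists [ffun x => g x]; rewrite ffunE -fr fK eqxx andbT.
apply/is_isoP; split=> [|d|d]; rewrite ?ffunE.
- by exists f => x; rewrite ffunE.
- by apply: (can_inj fK); rewrite gK fv gK.
- by apply: (can_inj fK); rewrite gK fe gK.
Qed.

Lemma rooted_iso_trans : transitive rooted_iso.
Proof.
move=> M2 M1 M3 /existsP[f /andP[/is_isoP[fB fv fe] /eqP fr]].
case/existsP=> g /andP[/is_isoP[gB gv ge] /eqP gr].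
apply/existsP; exists [ffun x => g (f x)]; rewrite ffunE fr gr eqxx andbT.
apply/is_isoP; split=> [|d|d]; rewrite ?ffunE ?fv ?gv ?fe ?ge //.
by apply: (eq_bij (bij_comp gB fB)) => x; rewrite ffunE.
Qed.

Canonical rooted_iso_equiv :=
  EquivRel rooted_iso rooted_iso_refl rooted_iso_sym rooted_iso_trans.

Definition rooted_class := {eq_quot rooted_iso}.

Definition class_of (k : nat) (m : cmap 'I_k) (r : 'I_k) : rooted_class :=
  (\pi_rooted_class (Rooted m r))%qT.

(* A tree is rooted by the dart of the marked leaf. *)
Definition rooted_ternary_tree (n : nat) (M : rooted_map) : bool :=
  ternary_tree (rmap M) n && leaf (rmap M) (root_dart M).

(* A triangulation is rooted by the dart of the marked outer edge that has the
   outer face on its right. *)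
Definition rooted_irreducible_triangulation (n : nat) (M : rooted_map) : bool :=
  irreducible_triangulation (rmap M) (root_dart M) &&
  (inner_vertices (rmap M) (root_dart M) == n).

(* The sets A'_n and T'_n.  Both predicates are invariant under isomorphism,
   so the choice of the representative is immaterial. *)
Definition rooted_ternary_trees (n : nat) :=
  {a : rooted_class | rooted_ternary_tree n (repr a)}.
Definition rooted_irreducible_triangulations (n : nat) :=
  {t : rooted_class | rooted_irreducible_triangulation n (repr t)}.

(* Main.v *)
(* In the closure C of a ternary tree A, let I be the set of the darts of the
   leaves of A, seen as darts leaving the ends of their stems.  Every inner
   triangle of C has exactly one dart of I on its boundary, and every inner
   vertex is the origin of exactly four darts outside I: I is a stem system.
   On a planar map, the difference of two stem systems is, around each vertex,
   the increment of a height function on the edges (a rank computation that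
   uses Euler's formula), so there is at most one minimal stem system, i.e.
   one to which no flip applies.  The system of a closure is minimal.
   Conversely, an irreducible triangulation has stem systems, by Hall's theorem
   and Euler's formula for induced subgraphs, hence a minimal one; in that one
   the triangles are nested without cycles, so that detaching the darts of I
   opens the triangulation into a ternary tree, of which it is the closure.
   By uniqueness, the isomorphisms between two trees are the isomorphisms
   between their closures.  Fixing an opening of every triangulation t, and the
   closure of every tree a, the pairs (a, i) and (t, j) are matched when some
   isomorphism from a to the opening of t sends the root of a to the j-th leaf
   while the induced isomorphism of the closures sends the i-th outer edge to
   the root of t. *)

From Stdlib Require Import ClassicalEpsilon.
Require Import Defs.
From mathcomp Require Import all_boot all_fingroup generic_quotient.
From mathcomp Require Import all_order all_algebra zify lra.

Set Implicit Arguments.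
Unset Strict Implicit.
Unset Printing Implicit Defensive.

(** * Planar maps *)

(** Nothing below appeals to Jordan's theorem. Its role is played by one relation: for a set H of
    edges of a plane map, the regions of the sphere cut along H and the components of the graph H
    satisfy regions + vertices = edges of H + components + 1. One inequality holds on every
    orientable surface, and the other is its dual and needs genus 0. The counting rests on lengths
    of regions. In an irreducible triangulation a region other than a face has length at least 4, so
    k vertices spanning E > 3 edges and t triangular faces satisfy 2E + 8 <= 4k + t. For the
    complement of a set of inner vertices this becomes Hall's condition with capacities deg - 4; for
    the vertices enclosed by a dual cycle it contradicts their four outgoing darts. In the other
    direction, k nodes of a tree span at most k - 1 closed edges, which leaves too many edges for
    anything enclosed by a loop, a double edge or a triangle. Symmetric trees and triangulations
    have fewer distinct rootings than leaves or outer edges; hence the matching of indexed pairs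
    through isomorphisms rather than a count of rootings. *)

Section Classes.
Variable T : finType.
Implicit Types e : rel T.

Definition cls e x := [set y | connect e x y].
Definition ncl e := #|cls e @: [set: T]|.

Lemma mem_cls e x y : (y \in cls e x) = connect e x y.
Proof. by rewrite inE. Qed.

Lemma cls_refl e x : x \in cls e x.
Proof. by rewrite inE connect0. Qed.

Lemma eq_cls e x y : connect_sym e -> (cls e x == cls e y) = connect e x y.
Proof.
move=> es; apply/eqP/idP => [exy|cxy].
  by rewrite -mem_cls exy cls_refl.
by apply/setP => z; rewrite !inE (same_connect es cxy).
Qed.

Lemma eq_ncl e e' : connect e =2 connect e' -> ncl e = ncl e'.
Proof.
move=> ee; rewrite /ncl; congr #|pred_of_set _|; apply: eq_imset => x.
by apply/setP => y; rewrite !inE ee.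
Qed.

Lemma card_cls_imset e (A : {pred T}) : connect_sym e -> closed e A ->
  #|cls e @: A| = n_comp e A.
Proof.
move=> es cA; rewrite /n_comp_mem.
have -> : cls e @: A = cls e @: [predI roots e & A].
  apply/setP => c; apply/imsetP/imsetP => [][x Ax ->]; last first.
    by case/andP: Ax => _ Ax; exists x.
  exists (fingraph.root e x).
    apply/andP; split; first exact: (roots_root es).
    by have := closed_connect cA (connect_root e x); rewrite Ax => /esym.
  by apply/eqP; rewrite eq_cls // connect_root.
rewrite card_in_imset // => x y /andP[/eqP rx _] /andP[/eqP ry _] /eqP.
by rewrite eq_cls // => /(fingraph.rootP es); rewrite rx ry.
Qed.

Lemma ncl_n_comp e : connect_sym e -> n_comp e T = ncl e.
Proof.
move=> es; rewrite /ncl card_cls_imset //; first by apply: eq_n_comp_r => x; rewrite !inE.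
by move=> x y _; rewrite !inE.
Qed.

Lemma ncl_ltn_sub e (A : {set T}) x : connect_sym e -> closed e (mem A) -> x \notin A ->
  n_comp e (mem A) < ncl e.
Proof.
move=> es cA xA; rewrite -card_cls_imset //; apply/proper_card/properP; split.
  by apply: imsetS; apply/subsetP.
exists (cls e x); first by apply: imset_f.
apply/imsetP => -[y Ay] /eqP; rewrite eq_cls // => cxy.
by move: xA; rewrite (closed_connect cA cxy) [y \in mem _]Ay.
Qed.

(** Only the classes of [a] and [b] can change: off their union the two relations have the same
    classes, and on it [e'] has a single one. *)
Lemma ncl_link e e' a b : connect_sym e -> connect_sym e' ->
  (forall x y, e x y -> connect e' x y) -> connect e' a b ->
  (forall x y, e' x y -> [|| connect e x y, (x == a) && (y == b) | (x == b) && (y == a)]) ->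
  ncl e = ncl e' + ~~ connect e a b.
Proof.
move=> es es' sub ab sup.
have sub' : subrel (connect e) (connect e') by apply: connect_sub.
have [cab|ncab] /= := boolP (connect e a b).
  rewrite addn0; apply: eq_ncl => x y; apply/idP/idP; first exact: sub'.
  apply: connect_sub => {}x {}y /sup /or3P[//|/andP[/eqP-> /eqP->]//|/andP[/eqP-> /eqP->]].
  by rewrite es.
pose A := cls e a :|: cls e b.
have cA x : x \notin A -> cls e' x = cls e x.
  move=> xA; apply/setP => y; rewrite !inE; apply/idP/idP; last exact: sub'.
  case/connectP => p; elim/last_ind: p y => [|p z IHp] y /=; first by move=> _ ->.
  rewrite rcons_path last_rcons => /andP[/IHp/(_ erefl) cz ez ->].
  case/or3P: (sup _ _ ez) => [|/andP[/eqP za _]|/andP[/eqP zb _]].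
  - exact: connect_trans.
  - by case/negP: xA; rewrite !inE (es a) -za cz.
  - by case/negP: xA; rewrite !inE (es b) -zb cz orbT.
have cA' x : x \in A -> cls e' x = cls e' a.
  move=> xA; apply/eqP; rewrite eq_cls // es'; move: xA; rewrite !inE => /orP[/sub'//|/sub' bx].
  exact: connect_trans ab bx.
have clA : closed e (mem A).
  apply: (intro_closed es) => x y exy; rewrite !inE => /orP[] /connect_trans -> //; rewrite ?orbT //;
  exact: connect1.
have split2 (h : T -> {set T}) : h @: [set: T] = h @: A :|: h @: ~: A.
  by rewrite -imsetU setUCr.
have disj h (es0 : connect_sym h) : closed h (mem A) ->
    [disjoint (cls h @: A) & (cls h @: ~: A)].
  move=> ch; apply/pred0P => c /=; apply/andP => -[/imsetP[x xA ->] /imsetP[y yA] /eqP].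
  rewrite eq_cls // => cxy; move: yA; rewrite inE.
  have := closed_connect ch cxy; rewrite !inE; move: xA; rewrite !inE => -> <-.
  by [].
have clA' : closed e' (mem A).
  apply: (intro_closed es') => x y exy xA.
  case/or3P: (sup _ _ exy) => [cxy|/andP[_ /eqP->]|/andP[_ /eqP->]].
  - by rewrite -(closed_connect clA cxy).
  - by rewrite !inE connect0 orbT.
  - by rewrite !inE connect0.
rewrite /ncl !split2.
have dj h : connect_sym h -> closed h (mem A) ->
    #|cls h @: A :|: cls h @: ~: A| = #|cls h @: A| + #|cls h @: ~: A|.
  by move=> hs ch; rewrite cardsU disjoint_setI0 ?cards0 ?subn0 //; apply: disj.
rewrite !dj //.
have -> : cls e' @: (~: A) = cls e @: (~: A).
  by apply: eq_in_imset => x; rewrite inE => /cA.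
have -> : cls e' @: A = [set cls e' a].
  apply/setP => c; rewrite inE; apply/imsetP/eqP => [[x xA ->]|->]; first exact: cA'.
  by exists a => //; rewrite !inE connect0.
have -> : cls e @: A = [set cls e a; cls e b].
  apply/setP => c; rewrite !inE; apply/imsetP/orP => [[x]|[/eqP->|/eqP->]].
  - by rewrite !inE => /orP[] cx ->; [left|right]; rewrite eq_cls // es.
  - by exists a => //; rewrite !inE connect0.
  - by exists b => //; rewrite !inE connect0 orbT.
by rewrite cards1 cards2 eq_cls // ncab addnAC.
Qed.

Lemma sum_card_cls e (P : {set T}) : connect_sym e ->
  #|P| = \sum_(c in cls e @: [set: T]) #|P :&: c|.
Proof.
move=> es; rewrite -sum1_card (partition_big (cls e) (mem (cls e @: [set: T]))) /=; last first.
  by move=> x _; apply: imset_f.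
apply: eq_bigr => c /imsetP[x _ ->]; rewrite -sum1_card; apply: eq_bigl => y.
by rewrite !inE eq_cls // es.
Qed.

End Classes.

Lemma connect_sym_sub (T : finType) (e : rel T) :
  (forall x y, e x y -> connect e y x) -> connect_sym e.
Proof.
move=> es; suff H x y : connect e x y -> connect e y x by move=> x y; apply/idP/idP; apply: H.
case/connectP => p; elim: p x => [|z p IHp] x /=; first by move=> _ ->.
by case/andP => /es zx /IHp H /H H1; apply: connect_trans H1 zx.
Qed.

(* The sum over a cycle of s of the increments of P along s vanishes. *)
Lemma card_perm_shift (T : finType) (s : T -> T) (W P : {set T}) : injective s ->
  (forall x, (s x \in W) = (x \in W)) -> #|[set x in W | s x \in P]| = #|W :&: P|.
Proof.
move=> si sW; rewrite -(card_imset _ si); apply: eq_card => y; rewrite !inE.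
apply/imsetP/andP => [[x]|[yW yP]]; first by rewrite inE => /andP[xW xP] ->; rewrite sW.
by exists (finv s y); rewrite ?f_finv // inE f_finv // yP -sW f_finv // yW.
Qed.

Section Maps.
Variables (D : finType) (m : cmap D).
Hypothesis me : edges_ok m.
Let v := vrot m.
Let e := erev m.
Let f := face m.

Lemma erevK : involutive e.
Proof. by move=> d; have /forallP/(_ d)/andP[_ /eqP] := me. Qed.

Lemma erev_neq d : e d != d.
Proof. by have /forallP/(_ d)/andP[] := me. Qed.

Lemma face_inj : injective f.
Proof. by move=> x y /perm_inj/perm_inj. Qed.

Lemma vrot_face d : v d = f (e d).
Proof. by rewrite /f /face erevK. Qed.

Lemma fc_symv : connect_sym (frel v).
Proof. exact/fconnect_sym/perm_inj. Qed.

Lemma fc_symf : connect_sym (frel f).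
Proof. exact/fconnect_sym/face_inj. Qed.

Lemma fc_syme : connect_sym (frel e).
Proof. exact/fconnect_sym/perm_inj. Qed.

(* The classes of [regR H] are the regions of the sphere cut along the edges
   of H, those of [verR H] the components of the graph with edge set H. *)
Definition regR (H : {set D}) : rel D :=
  [rel x y | (y == f x) || (y == e x) && (x \notin H)].
Definition verR (H : {set D}) : rel D :=
  [rel x y | (y == v x) || (y == e x) && (x \in H)].

Definition eclosed (H : {set D}) := forall x, (e x \in H) = (x \in H).

Lemma eclosedC H : eclosed H -> eclosed (~: H).
Proof. by move=> Hc x; rewrite !inE Hc. Qed.

Lemma regR_f H x : regR H x (f x). Proof. by rewrite /regR /= eqxx. Qed.
Lemma verR_v H x : verR H x (v x). Proof. by rewrite /verR /= eqxx. Qed.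
Lemma regR_e (H : {set D}) x : x \notin H -> regR H x (e x).
Proof. by move=> xH; rewrite /regR /= eqxx xH orbT. Qed.
Lemma verR_e (H : {set D}) x : x \in H -> verR H x (e x).
Proof. by move=> xH; rewrite /verR /= eqxx xH orbT. Qed.

Lemma regR_face H x y : fconnect f x y -> connect (regR H) x y.
Proof. apply: connect_sub => {}x {}y /eqP <-; exact/connect1/regR_f. Qed.
Lemma verR_vrot H x y : fconnect v x y -> connect (verR H) x y.
Proof. apply: connect_sub => {}x {}y /eqP <-; exact/connect1/verR_v. Qed.

Lemma regR_sym H : eclosed H -> connect_sym (regR H).
Proof.
move=> Hc; apply: connect_sym_sub => x y /orP[/eqP->|/andP[/eqP-> xH]].
  by apply: regR_face; rewrite fc_symf fconnect1.
by apply: connect1; rewrite /regR /verR /= erevK eqxx Hc xH orbT.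
Qed.

Lemma verR_sym H : eclosed H -> connect_sym (verR H).
Proof.
move=> Hc; apply: connect_sym_sub => x y /orP[/eqP->|/andP[/eqP-> xH]].
  by apply: verR_vrot; rewrite fc_symv fconnect1.
by apply: connect1; rewrite /regR /verR /= erevK eqxx Hc xH orbT.
Qed.

(* Every face-closed set of darts is balanced at each set of vertices. *)
Lemma flux (W r : {set D}) :
  (forall x, (v x \in W) = (x \in W)) -> (forall x, (f x \in r) = (x \in r)) ->
  #|[set x in W | e x \in r]| = #|W :&: r|.
Proof.
move=> vW fr; rewrite -(card_perm_shift _ (@perm_inj _ v) vW).
by apply: eq_card => x; rewrite !inE vrot_face fr.
Qed.

Lemma cls_verR_v H x y : eclosed H -> (v y \in cls (verR H) x) = (y \in cls (verR H) x).
Proof.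
move=> Hc; rewrite !inE; apply/idP/idP => /connect_trans; apply.
  by rewrite verR_sym //; apply/connect1/verR_v.
exact/connect1/verR_v.
Qed.

Lemma cls_regR_f H x y : eclosed H -> (f y \in cls (regR H) x) = (y \in cls (regR H) x).
Proof.
move=> Hc; rewrite !inE; apply/idP/idP => /connect_trans; apply.
  by rewrite regR_sym //; apply/connect1/regR_f.
exact/connect1/regR_f.
Qed.

Lemma cls_regR_e (H : {set D}) x y : eclosed H -> y \notin H ->
  (e y \in cls (regR H) x) = (y \in cls (regR H) x).
Proof.
move=> Hc yH; rewrite !inE; apply/idP/idP => /connect_trans; apply.
  by rewrite regR_sym //; apply/connect1/regR_e.
exact/connect1/regR_e.
Qed.

Lemma cls_verR_e (H : {set D}) x y : eclosed H -> y \in H ->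
  (e y \in cls (verR H) x) = (y \in cls (verR H) x).
Proof.
move=> Hc yH; rewrite !inE; apply/idP/idP => /connect_trans; apply.
  by rewrite verR_sym //; apply/connect1/verR_e.
exact/connect1/verR_e.
Qed.

(* An edge joining two components of a subgraph is not in the boundary of a
   region: the boundary would cross the cut an odd number of times. *)
Lemma bridge (H : {set D}) d : eclosed H -> d \notin H ->
  connect (regR (d |: (e d |: H))) d (e d) || connect (verR H) d (e d).
Proof.
move=> Hc dH; set H' := d |: (e d |: H).
have H'c : eclosed H'.
  move=> x; rewrite !inE Hc (inj_eq perm_inj).
  by rewrite -{1}(erevK d) (inj_eq perm_inj) orbA [in RHS]orbA (orbC (x == e d)).
apply/norP => -[nr nw].
pose r := cls (regR H') d; pose W := cls (verR H) d.
have dr : d \in r by rewrite cls_refl.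
have dW : d \in W by rewrite cls_refl.
have edr : e d \notin r by rewrite mem_cls.
have edW : e d \notin W by rewrite mem_cls.
have := @flux W r (fun x => cls_verR_v d x Hc) (fun x => cls_regR_f d x H'c).
rewrite (cardsD1 d (W :&: r)) in_setI dW dr /=.
have -> : [set x in W | e x \in r] = [set x in W :\ d | e x \in r].
  apply/setP => x; rewrite !inE; case: eqP => [->|] //=.
  by rewrite -!mem_cls [e d \in _](negbTE edr) andbF.
have eP x : x \in W -> x != d -> x \in H \/ (x \notin H').
  move=> xW xd; case: (boolP (x \in H)) => xH; [by left|right].
  rewrite !inE (negbTE xd) (negbTE xH) orbF /=; apply: contraNneq edW => <-; exact: xW.
(* [flux] equates two counts of which only one contains [d]. The other darts of [W] contribute
   equally to both: those of [H] are permuted by [e], and those outside [H'] have both halves in the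
   same region. *)
suff -> : #|[set x in W :\ d | e x \in r]| = #|(W :&: r) :\ d| by lia.
pose H1 := H :&: W.
have split3 (P : {set D}) : #|[set x in W :\ d | x \in P]|
      = #|H1 :&: P| + #|[set x in (W :\ d) :\: H | x \in P]|.
  rewrite -(cardsID H); congr (_ + _); apply: eq_card => x; rewrite !inE.
    case: (boolP (x \in H)) => xH; rewrite ?andbF ?andbT //=.
    by have -> : x != d by apply: contraNneq dH => <-.
  by rewrite -!andbA; do !bool_congr.
have -> : (W :&: r) :\ d = [set x in W :\ d | x \in r] by apply/setP => x; rewrite !inE andbA.
have -> : [set x in W :\ d | e x \in r] = [set x in W :\ d | x \in e @^-1: r].
  by apply/setP => x; rewrite !inE.
rewrite !split3; congr (_ + _).
  have -> : H1 :&: e @^-1: r = [set x in H1 | e x \in r] by apply/setP => x; rewrite !inE.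
  apply: card_perm_shift; first exact: perm_inj.
  move=> x; rewrite [LHS]in_setI [RHS]in_setI Hc; case: (boolP (x \in H)) => xH //=.
  exact: cls_verR_e.
apply: eq_card => x; rewrite !(in_setD, in_setI, in_set1, in_set); case: (boolP (x \in H)) => //= xH.
case: (boolP (x \in W)) => [xW|]; rewrite ?andbF //; case: (eqVneq x d) => [->|xd] //=.
by case: (eP x xW xd) => [|xH']; [rewrite (negbTE xH)|rewrite -!mem_cls cls_regR_e].
by rewrite -!mem_cls => /negbTE->.
Qed.

Hypothesis mc : connected_map m.

Lemma conn_map x y : connect [rel a b | (b == v a) || (b == e a)] x y.
Proof. by have /forallP/(_ x)/forallP/(_ y) := mc. Qed.

Lemma cls_all (h : rel D) (x0 : D) : connect_sym h ->
  (forall x, connect h x (v x)) -> (forall x, connect h x (e x)) -> ncl h = 1.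
Proof.
move=> hs hv he; apply/eqP/cards1P; exists (cls h x0); apply/setP => c; rewrite inE.
apply/imsetP/eqP => [[x _ ->]|->]; last by exists x0.
apply/eqP; rewrite eq_cls // hs; have := conn_map x0 x; apply: connect_sub => {}x y.
by case/orP => /eqP->.
Qed.

(** Valid in every genus. The inequality survives the addition of an edge to [H], since by [bridge]
    an edge cannot both split a region and join two components. *)
Lemma RC_le H (x0 : D) : eclosed H ->
  ncl (regR H) + ncl (frel v) <= #|H|./2 + ncl (verR H) + 1.
Proof.
move: {2}#|H| (leqnn #|H|) => n; elim: n H => [|n IHn] H.
  rewrite leqn0 cards_eq0 => /eqP-> Hc.
  have -> : ncl (regR set0) = 1.
    apply: (cls_all x0); first exact: regR_sym.
      move=> x; apply: (@connect_trans _ _ (e x)); apply: connect1; first by rewrite regR_e ?inE.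
      by rewrite vrot_face regR_f.
    by move=> x; apply: connect1; rewrite regR_e ?inE.
  have -> : ncl (verR set0) = ncl (frel v).
    by apply: eq_ncl; apply: eq_connect => x y; rewrite /verR /= inE andbF orbF eq_sym.
  by rewrite cards0; lia.
have [->|[d dH]] := set_0Vmem H; first by move=> _; apply: IHn; rewrite cards0.
move=> cH Hc; pose H0 := H :\ d :\ e d.
have dn := erev_neq d; have edH : e d \in H by rewrite Hc.
have H0c : eclosed H0.
  move=> x; rewrite !inE Hc (inj_eq perm_inj).
  by rewrite -{2}(erevK d) (inj_eq perm_inj) andbCA.
have dH0 : d \notin H0 by rewrite !inE eqxx andbF.
have HE : H = d |: (e d |: H0).
  apply/setP => x; rewrite !inE; case: (eqVneq x d) => [->|] //=; by case: (eqVneq x (e d)) => [->|] //=.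
have cE : #|H| = #|H0|.+2.
  by rewrite HE !cardsU1 in_setU1 H0c (negbTE dH0) eq_sym (negbTE dn).
clearbody H0.
have := IHn H0 _ H0c; rewrite cE in cH => /(_ ltac:(lia)) IH.
have lR : ncl (regR H) = ncl (regR H0) + ~~ connect (regR H) d (e d).
  apply: ncl_link; try exact: regR_sym.
  - move=> x y /orP[/eqP->|/andP[/eqP-> xH]]; first exact/connect1/regR_f.
    by apply/connect1/regR_e; move: xH; rewrite HE !inE !negb_or => /and3P[].
  - exact/connect1/regR_e.
  - move=> x y /orP[/eqP->|/andP[/eqP-> xH]]; first by rewrite connect1 ?regR_f.
    case: (boolP (x \in H)) => xH'; last by rewrite connect1 ?regR_e.
    move: xH'; rewrite HE !inE (negbTE xH) orbF => /orP[]/eqP->; rewrite ?erevK !eqxx ?orbT //.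
have lV : ncl (verR H0) = ncl (verR H) + ~~ connect (verR H0) d (e d).
  apply: ncl_link; try exact: verR_sym.
  - move=> x y /orP[/eqP->|/andP[/eqP-> xH]]; first exact/connect1/verR_v.
    by apply/connect1/verR_e; rewrite HE !inE xH !orbT.
  - exact/connect1/verR_e.
  - move=> x y /orP[/eqP->|/andP[/eqP-> xH]]; first by rewrite connect1 ?verR_v.
    case: (boolP (x \in H0)) => xH'; first by rewrite connect1 ?verR_e.
    move: xH; rewrite HE !inE; case/or3P => [/eqP->|/eqP->|xH0]; rewrite ?erevK ?eqxx ?orbT //.
    by rewrite xH0 in xH'.
have := @bridge H0 d H0c dH0; rewrite -HE; move: lR lV IH; rewrite cE /=.
by case: (connect (regR H) d (e d)); case: (connect (verR H0) d (e d)) => //=; lia.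
Qed.

End Maps.

(** * Duality, and the rank relation in genus 0 *)

Section Dual.
Variables (D : finType) (m : cmap D).
Hypothesis me : edges_ok m.
Hypothesis mc : connected_map m.

Definition dual : cmap D := ((erev m * vrot m)%g, erev m).

Lemma vrot_dual d : vrot dual d = face m d.
Proof. by rewrite /vrot /= permM. Qed.

Lemma face_dual d : face dual d = vrot m d.
Proof. by rewrite /face vrot_dual /face erevK. Qed.

Lemma connected_dual : connected_map dual.
Proof.
apply/forallP => x; apply/forallP => y; have := conn_map mc x y.
apply: connect_sub => {}x {}y /orP[]/eqP->; last first.
  by apply: connect1; rewrite /= eqxx orbT.
apply: (@connect_trans _ _ (erev m x)); apply: connect1; rewrite /= ?eqxx ?orbT //.
by rewrite vrot_dual /face erevK // eqxx.
Qed.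

Lemma edges_dual : edges_ok dual. Proof. exact: me. Qed.

Lemma fcard_ncl (s : D -> D) : injective s -> fcard s D = ncl (frel s).
Proof. by move=> si; apply: ncl_n_comp; apply: fconnect_sym. Qed.

Lemma cls_erev x : cls (frel (erev m)) x = [set x; erev m x].
Proof.
apply/setP => y; rewrite !inE; apply/idP/idP; last first.
  by case/orP => /eqP ->; rewrite ?connect0 ?fconnect1.
case/connectP => p; elim/last_ind: p y => [|p z IHp] y /=; first by move=> _ ->; rewrite eqxx.
rewrite rcons_path last_rcons => /andP[/IHp/(_ erefl) H /eqP E ->].
by case/orP: H => /eqP H; move: E; rewrite H ?erevK // => <-; rewrite eqxx ?orbT.
Qed.

Lemma card_eclosed (H : {set D}) : eclosed m H -> #|H| = (#|cls (frel (erev m)) @: H|).*2.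
Proof.
move=> Hc; rewrite -mul2n -[#|_ @: _|]sum1_card big_distrr /=.
rewrite -sum1_card (partition_big_imset (cls (frel (erev m)))) /=.
apply: eq_bigr => c /imsetP[x xH ->]; rewrite muln1.
transitivity #|[set x; erev m x]|; last by rewrite cards2 eq_sym erev_neq.
rewrite -sum1_card; apply: eq_bigl => y.
have cs : connect_sym (frel (erev m)) := fc_syme m.
rewrite (eq_cls _ _ cs) cs -mem_cls cls_erev andbC; case: (boolP (y \in [set x; _])) => //=.
by rewrite !inE => /orP[]/eqP->; rewrite ?Hc xH.
Qed.

Lemma ncl_erev : (ncl (frel (erev m))).*2 = #|D|.
Proof. by rewrite -cardsT card_eclosed // => x; rewrite !inE. Qed.

Hypothesis mp : planar_map m.

Lemma euler : ncl (frel (vrot m)) + ncl (frel (face m)) = #|D|./2 + 2.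
Proof.
case/and3P: mp => _ _ /eqP; rewrite !fcard_ncl; try exact: perm_inj; try exact: face_inj.
by move=> ->; rewrite -ncl_erev doubleK.
Qed.

(** Cutting along [H] amounts to connecting through the complement of [H] in the dual map, and
    conversely. So this is [RC_le] for the dual and the complement, where Euler's formula trades
    faces for vertices. *)
Lemma RC_ge (H : {set D}) (x0 : D) : eclosed m H ->
  #|H|./2 + ncl (verR m H) + 1 <= ncl (regR m H) + ncl (frel (vrot m)).
Proof.
move=> Hc; have Hc' : eclosed dual (~: H) by apply: eclosedC.
have := RC_le edges_dual connected_dual x0 Hc'.
have -> : ncl (regR dual (~: H)) = ncl (verR m H).
  by apply: eq_ncl; apply: eq_connect => x y; rewrite /verR /regR /= face_dual inE negbK.
have -> : ncl (verR dual (~: H)) = ncl (regR m H).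
  by apply: eq_ncl; apply: eq_connect => x y; rewrite /verR /regR /= vrot_dual inE.
have -> : ncl (frel (vrot dual)) = ncl (frel (face m)).
  by apply: eq_ncl; apply: eq_connect => x y; rewrite /verR /regR /= vrot_dual.
have oddH : odd #|H| = false by rewrite (card_eclosed Hc) odd_double.
have cD := cardsC H; have eu := euler; have dd := ncl_erev.
have := odd_double_half #|H|; rewrite oddH add0n => hH.
have hD := doubleK (ncl (frel (erev m))); rewrite dd in hD.
lia.
Qed.

End Dual.

(** * Stem systems and height functions *)

Section Potential.
Import GRing.Theory.
Variable D : finType.
Implicit Types s : {perm D}.
Local Open Scope ring_scope.
Local Notation N := #|D|.

(** Its row space is the space of [s]-invariant functions on the darts, and multiplying by its
    transpose takes sums over the cycles of [s]. *)
Definition cmx s : 'M[rat]_N := \matrix_(i, j) (fconnect s (enum_val i) (enum_val j))%:R.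

Lemma rank_cmx s : (ncl (frel s) <= \rank (cmx s))%N.
Proof.
rewrite -fcard_ncl; last exact: perm_inj.
set R := [predI froots s & D].
pose g (i : 'I_#|R|) := enum_rank (enum_val i).
have -> : fcard s D = #|R| by [].
suff E : mxsub g g (cmx s) = 1%:M.
  rewrite -{1}(@mxrank1 rat #|R|) -E /mxsub.
  have -> : \matrix_(i, j) cmx s (g i) (g j) = rowsub g (cmx s) *m colsub g 1%:M.
    apply/matrixP => i j; rewrite mxE mulmx_colsub mulmx1; by rewrite !mxE.
  apply: leq_trans (mxrankM_maxl _ _) _; exact: mxrankS (rowsub_sub _ _).
apply/matrixP => i j; rewrite !mxE !enum_rankK; congr (_%:R).
rewrite -(root_connect (fconnect_sym (@perm_inj _ s))).
have rt k : froot s (@enum_val _ R k) = enum_val k.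
  by have := enum_valP k => /andP[/eqP].
by rewrite !rt (inj_eq enum_val_inj).
Qed.

Lemma sub_cmx s (u : 'rV_N) : (u <= cmx s)%MS ->
  forall x y, fconnect s x y -> u 0 (enum_rank x) = u 0 (enum_rank y).
Proof.
case/submxP => w -> x y cxy; rewrite !mxE; apply: eq_bigr => i _; rewrite !mxE !enum_rankK.
have ss := fconnect_sym (@perm_inj _ s).
by rewrite ss (same_connect ss cxy) ss.
Qed.

Lemma const_rank (x0 : D) m (A : 'M[rat]_(m, N)) :
  (forall u : 'rV_N, (u <= A)%MS -> forall x y, u 0 (enum_rank x) = u 0 (enum_rank y)) ->
  (\rank A <= 1)%N.
Proof.
move=> cA; apply: leq_trans (rank_leq_row (const_mx 1 : 'rV[rat]_N)).
apply: mxrankS; apply/row_subP => i.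
have H := cA (row i A) (row_sub i A).
have -> : row i A = (row i A 0 (enum_rank x0)) *: const_mx 1.
  apply/rowP => j; rewrite [RHS]mxE [X in _ * X]mxE mulr1 -(enum_valK j); exact: H.
exact: scalemx_sub.
Qed.

Lemma trans_inv s t (g : D -> rat) :
  (forall x y, connect [rel a b | (b == s a) || (b == t a)] x y) ->
  (forall x y, fconnect s x y -> g x = g y) -> (forall x, g (t x) = g x) ->
  forall x y, g x = g y.
Proof.
move=> tr gp gq x y; case/connectP: (tr x y) => w; elim: w x => [|z w IH] x /=; first by move=> _ ->.
case/andP => /orP[]/eqP-> /IH H /H <-; rewrite ?gq //; apply: gp; exact: fconnect1.
Qed.

Lemma sum_cmx s (u : 'rV_N) x :
  (u *m (cmx s)^T) 0 (enum_rank x) = \sum_(y | fconnect s x y) u 0 (enum_rank y).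
Proof.
rewrite mxE [RHS]big_mkcond (reindex enum_rank) /=; last exact: onW_bij (enum_rank_bij D).
apply: eq_bigr => y _; rewrite !mxE !enum_rankK.
by case: ifP; rewrite ?mulr1 ?mulr0.
Qed.

Variables p q r : {perm D}.
Hypothesis trpq : forall x y, connect [rel a b | (b == p a) || (b == q a)] x y.
Hypothesis trqr : forall x y, connect [rel a b | (b == q a) || (b == r a)] x y.
Hypothesis qr : forall x, fconnect p ((q^-1)%g x) ((r^-1)%g x).
Hypothesis chi : (ncl (frel p) + ncl (frel q) + ncl (frel r) = N + 2)%N.

(* The increments along q of the p-invariant functions form a space of
   dimension c(p) - 1, and the functions with zero sums on the cycles of q and r
   one of dimension N - (c(q) + c(r) - 1): both are equal when the genus is 0. *)
Lemma potential (phi : D -> rat) :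
  (forall x, \sum_(y | fconnect q x y) phi y = 0) ->
  (forall x, \sum_(y | fconnect r x y) phi y = 0) ->
  exists h : D -> rat, (forall x, h (p x) = h x) /\ (forall x, phi (q x) = h (q x) - h x).
Proof.
move=> sq sr.
have [D0|[x0 _]] := set_0Vmem [set: D].
  by exists phi; split=> x; have := in_setT x; rewrite D0 inE.
pose P : 'M[rat]_N := \matrix_(i, j) (q (enum_val i) == enum_val j)%:R.
have PE (u : 'rV_N) x : (u *m P) 0 (enum_rank x) = u 0 (enum_rank ((q^-1)%g x)).
  rewrite mxE (bigD1 (enum_rank ((q^-1)%g x))) //= big1 => [|i ni]; rewrite !mxE !enum_rankK.
    by rewrite permKV eqxx mulr1 addr0.
  case: eqP => [E|]; rewrite ?mulr0 //; case/negP: ni.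
  by rewrite -E permK enum_valK.
pose Im := cmx p *m (1%:M - P).
pose K := kermx (row_mx (cmx q)^T (cmx r)^T).
have KP (u : 'rV_N) : (u <= K)%MS = (u *m (cmx q)^T == 0) && (u *m (cmx r)^T == 0).
  apply/sub_kermxP/andP; rewrite mul_mx_row; last first.
    by case=> /eqP-> /eqP->; exact: row_mx0.
  by rewrite -row_mx0 => /eq_row_mx[-> ->].
(* By [qr], a [p]-invariant function has the same value at the predecessors of a dart along [q] and
   along [r], so its increments along [q] sum to 0 over the cycles of both. *)
have ImK : (Im <= K)%MS.
  apply/rV_subP => u /submxP[w ->]; rewrite KP mulmxA.
  set h := w *m cmx p; have hp := @sub_cmx p h (submxMl _ _).
  have hE x : (h *m (1%:M - P)) 0 (enum_rank x) = h 0 (enum_rank x) - h 0 (enum_rank ((q^-1)%g x)).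
    by rewrite mulmxBr mulmx1 [LHS]mxE [X in _ + X]mxE PE.
  have Z s (hs : forall x, h 0 (enum_rank ((q^-1)%g x)) = h 0 (enum_rank ((s^-1)%g x))) :
     (h *m (1%:M - P)) *m (cmx s)^T == 0.
    apply/eqP/rowP => j; rewrite -(enum_valK j) sum_cmx [RHS]mxE.
    under eq_bigr do rewrite hE hs; rewrite sumrB; apply/eqP; rewrite subr_eq0; apply/eqP.
    rewrite (reindex_inj (@perm_inj _ (s^-1)%g)) /=; apply: eq_bigl => y.
    by rewrite -{2}(permKV s y) (same_fconnect1_r (@perm_inj _ s)).
  rewrite !Z // => x; apply: hp; exact: qr.
(* A row of [cmx p] killed by [1 - P] is invariant under [p] and [q], hence constant by
   transitivity: the rank drops by at most 1. *)
have rIm : (ncl (frel p) - 1 <= \rank Im)%N.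
  rewrite leq_subLR addnC; apply: leq_trans (rank_cmx p) _.
  rewrite -(mxrank_mul_ker (cmx p) (1%:M - P)) leq_add2l.
  apply: (const_rank x0) => u; rewrite sub_capmx => /andP[up /sub_kermxP].
  rewrite mulmxBr mulmx1 => /eqP; rewrite subr_eq0 => /eqP uP.
  apply: (trans_inv trpq (g := fun x => u 0 (enum_rank x))); first exact: sub_cmx.
  by move=> x; rewrite {1}uP PE permK.
have rK : (\rank K <= N - (ncl (frel q) + ncl (frel r) - 1))%N.
  rewrite mxrank_ker leq_sub2l // -tr_col_mx mxrank_tr -addsmxE.
  have := mxrank_sum_cap (cmx q) (cmx r).
  have : (\rank (cmx q :&: cmx r) <= 1)%N.
    apply: (const_rank x0) => u; rewrite sub_capmx => /andP[uq ur].
    apply: (trans_inv trqr (g := fun x => u 0 (enum_rank x))); first exact: sub_cmx.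
    move=> x; apply: (sub_cmx ur); by rewrite (fconnect_sym (@perm_inj _ r)) fconnect1.
  have := rank_cmx q; have := rank_cmx r; lia.
have KIm : (K <= Im)%MS.
  rewrite -(geq_leqif (mxrank_leqif_sup ImK)); apply: leq_trans rK _; apply: leq_trans rIm.
  have H s : (0 < ncl (frel s))%N by apply/card_gt0P; exists (cls (frel s) x0); apply: imset_f.
  have := H p; have := H q; have := H r; move: chi; lia.
pose u : 'rV[rat]_N := \row_i phi (enum_val i).
have uE x : u 0 (enum_rank x) = phi x by rewrite mxE enum_rankK.
have : (u <= Im)%MS.
  apply: submx_trans KIm; rewrite KP; apply/andP; split; apply/eqP/rowP => j.
    rewrite -(enum_valK j) sum_cmx [RHS]mxE -[RHS](sq (enum_val j)); by apply: eq_bigr => y _.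
  rewrite -(enum_valK j) sum_cmx [RHS]mxE -[RHS](sr (enum_val j)); by apply: eq_bigr => y _.
case/submxP => w; rewrite mulmxA => E.
exists (fun x => (w *m cmx p) 0 (enum_rank x)); split => x.
  by apply: (@sub_cmx p _ (submxMl _ _)); rewrite (fconnect_sym (@perm_inj _ p)) fconnect1.
by rewrite -uE E mulmxBr mulmx1 [LHS]mxE [X in _ + X]mxE PE permK.
Qed.

End Potential.

Section Struct.
Import GRing.Theory Num.Theory Order.TTheory.
Variables (D : finType) (m : cmap D) (o : D).
Local Notation v := (vrot m).
Local Notation e := (erev m).
Local Notation f := (face m).
Local Notation inn := (inner_vertex m o).

Definition outer_dart x := fconnect f o x.
Local Notation outd := outer_dart.

(* In the closure of a tree, the darts of the leaves form such a system. *)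
Record stem_system (I : {set D}) : Prop := StemSystem {
  st_tri : forall x, ~~ outd x -> f (f (f x)) = x /\ f x != x;
  st_face : forall x, ~~ outd x -> #|[set y in I | fconnect f x y]| = 1;
  st_out : forall x, x \in I -> ~~ outd x /\ ~~ outd (e x);
  st_inn : forall x, inn x -> #|[set y | fconnect v x y & y \notin I]| = 4;
  st_outv : forall x, ~~ inn x -> ~~ outd x -> ~~ outd (e x) -> x \in I }.

(* Adding 1 to the height on the edges of Z gives another stem system: the darts
   of I at which the rotation enters Z are replaced by those at which it leaves Z. *)
Definition flippable (I Z : {set D}) : Prop :=
  [/\ eclosed m Z, forall x, x \in Z -> inn x,
      forall x, v x \notin I -> v x \in Z -> x \in Z &
      forall x, v x \in I -> x \in Z -> v x \in Z].

Definition minimal (I : {set D}) : Prop := forall Z, flippable I Z -> Z = set0.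

Lemma innP x : reflect (exists2 y, outd y & fconnect v y x) (~~ inn x).
Proof.
rewrite negb_forall; apply: (iffP existsP) => [[y]|[y oy yx]].
  by rewrite negb_imply negbK => /andP[oy yx]; exists y.
by exists y; rewrite negb_imply negbK; apply/andP.
Qed.

Lemma outd_ninn x : outd x -> ~~ inn x.
Proof. by move=> ox; apply/innP; exists x. Qed.

Lemma inn_v x y : fconnect v x y -> inn x = inn y.
Proof.
have sv := fconnect_sym (@perm_inj _ v).
move=> cxy; apply: negb_inj; apply/innP/innP => -[z oz zx]; exists z => //;
  by apply: (connect_trans zx); rewrite // sv.
Qed.

Lemma inn_vrot x : inn (v x) = inn x.
Proof. by rewrite -(inn_v (fconnect1 v x)). Qed.

Hypothesis mp : planar_map m.
Let me : edges_ok m. Proof. by case/and3P: mp. Qed.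
Let mc : connected_map m. Proof. by case/and3P: mp. Qed.

Lemma outd_f x : outd (f x) = outd x.
Proof. by rewrite /outer_dart -(same_fconnect1_r (face_inj (m := m))). Qed.

Lemma outd_ev x : outd (v x) = outd (e x).
Proof. by rewrite (vrot_face me) outd_f. Qed.

Definition facep : {perm D} := (e * v)%g.
Lemma facepE x : facep x = f x. Proof. by rewrite permM. Qed.

Lemma facep_connect : fconnect facep =2 fconnect f.
Proof. by apply: eq_fconnect => x; rewrite facepE. Qed.

Local Open Scope ring_scope.

(** The case of [potential] where the invariant functions live on edges: the predecessors of a dart
    around its vertex and along its face are the two halves of one edge. *)
Lemma potential_edge (phi : D -> rat) :
  (forall x, \sum_(y | fconnect v x y) phi y = 0) ->
  (forall x, \sum_(y | fconnect f x y) phi y = 0) ->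
  exists h : D -> rat, (forall x, h (e x) = h x) /\ (forall x, phi (v x) = h (v x) - h x).
Proof.
move=> sv sf; apply: (@potential _ e v facep) => //.
- by move=> x y; have := conn_map mc x y; congr is_true; apply: eq_connect => a b; rewrite /= orbC.
- move=> x y; have := connected_dual me mc; move=> /conn_map/(_ x y).
  apply: connect_sub => {}x {}y /orP[]/eqP->.
    by apply: connect1; rewrite /= vrot_dual -facepE eqxx orbT.
  apply: (@connect_trans _ _ (v x)); first by apply: connect1; rewrite /= eqxx.
  rewrite (vrot_face me) (_ : erev (dual m) x = e x) //.
  have : fconnect facep (f (e x)) (e x).
    by rewrite (fconnect_sym (@perm_inj _ facep)) facep_connect fconnect1.
  by apply: connect_sub => a b /eqP<-; apply: connect1; rewrite /= eqxx orbT.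
- move=> x; rewrite /facep invMg permM.
  set y := (v^-1)%g x; have -> : (e^-1)%g y = e y by apply: (can_inj (permK e)); rewrite permKV erevK.
  exact: fconnect1.
- have := euler me mp; have := ncl_erev me.
  rewrite (@eq_ncl _ (frel facep) (frel f)); last exact: facep_connect.
  move=> <-; rewrite doubleK; lia.
- by move=> x; rewrite -[RHS](sf x); apply: eq_bigl => y; rewrite facep_connect.
Qed.

Lemma sum_ind (I P : {pred D}) : \sum_(y | y \in P) ((y \in I)%:R : rat) = #|[predI P & I]|%:R.
Proof. by rewrite -natr_sum -big_mkcondr /= sum1_card. Qed.

(** At the outer vertices the two systems agree, so [h] is constant there, equal to [h o]. If its
    maximum were larger, the edges where it is reached would be a nonempty flippable set for [I]. *)
Lemma struct_le (I I' : {set D}) (h : D -> rat) : stem_system I -> stem_system I' -> minimal I ->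
  (forall x, h (e x) = h x) ->
  (forall x, (v x \in I)%:R - (v x \in I')%:R = h (v x) - h x) -> forall x, h x <= h o.
Proof.
move=> sI sI' mI he hv x.
have Io y : ~~ inn y -> (y \in I) = (y \in I').
  move=> ny; apply/idP/idP => [/(st_out sI)|/(st_out sI')] [o1 o2]; exact: st_outv.
have hov y : ~~ inn y -> h (v y) = h y.
  by move=> ny; apply/eqP; rewrite -subr_eq0 -hv Io ?inn_vrot // subrr.
have hface y : outd y -> h y = h o.
  case/connectP => w; elim/last_ind: w y => [|w z IH] y /=; first by move=> _ ->.
  rewrite rcons_path last_rcons => /andP[pw /eqP zy] ->; rewrite -zy -(IH _ pw erefl).
  rewrite /face hov ?he // -inn_vrot; apply: outd_ninn.
  rewrite outd_ev erevK // /outer_dart.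
  by apply/connectP; exists w.
have ho y : ~~ inn y -> h y = h o.
  case/innP => z oz /connectP[w]; elim/last_ind: w y => [|w u IH] y /=; first by move=> _ ->; apply: hface.
  rewrite rcons_path last_rcons => /andP[pw /eqP uy] ->; rewrite -uy -(IH _ pw erefl) hov //.
  by apply/innP; exists z => //; apply/connectP; exists w.
have [y _ hy0] := @arg_maxP _ _ _ o xpredT h isT.
have hy z : h z <= h y := hy0 z isT.
apply: le_trans (hy x) _; rewrite leNgt; apply/negP => lt.
pose Z := [set x | h x == h y].
have : y \in Z by rewrite inE.
rewrite (mI Z) ?inE //; split.
- by move=> z; rewrite !inE he.
- move=> z; rewrite inE => /eqP hz; apply/contraT => /ho; rewrite hz => E.
  by rewrite E ltxx in lt.
- move=> z nI; rewrite !inE => /eqP hz; have := hv z; rewrite (negbTE nI) sub0r => E.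
  rewrite eq_le hy //= -hz -subr_ge0 -opprB oppr_ge0 -E; by rewrite oppr_le0 ler0n.
- move=> z vI; rewrite !inE => /eqP hz; have := hv z; rewrite vI => E.
  rewrite eq_le hy //= -hz -subr_ge0 -E; by case: (_ \in I').
Qed.

Lemma struct_vertex_sum (I I' : {set D}) x : stem_system I -> stem_system I' ->
  \sum_(y | fconnect v x y) ((y \in I)%:R - (y \in I')%:R : rat) = 0.
Proof.
move=> sI sI'; rewrite sumrB !(sum_ind _ (mem (fconnect v x))).
apply/eqP; rewrite subr_eq0 eqr_nat; apply/eqP.
case: (boolP (inn x)) => [ix|nx]; last first.
  apply: eq_card => y; rewrite !inE; apply: andb_id2l => cxy.
  have ny : ~~ inn y by rewrite -(inn_v cxy).
  apply/idP/idP => [/(st_out sI)|/(st_out sI')] [o1 o2]; exact: st_outv.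
have H J : stem_system J -> (#|[predI mem (fconnect v x) & J]| + 4 = #|fconnect v x|)%N.
  move=> sJ; rewrite -(st_inn sJ ix) -[RHS](cardID J); congr (_ + _)%N.
  by apply: eq_card => y; rewrite !inE andbC.
by have := H _ sI; rewrite -(H _ sI') => /addIn.
Qed.

Lemma struct_face_sum (I I' : {set D}) x : stem_system I -> stem_system I' ->
  \sum_(y | fconnect f x y) ((y \in I)%:R - (y \in I')%:R : rat) = 0.
Proof.
move=> sI sI'; rewrite sumrB !(sum_ind _ (mem (fconnect f x))).
apply/eqP; rewrite subr_eq0 eqr_nat; apply/eqP.
case: (boolP (outd x)) => ox.
  have H J : stem_system J -> #|[predI mem (fconnect f x) & J]| = 0%N.
    move=> sJ; apply: eq_card0 => y; rewrite !inE; apply/negP => /andP[cxy] /(st_out sJ)[].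
    by rewrite /outer_dart (connect_trans ox cxy).
  by rewrite !H.
have H J : stem_system J -> #|[predI mem (fconnect f x) & J]| = 1%N.
  by move=> sJ; rewrite -(st_face sJ ox); apply: eq_card => y; rewrite !inE andbC.
by rewrite !H.
Qed.

Lemma struct_unique (I I' : {set D}) : stem_system I -> stem_system I' -> minimal I -> minimal I' -> I = I'.
Proof.
move=> sI sI' mI mI'; pose phi x : rat := (x \in I)%:R - (x \in I')%:R.
have [x|x|h [he hv]] := @potential_edge phi; first exact: struct_vertex_sum.
  exact: struct_face_sum.
have le1 x : h x <= h o := struct_le sI sI' mI he hv x.
have le2 x : - h x <= - h o.
  apply: (@struct_le I' I (fun x => - h x)) => // y; first by rewrite he.
  by rewrite opprK [RHS]addrC -[RHS]opprB -hv opprB.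
have hc x : h x = h o by apply/eqP; rewrite eq_le le1 -lerN2 le2.
apply/setP => x; have := hv ((v^-1)%g x); rewrite permKV !hc subrr /phi => /eqP.
by rewrite subr_eq0 eqr_nat; case: (x \in I); case: (x \in I').
Qed.

End Struct.

(** * Counting in irreducible triangulations *)

Section Regions.
Variables (D : finType) (m : cmap D).
Local Notation v := (vrot m).
Local Notation e := (erev m).
Local Notation f := (face m).

Definition bd (r : {set D}) := [set d in r | e d \notin r].

Hypothesis me : edges_ok m.
Let sv : connect_sym (frel v) := fconnect_sym (@perm_inj _ v).

Lemma fc_sym x y : fconnect v x y = fconnect v y x.
Proof. exact: sv. Qed.

Lemma fc_trans x y z : fconnect v x y -> fconnect v y z -> fconnect v x z.
Proof. exact: connect_trans. Qed.

Lemma vclosed (X : {set D}) x y : (forall x, (v x \in X) = (x \in X)) ->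
  fconnect v x y -> (x \in X) = (y \in X).
Proof.
move=> vX; have cX : closed (frel v) (mem X) by move=> a b /eqP <-; rewrite [RHS]vX.
exact: (closed_connect cX).
Qed.

Lemma fc_ef x : fconnect v (e x) (f x).
Proof. exact: fconnect1. Qed.

(** Around the end of [d], [flux] equates the number of boundary darts that arrive with the number
    of those that leave, and [d] arrives. *)
Lemma bd_next (r : {set D}) d : (forall x, (f x \in r) = (x \in r)) -> d \in bd r ->
  exists2 d', d' \in bd r & fconnect v (e d) d'.
Proof.
move=> fr; rewrite inE => /andP[dr edr]; pose W := cls (frel v) (e d).
have vW x : (v x \in W) = (x \in W) by rewrite !inE -(same_fconnect1_r (@perm_inj _ v)).
have := flux me vW fr.
have -> : [set x in W | e x \in r] = [set x in W | e x \in r & x \in r] :|: [set x in W | e x \in r & x \notin r].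
  by apply/setP => x; rewrite !inE; case: (x \in r); rewrite ?andbT ?andbF ?orbF.
have -> : W :&: r = [set x in W | e x \in r & x \in r] :|: [set x in W | e x \notin r & x \in r].
  by apply/setP => x; rewrite !inE; case: (x \in r); case: (e x \in r); rewrite ?andbT ?andbF ?orbF.
rewrite !cardsU !disjoint_setI0 ?cards0 ?subn0; last first.
- by apply/pred0P => x; rewrite /= !inE; case: (x \in r); rewrite ?andbF.
- by apply/pred0P => x; rewrite /= !inE; case: (e x \in r); rewrite ?andbF.
move/addnI => E; have : 0 < #|[set x in W | e x \in r & x \notin r]|.
  by apply/card_gt0P; exists (e d); rewrite !inE erevK // dr edr connect0.
rewrite E => /card_gt0P[x]; rewrite !inE => /and3P[cx exr xr]; exists x => //.
by rewrite inE xr.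
Qed.

Hypothesis ms : simple_map m.

Lemma noloop d : ~~ fconnect v d (e d).
Proof. by case/andP: ms => /forallP/(_ d). Qed.

Lemma noloop' d : ~~ fconnect v (e d) d.
Proof. by rewrite fc_sym noloop. Qed.

Lemma nopar d d' : fconnect v d d' -> fconnect v (e d) (e d') -> d = d'.
Proof.
case/andP: ms => _ /forallP/(_ d)/forallP/(_ d')/implyP H c1 c2.
by apply/eqP/H/andP.
Qed.

Lemma nopar' d d' : fconnect v d (e d') -> fconnect v (e d) d' -> d = e d'.
Proof. by move=> c1 c2; apply: nopar => //; rewrite erevK. Qed.

(** In a simple map, a walk along the boundary cannot close up after one or two steps; with at most
    three darts available, the third one leads back to the first. *)
Lemma bd_triangle (r : {set D}) : (forall x, (f x \in r) = (x \in r)) -> bd r != set0 -> #|bd r| <= 3 ->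
  exists d1 d2 d3, triangle m d1 d2 d3 /\ bd r = [set d1; d2; d3].
Proof.
move=> fr /set0Pn[d1 b1] c3.
have nx d : d \in bd r -> exists2 d', d' \in bd r & fconnect v (e d) d' by exact: bd_next.
have N1 d d' : d \in bd r -> fconnect v (e d) d' -> d' != d.
  by move=> _ c; apply: contraTneq c => ->; exact: noloop'.
have N2 d d' d'' : d \in bd r -> d' \in bd r -> fconnect v (e d) d' -> fconnect v (e d') d'' -> d'' != d.
  move=> bdd bd' c c'; apply/eqP => E; subst d''.
  have : d = e d' by apply: nopar'; rewrite // fc_sym.
  by move=> E; move: bdd bd'; rewrite E !inE erevK // => /andP[_ /negbTE->].
have [d2 b2 c12] := nx _ b1; have [d3 b3 c23] := nx _ b2; have [d4 b4 c34] := nx _ b3.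
have n21 := N1 _ _ b1 c12; have n32 := N1 _ _ b2 c23; have n43 := N1 _ _ b3 c34.
have n31 := N2 _ _ _ b1 b2 c12 c23; have n42 := N2 _ _ _ b2 b3 c23 c34.
have S : [set d1; d2; d3] \subset bd r by apply/subsetP => x; rewrite in_setU in_set2 in_set1 -orbA => /or3P[]/eqP->.
have C : #|[set d1; d2; d3]| = 3.
  rewrite setUC cardsU1 cardsU1 cards1 !inE (negbTE n31) (negbTE n32).
  by rewrite (eq_sym d1) (negbTE n21).
have E : [set d1; d2; d3] = bd r by apply/eqP; rewrite eqEcard S C.
exists d1, d2, d3; split => //; rewrite /triangle c12 c23.
move: b4; rewrite -E !inE (negbTE n43) (negbTE n42) !orbF => /eqP E4.
by rewrite -E4 c34.
Qed.

Hypothesis nosep : forall d1 d2 d3, ~~ separating_triangle m d1 d2 d3.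

Lemma triangle_rot d1 d2 d3 : triangle m d1 d2 d3 -> triangle m d2 d3 d1.
Proof. by case/and3P => a b c; apply/and3P. Qed.

(** One side of the triangle has no vertex off it. In a simple map only the darts of the triangle
    join two of its corners, so that side is reduced to them. *)
Lemma triangle_side (r : {set D}) d1 d2 d3 : (forall x, (f x \in r) = (x \in r)) ->
  triangle m d1 d2 d3 -> bd r = [set d1; d2; d3] ->
  r = [set d1; d2; d3] \/ ~: r = [set e d1; e d2; e d3].
Proof.
move=> fr tr br.
have bdP x : x \in r -> e x \notin r -> x \in [set d1; d2; d3] by rewrite -br inE => -> ->.
have b_in : [/\ d1 \in bd r, d2 \in bd r & d3 \in bd r] by rewrite br !inE !eqxx !orbT.
case: b_in; rewrite !inE => /andP[r1 nr1] /andP[r2 nr2] /andP[r3 nr3].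
have ss x y : same_side m d1 d2 d3 x y -> (x \in r) = (y \in r).
  case/connectP => p; elim: p x => [|z p IH] x /=; first by move=> _ ->.
  case/andP => /orP[/eqP->|/andP[/eqP-> nx]] /IH H /H <-; first by rewrite fr.
  apply/idP/idP => [xr|exr]; apply/contraT => nr.
    by have := bdP _ xr nr; rewrite !inE; move: nx; rewrite !inE !negb_or => /and5P[/negbTE-> /negbTE-> /negbTE-> ].
  have := bdP _ exr; rewrite erevK // => /(_ nr); rewrite !inE !(inv_eq (erevK me)).
  by move: nx; rewrite !inE !negb_or => /and5P[_ _ _ /negbTE-> /andP[/negbTE-> /negbTE->]].
have K a b c x : triangle m a b c -> fconnect v a x ->
   ~~ off_triangle m a b c (f x) -> x = a \/ x = e c.
  case/and3P => ab bc ca ax; rewrite !negb_and !negbK => H.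
  have ef u : fconnect v u (f x) -> fconnect v (e x) u.
    by move=> uf; rewrite fc_sym; apply: fc_trans uf _; rewrite fc_sym fc_ef.
  case/or3P: H => /ef xu.
  - by have := noloop x; rewrite fc_sym (fc_trans xu ax).
  - by left; symmetry; apply: nopar => //; apply: fc_trans ab _; rewrite fc_sym.
  - right; apply: nopar' => //; rewrite fc_sym; apply: fc_trans ca ax.
have pos x : ~~ off_triangle m d1 d2 d3 x -> ~~ off_triangle m d1 d2 d3 (f x) ->
    x \in [set d1; d2; d3] \/ x \in [set e d1; e d2; e d3].
  have rot a b c y : off_triangle m b c a y = off_triangle m a b c y.
    by rewrite /off_triangle andbA andbC.
  move=> h1 oh; move: h1; rewrite /off_triangle !negb_and !negbK => /or3P[] cx.
  - by case: (K _ _ _ x tr cx oh) => ->; [left|right]; rewrite !inE eqxx ?orbT.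
  - have tr2 := triangle_rot tr; rewrite -rot in oh.
    by case: (K _ _ _ x tr2 cx oh) => ->; [left|right]; rewrite !inE eqxx ?orbT.
  - have tr3 := triangle_rot (triangle_rot tr); rewrite -rot -rot in oh.
    by case: (K _ _ _ x tr3 cx oh) => ->; [left|right]; rewrite !inE eqxx ?orbT.
have S1 : [set d1; d2; d3] \subset r.
  by apply/subsetP => x; rewrite !inE -orbA => /or3P[]/eqP->.
have S2 : [set e d1; e d2; e d3] \subset ~: r.
  by apply/subsetP => x; rewrite !inE -orbA => /or3P[]/eqP->.
case: (boolP [exists x in r, off_triangle m d1 d2 d3 x]) => [/exists_inP[x xr ox]|nx].
  right; apply/eqP; rewrite eqEsubset S2 andbT; apply/subsetP => y; rewrite inE => yr.
  have H z : z \notin r -> ~~ off_triangle m d1 d2 d3 z.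
    move=> zr; apply/negP => oz; case/negP: (nosep d1 d2 d3); rewrite /separating_triangle tr /=.
    apply/existsP; exists x; apply/existsP; exists z; rewrite ox oz /=.
    by apply/negP => /ss; rewrite xr (negbTE zr).
  case: (pos y (H _ yr) (H _ _)) => //; first by rewrite fr.
  by move/(subsetP S1); rewrite (negbTE yr).
left; apply/eqP; rewrite eqEsubset S1 andbT; apply/subsetP => y yr.
have H z : z \in r -> ~~ off_triangle m d1 d2 d3 z.
  by move=> zr; apply: contra nx => oz; apply/exists_inP; exists z.
case: (pos y (H _ yr) (H _ _)) => //; first by rewrite fr.
by move/(subsetP S2); rewrite inE yr.
Qed.

(* The origins of the three sides are distinct, so a face map preserving the
   set of the sides is the rotation of the triangle. *)
Lemma triangle_face d1 d2 d3 : triangle m d1 d2 d3 ->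
  f d1 \in [set d1; d2; d3] -> f d1 = d2.
Proof.
case/and3P => c12 c23 c31; rewrite !inE -orbA => /or3P[]/eqP // E.
  by have := noloop' d1; rewrite -{2}E fc_ef.
have : fconnect v d2 d3 by rewrite fc_sym -E; apply: fc_trans c12; rewrite fc_sym fc_ef.
by move=> c; have := noloop' d2; rewrite (fc_trans c23) // fc_sym.
Qed.

Definition tri3 (X : {set D}) := [set x | [&& x \in X, f x \in X, f (f x) \in X & f (f (f x)) == x]].

(** When [X] is a set of vertices this is the induced subgraph; for a union of faces, further on, it
    is the set of edges interior to the region. *)
Definition Gof (X : {set D}) := [set x in X | e x \in X].

Lemma Gof_closed X : eclosed m (Gof X).
Proof. by move=> x; rewrite !inE erevK // andbC. Qed.

Lemma tri3_f X x : (f x \in tri3 X) = (x \in tri3 X).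
Proof.
rewrite !inE (inj_eq (face_inj (m := m))); case: eqP => [->|]; rewrite ?andbF //.
by case: (x \in X); case: (f x \in X); case: (f (f x) \in X).
Qed.

Hypothesis mp : planar_map m.
Let mc : connected_map m. Proof. by case/and3P: mp. Qed.

(* A region of the complement of the graph induced by X has length at least 4,
   unless it is a triangular face. *)
Lemma region_length (X : {set D}) c : (forall x, (v x \in X) = (x \in X)) ->
  6 < #|Gof X| -> c \in cls (regR m (Gof X)) @: [set: D] -> #|Gof X :&: c| <= 3 ->
  [/\ c \subset tri3 X, #|c| = 3 & #|Gof X :&: c| = 3].
Proof.
move=> vX big /imsetP[x0 _ cE] small; set G := Gof X in big cE small *.
have Gc := Gof_closed X : eclosed m G.
have fr x : (f x \in c) = (x \in c) by rewrite cE cls_regR_f.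
have er x : x \notin G -> (e x \in c) = (x \in c) by rewrite cE => xG; rewrite cls_regR_e.
have bG : bd c \subset G :&: c.
  apply/subsetP => x; rewrite inE => /andP[xc nx]; rewrite in_setI xc andbT.
  by apply: contraNT nx => xG; rewrite er.
have x0c : x0 \in c by rewrite cE cls_refl.
have [b0|bn0] := eqVneq (bd c) set0.
  have ec x : x \in c -> e x \in c.
    move=> xc; apply/contraT => nx; have : x \in bd c by rewrite inE xc.
    by rewrite b0 inE.
  have all x : x \in c.
    have := conn_map mc x0 x; case/connectP => p; elim/last_ind: p x => [|p z IH] x /=; first by move=> _ ->.
    rewrite rcons_path last_rcons => /andP[/IH/(_ erefl) zc /orP[]/eqP E ->]; rewrite E; last exact: ec.
    by rewrite (vrot_face me) fr ec.
  have : #|G| <= 3 by apply: leq_trans small; apply: subset_leq_card; apply/subsetP => x xG; rewrite in_setI xG all.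
  lia.
have sb : #|bd c| <= 3 by apply: leq_trans small; apply: subset_leq_card.
have [d1 [d2 [d3 [tr be]]]] := bd_triangle fr bn0 sb.
have b3 : 3 <= #|bd c|.
  rewrite be; have /and3P[c12 c23 c31] := tr.
  have n12 : d1 != d2 by apply: contraTneq c12 => <-; exact: noloop'.
  have n23 : d2 != d3 by apply: contraTneq c23 => <-; exact: noloop'.
  have n31 : d3 != d1 by apply: contraTneq c31 => <-; exact: noloop'.
  by rewrite setUC cardsU1 cardsU1 cards1 !inE (negbTE n12) (eq_sym d3 d2) (negbTE n23) (negbTE n31).
have bGE : bd c = G :&: c by apply/eqP; rewrite eqEcard bG; lia.
(* In the second case everything off [c] is one reversed triangle, so the induced graph has at most
   the six darts of that triangle. This is the origin of the bound 6 in [big]. *)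
case: (triangle_side fr tr be) => rE; last first.
  have : #|G| <= 6.
    rewrite -(cardsID c) -bGE; have -> : 6 = 3 + 3 by []; apply: leq_add => //.
    apply: (@leq_trans #|~: c|).
      by apply: subset_leq_card; apply/subsetP => x; rewrite !inE => /andP[].
    by rewrite rE setUC cardsU1 cardsU1 cards1; case: (_ \notin _); case: (_ \notin _).
  lia.
have c3 : #|c| = 3.
  by rewrite -{1}be in rE; move: b3 sb; rewrite -rE; lia.
have cG x : x \in c -> x \in X.
  by rewrite rE -be bGE !inE => /andP[/andP[]].
split => //; last by rewrite -bGE; lia.
have F1 := triangle_face tr; have F2 := triangle_face (triangle_rot tr).
have F3 := triangle_face (triangle_rot (triangle_rot tr)).
have cin : [/\ d1 \in c, d2 \in c & d3 \in c] by rewrite rE !inE !eqxx !orbT.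
case: cin => i1 i2 i3.
have {}F1 : f d1 = d2 by apply: F1; rewrite -rE fr.
have {}F2 : f d2 = d3 by apply: F2; rewrite setUC setUA -rE fr.
have {}F3 : f d3 = d1 by apply: F3; rewrite -setUA setUC -rE fr.
apply/subsetP => x xc; rewrite inE !cG ?fr //=.
by move: xc; rewrite rE !inE -orbA => /or3P[]/eqP->; rewrite ?(F1,F2,F3).
Qed.

Definition nvert (X : {set D}) := #|cls (frel v) @: X|.

Lemma nvertC (X : {set D}) : (forall x, (v x \in X) = (x \in X)) ->
  nvert X + nvert (~: X) = ncl (frel v).
Proof.
move=> vX; have cX : closed (frel v) (mem X) by move=> x y /eqP <-; rewrite [RHS]vX.
rewrite /nvert !card_cls_imset //; first last.
  by move=> x y /eqP <-; rewrite !inE vX.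
rewrite -ncl_n_comp // (n_compC (mem X)); congr (_ + _); apply: eq_n_comp_r => x.
by rewrite !inE.
Qed.

(** The vertices off [X] are isolated in the graph [H], and [X] adds at least one component. *)
Lemma ncl_verR_ge (X H : {set D}) (x0 : D) : (forall x, (v x \in X) = (x \in X)) ->
  eclosed m H -> H \subset Gof X -> x0 \in X ->
  ncl (frel v) + 1 <= ncl (verR m H) + nvert X.
Proof.
move=> vX Hc HX x0X.
clear nosep mp mc; clear ms.
suff: nvert (~: X) < ncl (verR m H) by have := nvertC vX; lia.
rewrite /nvert.
have HX' x : x \in H -> x \in X /\ e x \in X.
  by move/(subsetP HX); rewrite inE => /andP[].
have -> : cls (frel v) @: (~: X) = cls (verR m H) @: (~: X).
  apply: eq_in_imset => x; rewrite inE => xX; apply/setP => y; rewrite !inE.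
  apply/idP/idP; first exact: verR_vrot.
  case/connectP => p; elim/last_ind: p y => [|p z IH] y /=; first by move=> _ ->.
  rewrite rcons_path last_rcons => /andP[/IH/(_ erefl) zc] K ->; case/orP: K => [/eqP->|/andP[_ zG]].
    by apply: connect_trans zc _; exact: fconnect1.
  by move: xX; rewrite (vclosed vX zc) (HX' _ zG).1.
have cX : closed (verR m H) (mem (~: X)).
  move=> a b /orP[/eqP->|/andP[/eqP-> aG]]; rewrite !inE ?vX //.
  by rewrite (HX' _ aG).1 (HX' _ aG).2.
rewrite card_cls_imset //; last exact: verR_sym.
by apply: (ncl_ltn_sub (x := x0)) => //; [exact: verR_sym|rewrite inE x0X].
Qed.

(** With E edges, k vertices and t triangular faces, this is three times 2E + 8 <= 4k + t. There are
    at least E - k + 2 regions, and by [region_length] all have length at least 4 except the t faces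
    of length 3. *)
Theorem induced_edges (X : {set D}) : (forall x, (v x \in X) = (x \in X)) ->
  6 < #|Gof X| -> 3 * #|Gof X| + 24 <= 12 * nvert X + #|tri3 X|.
Proof.
move=> vX big; set G := Gof X.
have Gc := Gof_closed X : eclosed m G.
have /card_gt0P[x0 x0G] : 0 < #|G| by rewrite /G; lia.
have x0X : x0 \in X by move: x0G; rewrite inE => /andP[].
have := RC_ge me mc mp x0 Gc; set R := ncl (regR m G).
have K1 := ncl_verR_ge vX Gc (subxx _) x0X; rewrite -/G in K1.
have Rle : 12 * R <= 3 * #|G| + #|tri3 X|.
  have rs := regR_sym me Gc.
  rewrite (sum_card_cls G rs) (sum_card_cls (tri3 X) rs) big_distrr -big_split /=.
  rewrite /R /ncl -sum1_card big_distrr /=; apply: leq_sum => c cR.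
  case: (leqP #|G :&: c| 3) => [sm|]; last by lia.
  have [ct c3 g3] := region_length vX big cR sm.
  by rewrite g3 (setIidPr ct) c3.
have ev : #|G| = (#|G|./2).*2 by rewrite (card_eclosed me Gc) doubleK.
move=> RC; rewrite {1}ev; rewrite ev in Rle; lia.
Qed.

End Regions.

(** * Hall's theorem with capacities *)

Section Hall.
Variables (F V : finType) (N : F -> {set V}) (v0 : V).
Definition nbh (W : {set F}) := \bigcup_(c in W) N c.

Lemma nbhU U W : nbh (U :|: W) = nbh U :|: nbh W.
Proof. exact: bigcup_setU. Qed.

(* Halmos-Vaughan induction, with capacities. *)
Lemma hall (A : {set F}) (cap : V -> nat) :
  (forall W : {set F}, W \subset A -> #|W| <= \sum_(w in nbh W) cap w) ->
  exists s : F -> V, (forall c, c \in A -> s c \in N c) /\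
    forall w, #|[set c in A | s c == w]| <= cap w.
Proof.
move: {2}#|A| (leqnn #|A|) => n; elim: n A cap => [|n IH] A cap.
  rewrite leqn0 cards_eq0 => /eqP-> _; exists (fun=> v0); split=> [c|w]; rewrite ?inE //.
  suff -> : [set c in (set0 : {set F}) | v0 == w] = set0 by rewrite cards0.
  by apply/setP => c; rewrite !inE.
move=> cA hA; have [A0|[c0 c0A]] := set_0Vmem A.
  by apply: IH => //; rewrite A0 cards0.
(* A tight proper subset [W] exhausts the capacity of its neighbours. It is assigned first, and the
   rest keeps Hall's condition after these capacities are set to 0. *)
case: (boolP [exists W : {set F}, [&& W \proper A, W != set0 & #|W| == \sum_(w in nbh W) cap w]]).
  case/existsP => W /and3P[Wp Wn /eqP tW]; have Ws := proper_sub Wp.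
  have cWA := proper_card Wp.
  have [||s1 [s1N s1c]] := IH W cap; first by lia.
    by move=> U UW; apply/hA/(subset_trans UW).
  pose cap' w := if w \in nbh W then 0 else cap w.
  have cD : #|A :\: W| <= n by rewrite cardsDS //; move: Wn; rewrite -card_gt0; lia.
  have [|s2 [s2N s2c]] := IH (A :\: W) cap' cD.
    move=> U; rewrite subsetD => /andP[UA dUW].
    have : U :|: W \subset A by rewrite subUset UA.
    move/hA; rewrite cardsU disjoint_setI0 // cards0 subn0 nbhU tW.
    have -> : \sum_(w in nbh U :|: nbh W) cap w =
        \sum_(w in nbh U :\: nbh W) cap w + \sum_(w in nbh W) cap w.
      rewrite (big_setID (nbh W)) /= addnC setDUl setDv setU0; congr (_ + _).
      by apply: eq_bigl => x; rewrite !inE andbC; case: (x \in nbh W); rewrite ?orbT.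
    rewrite leq_add2r => /leq_trans; apply.
    rewrite [X in _ <= X](big_setID (nbh W)) /=.
    rewrite [X in _ <= X + _]big1 ?add0n; last by move=> w; rewrite /cap' inE => /andP[_ ->].
    by apply: leq_sum => w; rewrite /cap' inE => /andP[/negbTE->].
  exists (fun c => if c \in W then s1 c else s2 c); split=> [c cAc|w].
    by case: ifP => cW; [apply: s1N|apply: s2N; rewrite inE cW].
  have -> : [set c in A | (if c \in W then s1 c else s2 c) == w]
     = [set c in W | s1 c == w] :|: [set c in A :\: W | s2 c == w].
    apply/setP => c; rewrite !inE; case: (boolP (c \in W)) => cW /=; last by [].
    by rewrite (subsetP Ws) // orbF.
  apply: leq_trans (leq_card_setU _ _) _.
  have := s2c w; rewrite /cap'; case: ifP => wW.
    by rewrite leqn0 => /eqP->; rewrite addn0; exact: s1c.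
  suff -> : [set c in W | s1 c == w] = set0 by rewrite cards0.
  apply/setP => c; rewrite !inE.
  apply/negP => /andP[cW /eqP E]; move/negP: wW; case; apply/bigcupP; exists c => //.
  by rewrite -E s1N.
(* Without a tight proper subset each condition has a slack of 1, which pays for the assignment of
   [c0] to [w0]. *)
rewrite negb_exists => /forallP nt.
have : 0 < \sum_(w in N c0) cap w.
  have := hA [set c0]; rewrite sub1set c0A cards1 /nbh big_set1; exact.
rewrite lt0n sum_nat_eq0 negb_forall => /existsP[w0]; rewrite negb_imply -lt0n => /andP[w0N w0c].
pose cap' w := cap w - (w == w0).
have [||s [sN sc]] := IH (A :\ c0) cap'; first by have := cardsD1 c0 A; rewrite c0A; lia.
  move=> U UA; have [->|Un] := eqVneq U set0; first by rewrite cards0.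
  have Up : U \proper A.
    apply: sub_proper_trans UA _; apply/properP; split; first exact: subsetDl.
    by exists c0; rewrite // !inE eqxx.
  have := hA _ (proper_sub Up); have := nt U; rewrite Up Un /= => H1 H2.
  have {H1 H2} H : #|U| < \sum_(w in nbh U) cap w by rewrite ltn_neqAle H1.
  have : \sum_(w in nbh U) cap w <= \sum_(w in nbh U) cap' w + 1.
    case: (boolP (w0 \in nbh U)) => w0U.
      rewrite (bigD1 w0) //= [X in _ <= X + _](bigD1 w0) //= /cap' eqxx.
      rewrite (eq_bigr (fun w => cap w - (w == w0))); first by lia.
      by move=> w /andP[_ /negbTE->]; rewrite subn0.
    rewrite (eq_bigr cap'); first by lia.
    move=> w wU; rewrite /cap'; case: eqP => [E|]; last by rewrite subn0.
    by rewrite E (negbTE w0U) in wU.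
  lia.
exists (fun c => if c == c0 then w0 else s c); split=> [c cAc|w].
  by case: eqP => [->//|/eqP n0]; apply: sN; rewrite !inE n0.
have sb : [set c in A | (if c == c0 then w0 else s c) == w] \subset
  [set c in A :\ c0 | s c == w] :|: (if w == w0 then [set c0] else set0).
  apply/subsetP => c; rewrite !inE => /andP[cAc]; case: (eqVneq c c0) => [->|nc] /=.
    by move=> /eqP <-; rewrite !eqxx ?in_set1 ?eqxx ?orbT.
  by move=> sw; rewrite cAc sw.
apply: leq_trans (subset_leq_card sb) _; apply: leq_trans (leq_card_setU _ _) _.
apply: leq_trans (leq_add (sc w) (leqnn _)) _; rewrite /cap'; case: eqP => [->|_].
  by rewrite cards1; lia.
by rewrite cards0; lia.
Qed.

End Hall.

(** * The outer 4-cycle, and Hall's condition for the inner faces *)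

Section Irreducible.
Variables (D : finType) (m : cmap D) (o : D).
Local Notation v := (vrot m).
Local Notation e := (erev m).
Local Notation f := (face m).
Local Notation inn := (inner_vertex m o).
Local Notation outd := (outer_dart m o).

Hypothesis it : irreducible_triangulation m o.
Variable w0 : D.
Hypothesis iw0 : inn w0.

Lemma eq_clsv x y : (cls (frel v) x == cls (frel v) y) = fconnect v x y.
Proof. exact: (eq_cls _ _ (fc_symv m)). Qed.

Lemma eq_clsf x y : (cls (frel f) x == cls (frel f) y) = fconnect f x y.
Proof. exact: (eq_cls _ _ (fc_symf m)). Qed.

Lemma irr_planar : planar_map m. Proof. by case/and5P: it. Qed.
Lemma irr_edges : edges_ok m. Proof. by case/and3P: irr_planar. Qed.
Lemma irr_conn : connected_map m. Proof. by case/and3P: irr_planar. Qed.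
Lemma irr_simple : simple_map m. Proof. by case/and5P: it. Qed.
Lemma irr_nosep d1 d2 d3 : ~~ separating_triangle m d1 d2 d3.
Proof. by case/and5P: it => _ _ _ _ /forallP/(_ d1)/forallP/(_ d2)/forallP/(_ d3). Qed.
Let mp := irr_planar.
Let me := irr_edges.
Let mc := irr_conn.
Let ms := irr_simple.
Let fi : injective f := @face_inj _ m.
Let sf : connect_sym (frel f) := fc_symf m.

Lemma outd_o : outd o. Proof. exact: connect0. Qed.

Lemma outd_trans x y : outd x -> outd y -> fconnect f x y.
Proof. by move=> ox oy; rewrite (connect_trans _ oy) // sf. Qed.

Lemma order_outd x : outd x -> fingraph.order f x = 4.
Proof.
move=> ox; case/and5P: it => _ _ /eqP <- _ _; apply: eq_card => y.
by rewrite !inE /= (same_connect sf ox).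
Qed.

Lemma out4 x : outd x -> f (f (f (f x))) = x.
Proof. by move=> ox; have := iter_order fi x; rewrite (order_outd ox). Qed.

Lemma outdP x y : outd x -> outd y -> [\/ y = x, y = f x, y = f (f x) | y = f (f (f x))].
Proof.
move=> ox oy; have := outd_trans ox oy; rewrite fconnect_orbit /fingraph.orbit (order_outd ox) /= !inE.
by case/or4P => /eqP->; [constructor 1|constructor 2|constructor 3|constructor 4].
Qed.

Lemma out_uniq x : outd x -> uniq [:: x; f x; f (f x); f (f (f x))].
Proof. by move=> ox; have := orbit_uniq f x; rewrite /fingraph.orbit (order_outd ox). Qed.

Lemma in3 x : ~~ outd x -> f (f (f x)) = x.
Proof.
move=> ox; case/and5P: it => _ _ _ /forallP/(_ x)/implyP/(_ ox)/eqP o3 _.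
by have := iter_order fi x; rewrite o3.
Qed.

Lemma face_neq x : f x != x.
Proof. by apply/eqP => E; have := noloop' ms x; rewrite -{2}E fc_ef. Qed.

(** The outer cycle is simple. If two opposite corners coincided, simplicity would fold the four
    outer darts into two edges, closed under both permutations: they would be the whole map, leaving
    no room for the inner vertex of [w0]. *)
Lemma out_vertex x y : outd x -> outd y -> fconnect v x y -> y = x.
Proof.
move=> ox oy cxy.
have fx z : fconnect v (e z) (f z) by exact: fc_ef.
have [|E|E|E] // := outdP ox oy.
- by have := noloop ms x; rewrite (fc_trans cxy) // E fc_sym fx.
- have O1 : f x = e x.
    apply: nopar' => //; first by rewrite fc_sym fx.
    by apply: fc_trans (fx _) _; rewrite -E fc_sym.
  have O2 : f y = e y.
    apply: nopar' => //; first by rewrite fc_sym fx.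
    apply: fc_trans (fx _) _; rewrite E out4 // -E; exact: cxy.
  pose S := [set x; e x; y; e y].
  have vS z : z \in S -> v z \in S.
    rewrite (vrot_face me) !inE -!orbA => /or4P[]/eqP->; rewrite ?erevK //.
    - by rewrite -O1 -E eqxx !orbT.
    - by rewrite O1 eqxx !orbT.
    - by rewrite -O2 E out4 // eqxx.
    - by rewrite O2 eqxx !orbT.
  have eS z : z \in S -> e z \in S.
    by rewrite !inE -!orbA => /or4P[]/eqP->; rewrite ?erevK // eqxx ?orbT.
  have : w0 \in S.
    case/connectP: (conn_map mc x w0) => p; elim/last_ind: p (w0) => [|p z IH] w /=.
      by move=> _ ->; rewrite !inE eqxx.
    rewrite rcons_path last_rcons => /andP[/IH/(_ erefl) zc /orP[]/eqP Ez ->]; rewrite Ez; [exact: vS|exact: eS].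
  suff /(_ w0) H z : z \in S -> outd z by move/H/outd_ninn; rewrite iw0.
  by rewrite !inE -!orbA -O1 -O2 => /or4P[]/eqP->; rewrite ?outd_f.
- have E' : f y = x by rewrite E out4.
  by have := noloop' ms y; rewrite (fc_trans (fx y)) // E'.
Qed.

Lemma outd_e x : outd x -> ~~ outd (e x).
Proof.
move=> ox; apply/negP => oex.
have E : f x = e x by apply: out_vertex oex _ (fc_ef m x); rewrite outd_f.
have E2 : f (f x) = x.
  apply: out_vertex; rewrite ?outd_f // E -(vrot_face me); exact: fconnect1.
by have := out_uniq ox; rewrite E2 /= !inE eqxx !orbT.
Qed.

Definition Xo := [set x | ~~ inn x].

Lemma Xo_v x : (v x \in Xo) = (x \in Xo).
Proof. by rewrite !inE inn_vrot. Qed.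

Lemma Yi_v x : (v x \in ~: Xo) = (x \in ~: Xo).
Proof. by rewrite !inE inn_vrot. Qed.

Lemma card_outd : #|[set x | outd x]| = 4.
Proof.
rewrite -(@order_outd o); last exact: connect0.
by apply: eq_card => x; rewrite !inE.
Qed.

Lemma nvert_Xo : nvert m Xo = 4.
Proof.
rewrite -card_outd /nvert.
have -> : cls (frel v) @: Xo = cls (frel v) @: [set x | outd x].
  apply/setP => c; apply/imsetP/imsetP => -[x]; rewrite inE => H ->.
    case/innP: H => y oy yx; exists y; rewrite ?inE //.
    by apply/eqP; rewrite eq_clsv (fc_sym m).
  by exists x; rewrite // inE; exact: outd_ninn.
rewrite card_in_imset // => x y; rewrite !inE => ox oy /eqP.
by rewrite eq_clsv => c; rewrite (out_vertex ox oy c).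
Qed.

Lemma tri3_nout X x : x \in tri3 m X -> ~~ outd x.
Proof.
rewrite inE => /and4P[_ _ _ /eqP E]; apply/negP => /out_uniq.
by rewrite E /= !inE eqxx !orbT.
Qed.

Definition ring8 := [set x | outd x || outd (e x)].

Lemma card_ring8 : #|ring8| = 8.
Proof.
have -> : ring8 = [set x | outd x] :|: e @^-1: [set x | outd x].
  by apply/setP => x; rewrite !inE.
rewrite cardsU disjoint_setI0; last first.
  by apply/pred0P => x; rewrite /= !inE; apply/negP => /andP[/outd_e/negbTE->].
by rewrite cards0 subn0 card_preimset ?card_outd //; exact: perm_inj.
Qed.

Lemma ring8_sub : ring8 \subset Gof m Xo.
Proof.
apply/subsetP => x; rewrite !inE => /orP[] ox; rewrite (outd_ninn ox) ?andbT /=.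
  by rewrite -inn_vrot outd_ninn // -/(f x) outd_f.
by rewrite -inn_vrot (vrot_face me) outd_ninn // outd_f.
Qed.

(** A fifth edge among the four outer vertices makes [induced_edges] tight, with exactly 10 darts.
    Then all non-outer darts of the induced graph bound triangles on these vertices, the graph is
    closed under both permutations, and there is no inner vertex. *)
Lemma nochord x : ~~ inn x -> ~~ inn (e x) -> outd x || outd (e x).
Proof.
move=> nx nex; case: (boolP (x \in ring8)); rewrite inE // => xr.
have sb : [set x; e x] :|: ring8 \subset Gof m Xo.
  rewrite subUset ring8_sub andbT; apply/subsetP => y; rewrite !inE.
  by case/orP => /eqP->; rewrite ?erevK // nx nex.
have c10 : 10 <= #|Gof m Xo|.
  apply: leq_trans (subset_leq_card sb); rewrite cardsU disjoint_setI0.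
    by rewrite cards0 subn0 cards2 card_ring8 eq_sym erev_neq.
  apply/pred0P => y; rewrite /= !inE; apply/negP => /andP[/orP[]/eqP->]; rewrite ?erevK //.
    exact: negP.
  by rewrite orbC; exact: negP.
have := induced_edges me ms irr_nosep mp Xo_v (leq_trans _ c10); rewrite nvert_Xo => /(_ isT) K.
have ts : tri3 m Xo \subset Gof m Xo :\: [set x | outd x].
  apply/subsetP => y yt; rewrite in_setD inE (tri3_nout yt) /=.
  by move: yt; rewrite !inE => /and4P[-> fy _ _]; rewrite -inn_vrot -/(f y).
have cG : #|Gof m Xo :\: [set x | outd x]| + 4 = #|Gof m Xo|.
  rewrite -card_outd cardsDS ?subnK //.
    by apply/subset_leq_card/(subset_trans _ ring8_sub)/subsetP => y; rewrite !inE => ->.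
  by apply/(subset_trans _ ring8_sub)/subsetP => y; rewrite !inE => ->.
have ct := subset_leq_card ts.
have {}ts : tri3 m Xo = Gof m Xo :\: [set x | outd x] 
  by apply/eqP; rewrite eqEcard ts /=; move: cG K c10; clear; lia.
have Gf y : y \in Gof m Xo -> f y \in Gof m Xo.
  move=> yG; case: (boolP (outd y)) => oy; first by apply: (subsetP ring8_sub); rewrite inE outd_f oy.
  have : f y \in tri3 m Xo by rewrite tri3_f ts in_setD inE oy.
  by rewrite ts in_setD => /andP[].
have Ge := Gof_closed me Xo.
have : w0 \in Gof m Xo.
  have : o \in Gof m Xo by apply: (subsetP ring8_sub); rewrite inE outd_o.
  case/connectP: (conn_map mc o w0) => p; elim/last_ind: p (w0) => [|p z IH] w /=; first by move=> _ ->.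
  rewrite rcons_path last_rcons => /andP[pp /orP[]/eqP Ez ->] oG; have := IH _ pp erefl oG; rewrite Ez ?Ge //.
  by move=> H; rewrite (vrot_face me) Gf // Ge.
by rewrite !inE iw0.
Qed.

Lemma Gof_Xo : Gof m Xo = ring8.
Proof.
apply/eqP; rewrite eqEsubset ring8_sub andbT; apply/subsetP => x; rewrite !inE => /andP[].
exact: nochord.
Qed.

(** Otherwise, by [nochord], the three sides of the face are outer edges, and the outer face closes
    up after three steps. *)
Lemma inner_corner x : ~~ outd x -> [|| inn x, inn (f x) | inn (f (f x))].
Proof.
move=> ox; apply/contraT; rewrite !negb_or => /and3P[n1 n2 n3].
have H y : ~~ outd y -> ~~ inn y -> ~~ inn (f y) -> outd (e y).
  by move=> oy ny nfy; have := nochord ny; rewrite -(inn_vrot m o (e y)) => /(_ nfy); rewrite (negbTE oy).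
have o1 := H _ ox n1 n2; have o2 : outd (e (f x)) by apply: H; rewrite // outd_f.
have o3 : outd (e (f (f x))) by apply: H; rewrite ?in3 ?outd_f.
have K y : outd (e y) -> outd (e (f y)) -> f (e (f y)) = e y.
  move=> oy ofy; apply: out_vertex => //; first by rewrite outd_f.
  apply: fc_trans (fc_ef m y) _; rewrite -(vrot_face me); exact: fconnect1.
have k1 := K _ o1 o2; have k2 := K _ o2 o3.
have k3 := K _ o3; rewrite in3 // in k3; have {}k3 := k3 o1.
by have := out_uniq o1; rewrite k3 k2 k1 /= !inE eqxx !orbT.
Qed.

Definition nin := nvert m (~: Xo).

(** Euler's formula with [nin + 4] vertices, one face of length 4 and all others of length 3. *)
Lemma card_darts : #|D| = 6 * nin + 10.
Proof.
have V := nvertC Xo_v; rewrite nvert_Xo -/nin in V.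
have E := euler me mp; have N := ncl_erev me.
have F : #|D| = 3 * ncl (frel f) + 1.
  have c0 : cls (frel f) o \in cls (frel f) @: [set: D] by apply: imset_f.
  rewrite -cardsT (sum_card_cls _ sf) /ncl (bigD1 _ c0) /=.
  rewrite (eq_bigr (fun=> 3)); last first.
    move=> c /andP[/imsetP[x _ ->]]; rewrite eq_clsf sf => ox; rewrite setTI.
    case/and5P: it => _ _ _ /forallP/(_ x)/implyP/(_ ox)/eqP o3 _.
    by rewrite -o3; apply: eq_card => y; rewrite !inE.
  rewrite setTI -[#|cls _ _|]/#|[set x | outd x]| card_outd sum_nat_const.
  rewrite (cardsD1 (cls (frel f) o)) c0 /=.
  have -> : #|[pred i in cls (frel f) @: [set: D] | i != cls (frel f) o]| =
     #|(cls (frel f) @: [set: D]) :\ cls (frel f) o|.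
    by apply: eq_card => c; rewrite !inE andbC.
  by rewrite [_ * 3]mulnC mulnDr addnAC.
lia.
Qed.

Lemma inner_vertices_nin : inner_vertices m o = nin.
Proof.
rewrite /inner_vertices /nin /nvert card_cls_imset; last 2 first.
- exact: fc_symv.
- by move=> x y /eqP<-; rewrite !inE inn_vrot.
by apply: eq_n_comp_r => x; rewrite !inE negbK.
Qed.

(* A face with corners on both sides of a cut has exactly one side leaving Y. *)
Lemma cut_faces (Y : {set D}) : Y \subset ~: Xo -> (forall x, (v x \in Y) = (x \in Y)) ->
  #|tri3 m Y| + #|tri3 m (~: Y)| + 3 * #|Y :\: Gof m Y| = 6 * nin + 6.
Proof.
move=> Yi Yv; have fY x : (f x \in Y) = (e x \in Y) by exact: Yv.
have oY x : outd x -> x \notin Y.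
  by move=> ox; apply/negP => /(subsetP Yi); rewrite !inE outd_ninn.
pose c x : nat := (x \in Y) && (f x \notin Y).
pose no := [set x | ~~ outd x].
have cno : #|no| = 6 * nin + 6.
  have := cardsC [set x | outd x]; rewrite card_outd card_darts.
  by rewrite [~: _](_ : _ = no); [lia|apply/setP => x; rewrite !inE].
have nof x : (f x \in no) = (x \in no) by rewrite !inE outd_f.
have t1 X : #|tri3 m X| = \sum_(x in no) (x \in tri3 m X).
  rewrite -sum1_card big_mkcond [RHS]big_mkcond /=; apply: eq_bigr => x _.
  case: (boolP (x \in tri3 m X)) => [/tri3_nout ox|]; first by rewrite inE ox.
  by case: ifP.
have sc : \sum_(x in no) c x = #|Y :\: Gof m Y|.
  rewrite -sum1_card big_mkcond [RHS]big_mkcond /=; apply: eq_bigr => x _.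
  rewrite /c fY !inE; case: (boolP (x \in Y)) => xY; rewrite ?andbT ?andbF ?if_same //=.
  by rewrite (contraL (@oY x)) //; case: (e x \in Y).
have sh (g : D -> nat) : \sum_(x in no) g (f x) = \sum_(x in no) g x.
  rewrite [RHS](reindex_inj fi) /=; apply: eq_bigl => x; by rewrite nof.
have sc1 := sh c; have sc2 := sh (fun x => c (f x)).
rewrite -cno (t1 Y) (t1 (~: Y)) -[in RHS]sum1_card.
have -> : 3 * #|Y :\: Gof m Y| = \sum_(x in no) c x + \sum_(x in no) c (f x) + \sum_(x in no) c (f (f x)).
  by rewrite sc2 sc1 sc; lia.
rewrite -!big_split /=; apply: eq_bigr => x; rewrite !inE => ox.
rewrite /c in3 // eqxx !andbT.
by case: (x \in Y); case: (f x \in Y); case: (f (f x) \in Y).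
Qed.

(** Three times Hall's condition: the triangles with all corners in [Y] are at most the sum of deg -
    4 over the vertices of [Y]. The edge bound is applied to the complement of [Y], which contains
    the outer cycle, and [cut_faces] carries it over to [Y]. *)
Lemma capacity (Y : {set D}) : Y \subset ~: Xo -> (forall x, (v x \in Y) = (x \in Y)) ->
  #|tri3 m Y| + 12 * nvert m Y <= 3 * #|Y|.
Proof.
move=> Yi Yv; have C := cut_faces Yi Yv.
have Yv' x : (v x \in ~: Y) = (x \in ~: Y) by rewrite !inE Yv.
have GX : 8 <= #|Gof m (~: Y)|.
  rewrite -card_ring8 -Gof_Xo; apply: subset_leq_card; apply/subsetP => x.
  have H z : z \in Xo -> z \notin Y by move=> zX; apply/negP => /(subsetP Yi); rewrite inE zX.
  by rewrite /Gof !inE => /andP[nx nex]; rewrite !H // inE.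
have K := induced_edges me ms irr_nosep mp Yv' ltac:(lia).
have N1 := nvertC Xo_v; have N2 := nvertC Yv; rewrite nvert_Xo -/nin in N1.
have cD := cardsC Y; have D6 := card_darts.
have a1 : #|Y :\: Gof m Y| + #|Gof m Y| = #|Y|.
  by rewrite -(cardsID (Gof m Y) Y) addnC (setIidPr _) //; apply/subsetP => x; rewrite !inE => /andP[].
have a2 : #|Y :\: Gof m Y| + #|Gof m (~: Y)| = #|~: Y|.
  rewrite -(cardsID (Gof m (~: Y)) (~: Y)) addnC (setIidPr _) //; last first.
    by apply/subsetP => x; rewrite !inE => /andP[].
  congr (_ + _); rewrite -(card_preimset _ (@perm_inj _ e)); apply: eq_card => x; rewrite !inE erevK //.
  by case: (x \in Y); case: (e x \in Y).
lia.
Qed.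

(** For the whole interior there is equality, since the outer vertices span only the four outer
    edges and no inner face. This later forces every vertex to be used to its full capacity. *)
Lemma capacity_all : #|tri3 m (~: Xo)| + 12 * nin = 3 * #|~: Xo|.
Proof.
have C := cut_faces (subxx _) Yi_v; rewrite setCK in C.
have t0 : tri3 m Xo = set0.
  apply/setP => x; rewrite in_set0; apply/negP => xt.
  have := inner_corner (tri3_nout xt); move: xt; rewrite !inE => /and4P[n1 n2 n3 _].
  by rewrite (negbTE n1) (negbTE n2) (negbTE n3).
have cD := cardsC Xo; have D6 := card_darts.
have a2 : #|~: Xo :\: Gof m (~: Xo)| + #|Gof m Xo| = #|Xo|.
  rewrite -(cardsID (Gof m Xo) Xo) addnC (setIidPr _) //; last first.
    by apply/subsetP => x; rewrite !inE => /andP[].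
  congr (_ + _); rewrite -(card_preimset _ (@perm_inj _ e)); apply: eq_card => x; rewrite !inE erevK //.
  by case: (inn x); case: (inn (e x)).
rewrite Gof_Xo card_ring8 in a2; rewrite t0 cards0 in C; lia.
Qed.

End Irreducible.

Lemma card_closed (T : finType) (s : T -> T) (Y P : {set T}) : injective s ->
  (forall x, (s x \in Y) = (x \in Y)) ->
  #|P :&: Y| = \sum_(c in cls (frel s) @: Y) #|P :&: c|.
Proof.
move=> si sY; have ss := fconnect_sym si.
rewrite -sum1_card (partition_big (cls (frel s)) (mem (cls (frel s) @: Y))) /=; last first.
  by move=> x; rewrite inE => /andP[_ xY]; apply: imset_f.
apply: eq_bigr => c /imsetP[x xY ->]; rewrite -sum1_card; apply: eq_bigl => y.
rewrite (eq_cls _ _ ss) ss !in_setI mem_cls -andbA; apply: andb_id2l => _.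
apply: andb_idl => cxy; have cY : closed (frel s) (mem Y) by move=> a b /eqP <-; rewrite [RHS]sY.
by have := closed_connect cY cxy; rewrite [in X in X -> _](_ : (x \in mem Y) = true) // => <-.
Qed.

(** * Existence of a stem system *)

Section Exists.
Variables (D : finType) (m : cmap D) (o : D).
Local Notation v := (vrot m).
Local Notation e := (erev m).
Local Notation f := (face m).
Local Notation inn := (inner_vertex m o).
Local Notation outd := (outer_dart m o).
Hypothesis it : irreducible_triangulation m o.
Variable w0 : D.
Hypothesis iw0 : inn w0.
Let mp := irr_planar it.
Let ms := irr_simple it.
Let fi : injective f := @face_inj _ m.
Let sf : connect_sym (frel f) := fc_symf m.
Let vi : injective v := @perm_inj _ v.

Lemma in_face x y : ~~ outd x -> fconnect f x y -> [\/ y = x, y = f x | y = f (f x)].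
Proof.
move=> ox; case/and5P: it => _ _ _ /forallP/(_ x)/implyP/(_ ox)/eqP o3 _.
rewrite fconnect_orbit /fingraph.orbit o3 /= !inE.
by case/or3P => /eqP->; [constructor 1|constructor 2|constructor 3].
Qed.

Lemma face_vertex x y : ~~ outd x -> fconnect f x y -> fconnect v x y -> y = x.
Proof.
move=> ox cf cv; case: (in_face ox cf) => // E.
  by have := noloop' ms x; rewrite (fc_trans (fc_ef m x)) // -E (fc_sym m).
have E' : f y = x by rewrite E (in3 it ox).
by have := noloop' ms y; rewrite (fc_trans (fc_ef m y)) // E'.
Qed.

Lemma outd_fc x y : fconnect f x y -> outd x = outd y.
Proof. by move=> c; rewrite /outer_dart ![fconnect f o _]sf (same_connect sf c). Qed.

Lemma card_face3 x : ~~ outd x -> #|cls (frel f) x| = 3.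
Proof.
move=> ox; case/and5P: it => _ _ _ /forallP/(_ x)/implyP/(_ ox)/eqP <- _.
by apply: eq_card => y; rewrite !inE.
Qed.

Let Yi := ~: Xo m o.
Let T := tri3 m Yi.
Let A := cls (frel f) @: T.
Let N (c : {set D}) : {set {set D}} := cls (frel v) @: c.

Lemma inYi x : (x \in Yi) = inn x. Proof. by rewrite !inE negbK. Qed.

Lemma T_fc x y : fconnect f x y -> (x \in T) = (y \in T).
Proof.
move=> c; have cT : closed (frel f) (mem T) by move=> a b /eqP <-; rewrite [RHS]tri3_f.
exact: (closed_connect cT).
Qed.

Lemma T_inn x : x \in T -> inn x.
Proof. by rewrite inE => /and4P[]; rewrite inYi. Qed.

(** The bound of [capacity] for a single vertex, which spans no triangle. *)
Lemma vertex4 x : inn x -> 4 <= #|cls (frel v) x|.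
Proof.
move=> ix; set w := cls (frel v) x.
have wv y : (v y \in w) = (y \in w) by rewrite !mem_cls -(same_fconnect1_r vi).
have wY : w \subset ~: Xo m o.
  by apply/subsetP => y; rewrite mem_cls => c; rewrite inYi -(inn_v o c).
have := capacity it iw0 wY wv.
have -> : nvert m w = 1.
  apply/eqP/cards1P; exists w; apply/setP => c; rewrite inE; apply/imsetP/eqP => [[y yw ->]|->].
    by apply/eqP; rewrite eq_clsv (fc_sym m) -mem_cls.
  by exists x; rewrite ?cls_refl.
lia.
Qed.

Lemma card_Y (Y : {set D}) : (forall x, (v x \in Y) = (x \in Y)) ->
  #|Y| = \sum_(w in cls (frel v) @: Y) #|w|.
Proof.
move=> Yv; rewrite -{1}(setTI Y) (card_closed _ vi Yv); apply: eq_bigr => c _; by rewrite setTI.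
Qed.

Lemma sum_cap (Y : {set D}) : Y \subset Yi -> (forall x, (v x \in Y) = (x \in Y)) ->
  \sum_(w in cls (frel v) @: Y) (#|w| - 4) + 4 * nvert m Y = #|Y|.
Proof.
move=> Yi' Yv; rewrite (card_Y Yv) /nvert -sum1_card big_distrr -big_split /=.
apply: eq_bigr => w /imsetP[x xY ->]; rewrite subnK // vertex4 //.
by rewrite -inYi (subsetP Yi').
Qed.

Lemma hall_cond (W : {set {set D}}) : W \subset A -> #|W| <= \sum_(w in nbh N W) (#|w| - 4).
Proof.
move=> WA; pose Y := [set y | cls (frel v) y \in nbh N W].
have clv y : cls (frel v) (v y) = cls (frel v) y.
  by apply/eqP; rewrite eq_clsv (fc_sym m) fconnect1.
have Yv y : (v y \in Y) = (y \in Y) by rewrite !inE clv.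
have inW c x : c \in W -> x \in c -> x \in T /\ x \in Y.
  move=> cW xc; split; last by rewrite inE; apply/bigcupP; exists c => //; apply: imset_f.
  have /imsetP[t tT ct] := subsetP WA _ cW; move: xc; rewrite ct mem_cls => /T_fc <-; exact: tT.
have NY : nbh N W = cls (frel v) @: Y.
  apply/setP => w; apply/idP/imsetP => [|[y]]; last by rewrite inE => wW ->.
  move=> /[dup] /bigcupP[c cW /imsetP[x xc ->]] wW; exists x => //; by case: (inW c x).
have YYi : Y \subset Yi.
  apply/subsetP => y; rewrite inE => /bigcupP[c cW /imsetP[x xc /eqP]].
  by rewrite eq_clsv inYi => /(inn_v o) ->; apply: T_inn; case: (inW c x).
have := sum_cap YYi Yv; rewrite -NY; have := capacity it iw0 YYi Yv.
move: (\sum_(w in nbh N W) (#|w| - 4)) (nvert m Y) (#|Y|) => S nv cY C1 C2.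
suff : 3 * #|W| <= #|tri3 m Y| by lia.
pose U := [set x | cls (frel f) x \in W].
have UY : U \subset tri3 m Y.
  apply/subsetP => x; rewrite inE => xW.
  have [xT xY] := inW _ _ xW (cls_refl _ x).
  have c1 : fconnect f x (f x) := fconnect1 f x.
  have c2 : fconnect f x (f (f x)) := connect_trans c1 (fconnect1 f _).
  have [_ y1] := inW _ (f x) xW ltac:(by rewrite mem_cls).
  have [_ y2] := inW _ (f (f x)) xW ltac:(by rewrite mem_cls).
  by rewrite inE xY y1 y2 /=; move: xT; rewrite inE => /and4P[].
apply: leq_trans (subset_leq_card UY).
have Uf x : (f x \in U) = (x \in U).
  rewrite !inE (_ : cls (frel f) (f x) = cls (frel f) x) //.
  by apply/eqP; rewrite eq_clsf sf fconnect1.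
rewrite -(setTI U) (card_closed _ fi Uf).
have -> : cls (frel f) @: U = W.
  apply/setP => c; apply/imsetP/idP => [[x]|cW]; first by rewrite inE => xW ->.
  have /imsetP[t tT ct] := subsetP WA _ cW; exists t; rewrite // inE -ct; exact: cW.
rewrite (eq_bigr (fun=> 3)) => [|c cW]; first by rewrite sum_nat_const mulnC.
have /imsetP[t tT ct] := subsetP WA _ cW; rewrite setTI ct card_face3 //.
exact: tri3_nout tT.
Qed.

Lemma struct_exists : exists I, stem_system m o I.
Proof.
have [s [sN scap]] := @hall _ _ N set0 A (fun w => #|w| - 4) hall_cond.
(* The darts that leave the outer cycle inwards are forced by [st_outv]. They serve the inner faces
   with an outer corner, and Hall's assignment serves those of [T]. *)
pose j x := [&& ~~ inn x, ~~ outd x & ~~ outd (e x)].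
pose I := [set x | (x \in T) && (cls (frel v) x == s (cls (frel f) x)) || j x].
have inI z : (z \in I) = (z \in T) && (cls (frel v) z == s (cls (frel f) z)) || j z.
  by rewrite [LHS]in_set.
have clf x y : fconnect f x y -> cls (frel f) x = cls (frel f) y.
  by move=> c; apply/eqP; rewrite eq_clsf.
have faceI x : ~~ outd x -> #|[set y in I | fconnect f x y]| = 1.
  move=> ox; apply/eqP/cards1P.
  case: (boolP (x \in T)) => xT.
    have /imsetP[y yx sy] := sN _ (imset_f (cls (frel f)) xT).
    rewrite mem_cls in yx; exists y; apply/setP => z; rewrite in_set1 [LHS]in_set inI.
    apply/andP/eqP => [[H xz]|->]; last first.
      by rewrite -(T_fc yx) xT -(clf _ _ yx) sy eqxx.
    have zT : z \in T by rewrite -(T_fc xz).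
    move: H; rewrite /j (T_inn zT) orbF -(clf _ _ xz) sy eq_clsv => /andP[_ cv].
    symmetry; apply: face_vertex => //; first by rewrite -(outd_fc xz).
    by rewrite -(same_connect sf xz).
  (* In a face with an outer corner, the origin of [y], the dart of the system is [f y] when the
     edge of [y] is an outer edge, and [y] itself otherwise. *)
  have [y [ny xy]] : exists y, ~~ inn y /\ fconnect f x y.
    move: xT; rewrite inE !inYi (in3 it ox) eqxx andbT !negb_and => /or3P[] ny;
      [exists x|exists (f x)|exists (f (f x))]; split=> //; first exact: fconnect1.
    exact: connect_trans (fconnect1 f x) (fconnect1 f _).
  have oy : ~~ outd y by rewrite -(outd_fc xy).
  have ofy : ~~ outd (f y) by rewrite outd_f.
  have offy : ~~ outd (f (f y)) by rewrite !outd_f.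
  have ife z : inn (f z) = inn (e z) by rewrite (inn_vrot m o (e z)).
  have E : [set z in I | fconnect f x z] = [set z in [set y; f y; f (f y)] | j z].
    apply/setP => z; rewrite [LHS]in_set [RHS]in_set inI !(in_setU, in_set1) (same_connect sf xy); apply/andP/andP => [[H cz]|[H jz]].
      have zT : z \notin T by rewrite -(T_fc cz) -(T_fc xy).
      move: H; rewrite (negbTE zT) /= => ->; split=> //.
      by case: (in_face oy cz) => ->; rewrite eqxx ?orbT.
    rewrite jz orbT; split=> //; case/orP: H => [/orP[]|] /eqP->; first exact: connect0.
      exact: fconnect1.
    exact: connect_trans (fconnect1 f y) (fconnect1 f _).
  rewrite E; case: (boolP (outd (e y))) => oey.
    have nfy : ~~ inn (f y) by rewrite ife outd_ninn.
    have iff : inn (f (f y)) by have := inner_corner it iw0 oy; rewrite (negbTE ny) (negbTE nfy).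
    have jfy : j (f y).
      rewrite /j nfy ofy /=; apply: contraTN iff => oe; rewrite ife; exact: outd_ninn.
    exists (f y); apply/setP => z; rewrite [LHS]in_set !(in_setU, in_set1); apply/andP/eqP => [[]|->]; last by rewrite eqxx orbT.
    by case/orP => [/orP[]|] /eqP-> //; rewrite /j ?oey ?andbF // iff.
  have jy : j y by rewrite /j ny oy.
  have ify : inn (f y).
    apply/contraT; rewrite ife => nn.
    by have := nochord it iw0 ny nn; rewrite (negbTE oy) (negbTE oey).
  exists y; apply/setP => z; rewrite [LHS]in_set !(in_setU, in_set1); apply/andP/eqP => [[]|->]; last by rewrite eqxx.
  case/orP => [/orP[]|] /eqP-> //; rewrite /j ?ify // => /and3P[nff _ /negP[]].
  have := nochord it iw0 nff; rewrite -ife (in3 it oy) => /(_ ny).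
  by rewrite (negbTE offy).
exists I; split => //.
- by move=> x ox; split; [exact: (in3 it)|exact: (face_neq it)].
- move=> x; rewrite inI => /orP[/andP[xT _]|/and3P[]//].
  split; first exact: tri3_nout xT.
  apply: contraTN (T_inn xT); rewrite -outd_ev // => ov; rewrite -inn_vrot; exact: outd_ninn.
- move=> x ix; set w := cls (frel v) x.
  have IT z : z \in I -> inn z -> z \in T /\ cls (frel v) z = s (cls (frel f) z).
    by rewrite inI /j => /orP[/andP[zT /eqP->]|/and3P[/negbTE->]].
  have iw u : u \in cls (frel v) @: Yi -> #|I :&: u| <= #|u| - 4.
    case/imsetP => y; rewrite inYi => iy ->; set w' := cls (frel v) y.
    have inw z : z \in I :&: w' -> [/\ z \in T, s (cls (frel f) z) = w' & fconnect v y z].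
      rewrite in_setI mem_cls => /andP[zI cz].
      have [zT sz] := IT _ zI ltac:(by rewrite -(inn_v o cz)).
      by split=> //; rewrite -sz; apply/eqP; rewrite eq_clsv (fc_sym m).
    apply: leq_trans (scap w'); rewrite -(card_in_imset (f := cls (frel f)) (D := mem (I :&: w'))).
      apply: subset_leq_card; apply/subsetP => c /imsetP[z zw ->]; rewrite inE.
      by case: (inw z zw) => zT -> _; rewrite eqxx andbT; apply: imset_f.
    move=> a b aw bw /eqP; rewrite eq_clsf => cf.
    case: (inw a aw) => aT _ ca; case: (inw b bw) => _ _ cb.
    symmetry; apply: face_vertex => //; first exact: tri3_nout aT.
    by rewrite (fc_sym m) in ca; exact: fc_trans ca cb.
  have tot : \sum_(u in cls (frel v) @: Yi) #|I :&: u| = \sum_(u in cls (frel v) @: Yi) (#|u| - 4).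
    have Yv := @Yi_v _ m o; rewrite -/Yi in Yv.
    rewrite -(card_closed I vi Yv); have S := sum_cap (subxx Yi) Yv.
    have -> : I :&: Yi = I :&: T.
      apply/setP => z; rewrite !in_setI; apply: andb_id2l => zI; rewrite inYi.
      by apply/idP/idP => [/(IT _ zI)[]|/T_inn].
    have Tf z : (f z \in T) = (z \in T) by exact: tri3_f.
    have C1 := card_closed I fi Tf; have C2 := card_closed [set: D] fi Tf.
    rewrite setTI (eq_bigr (fun=> 3)) in C2; last first.
      by move=> c /imsetP[z zT ->]; rewrite setTI card_face3 // (tri3_nout it zT).
    rewrite (eq_bigr (fun=> 1)) in C1; last first.
      move=> c /imsetP[z zT ->]; rewrite -(faceI z (tri3_nout it zT)).
      by apply: eq_card => u; rewrite !(in_set, in_setU, in_set1).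
    rewrite !sum_nat_const in C1 C2.
    by have := capacity_all it iw0; rewrite -/Yi -/T /nin -/Yi; lia.
  have wY : w \in cls (frel v) @: Yi by apply: imset_f; rewrite inYi.
  have Iw : #|I :&: w| = #|w| - 4.
    apply/eqP; rewrite eqn_leq iw //=; move: tot; rewrite (bigD1 w) //= [in RHS](bigD1 w) //=.
    have : \sum_(u in cls (frel v) @: Yi | u != w) #|I :&: u| <= \sum_(u in cls (frel v) @: Yi | u != w) (#|u| - 4).
      by apply: leq_sum => u /andP[uY _]; apply: iw.
    move: (\sum_(u in _ | _) _) (\sum_(u in _ | _) _) => S1 S2; lia.
  have -> : [set y | fconnect v x y & y \notin I] = w :\: I.
    by apply/setP => y; rewrite !(in_set, in_setU, in_set1) andbC.
  rewrite cardsD setIC Iw; have := vertex4 ix; rewrite -/w; lia.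
- by move=> x nx ox oex; rewrite inI /j nx ox oex orbT.
Qed.

End Exists.

(** * The minimal stem system *)

Section Minimal.
Import GRing.Theory Num.Theory Order.TTheory.
Variables (D : finType) (m : cmap D) (o : D).
Local Notation v := (vrot m).
Local Notation e := (erev m).
Local Notation f := (face m).
Local Notation inn := (inner_vertex m o).
Local Notation struct := (stem_system m o).
Hypothesis mp : planar_map m.
Let mc : connected_map m. Proof. by case/and3P: mp. Qed.

Definition flip (I Z : {set D}) : {set D} :=
  [set y | if (v^-1)%g y \in Z then (y \notin Z) || (y \in I) else (y \notin Z) && (y \in I)].

(** With booleans read as integers: a flip subtracts from the indicator of [I] the increment of that
    of [Z] along the rotation. Hence the counts around vertices and faces do not change. *)
Lemma flipE I Z x : flippable m o I Z ->
  (v x \in flip I Z) + (v x \in Z) = (v x \in I) + (x \in Z).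
Proof.
case=> _ _ h1 h2; rewrite inE permK; have := h1 x; have := h2 x.
case: (x \in Z); case: (v x \in Z); case: (v x \in I) => // H1 H2; try by have := H1 isT isT.
by have := H2 isT isT.
Qed.

Lemma sum_indicator (P : pred D) (I : {set D}) :
  #|[set y in I | P y]| = \sum_(y | P y) (y \in I).
Proof.
rewrite -sum1_card big_mkcond [RHS]big_mkcond; apply: eq_bigr => y _.
by rewrite inE; case: (y \in I); case: (P y).
Qed.

Lemma flip_card I Z (P : pred D) (g : D -> D) : injective g -> flippable m o I Z ->
  (forall z, P (g z) = P z) -> (forall z, (v^-1)%g (g z) \in Z = (z \in Z)) ->
  #|[set y in flip I Z | P y]| = #|[set y in I | P y]|.
Proof.
move=> gi fl Pg gZ; rewrite !sum_indicator.
apply: (@addIn (\sum_(y | P y) (y \in Z))).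
have R : \sum_(y | P y) (y \in Z) = \sum_(y | P y) ((v^-1)%g y \in Z).
  by rewrite [RHS](reindex_inj gi) /=; apply: eq_big => y; rewrite ?Pg ?gZ.
rewrite [in RHS]R -!big_split /=.
by apply: eq_bigr => y _; have := flipE ((v^-1)%g y) fl; rewrite permKV.
Qed.

Lemma flip_struct I Z : struct I -> flippable m o I Z -> struct (flip I Z).
Proof.
move=> sI fl; have [Zc Zi h1 h2] := fl.
have fi : injective f := @face_inj _ m.
have ff x z : fconnect f x (f z) = fconnect f x z by rewrite -(same_fconnect1_r fi).
have vv x z : fconnect v x (v z) = fconnect v x z by rewrite -(same_fconnect1_r (@perm_inj _ v)).
split.
- exact: st_tri sI.
- move=> x ox; rewrite (flip_card fi fl) ?(st_face sI) // => z.
  by rewrite /face permK Zc.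
- move=> y; rewrite inE; case: ifP => yZ; last by case/andP=> _ /(st_out sI).
  case/orP => [yZ'|/(st_out sI)//].
  have iy : inn y by have := Zi _ yZ; rewrite -{2}(permKV v y) inn_vrot.
  split; first by apply: contraTN iy; exact: outd_ninn.
  apply: contraTN iy; rewrite -outd_ev // -inn_vrot; exact: outd_ninn.
- move=> x ix; have := st_inn sI ix.
  have H (J : {set D}) : #|[set y | fconnect v x y & y \notin J]| + #|[set y in J | fconnect v x y]| = #|[set y | fconnect v x y]|.
    rewrite -[RHS](cardsID J) addnC; congr (_ + _); by apply: eq_card => y; rewrite !inE // andbC.
  have := H I; have := H (flip I Z); rewrite (flip_card (@perm_inj _ v) fl) //; last by move=> z; rewrite permK.
  by move=> <- /addIn ->.
- move=> x nx ox oex; rewrite inE; have xI := st_outv sI nx ox oex.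
  have nZ y : ~~ inn y -> y \notin Z by apply: contraNN; exact: Zi.
  by rewrite (negbTE (nZ x nx)) xI -if_neg nZ // -inn_vrot permKV.
Qed.

Local Open Scope ring_scope.

(* The height difference between two stem systems. *)
Definition height (I0 I : {set D}) (h : D -> rat) : Prop :=
  [/\ forall x, h (e x) = h x,
      forall x, (v x \in I0)%:R - (v x \in I)%:R = h (v x) - h x & h o = 0].

Lemma height_exists I0 I : struct I0 -> struct I -> exists h, height I0 I h.
Proof.
move=> s0 sI.
have [||h [he hv]] := @potential_edge _ m mp (fun x => (x \in I0)%:R - (x \in I)%:R).
- by move=> x; exact: (struct_vertex_sum _ s0 sI).
- by move=> x; exact: (struct_face_sum _ s0 sI).
exists (fun x => h x - h o); split=> [x|x|]; rewrite ?he ?subrr //.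
by rewrite hv opprB addrA addrNK.
Qed.

Lemma height_unique I0 I h h' : height I0 I h -> height I0 I h' -> h =1 h'.
Proof.
move=> [he hv ho] [he' hv' ho'] x; apply/eqP; rewrite -subr_eq0; apply/eqP.
pose d x := h x - h' x; rewrite -/(d x).
have -> : 0 = d o by rewrite /d ho ho' subrr.
have dv y : d (v y) = d y by have := hv y; have := hv' y; rewrite /d; lra.
have de y : d (e y) = d y by rewrite /d he he'.
case/connectP: (conn_map mc o x) => p; elim/last_ind: p x => [|p z IH] x /=; first by move=> _ ->.
by rewrite rcons_path last_rcons => /andP[/IH/(_ erefl) zc /orP[]/eqP E ->]; rewrite E ?dv ?de.
Qed.

Lemma height_flip I0 I Z h : flippable m o I Z -> height I0 I h ->
  height I0 (flip I Z) (fun x => h x + (x \in Z)%:R).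
Proof.
move=> fl [he hv ho]; have [Zc Zi _ _] := fl; split=> [x|x|].
- by rewrite he Zc.
- have := flipE x fl => /(congr1 (fun n => n%:R : rat)); rewrite !natrD => E.
  have := hv x; lra.
- rewrite ho add0r; case: (boolP (o \in Z)) => // /Zi.
  by rewrite (negbTE (outd_ninn _)) //; exact: connect0.
Qed.

(** Among the finitely many systems, one of largest total height over [I0] is minimal, because
    flipping along [Z] adds the cardinality of [Z] to that total. *)
Lemma minimal_exists I0 : struct I0 -> exists I, struct I /\ minimal m o I.
Proof.
move=> s0.
have /fin_all_exists[pot potP] : forall I, exists q, struct I -> exists2 h, height I0 I h & q = \sum_x h x.
  move=> I.
  case: (classic (struct I)) => [sI|nI]; last by exists 0.
  by have [h hh] := height_exists s0 sI; exists (\sum_x h x) => _; exists h.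
pose P I : bool := if excluded_middle_informative (struct I) then true else false.
have PP I : reflect (struct I) (P I).
  by rewrite /P; case: excluded_middle_informative => H; constructor.
have [I /PP sI Imax] := @arg_maxP _ _ _ I0 P pot (introT (PP _) s0).
exists I; split=> // Z fl; apply/eqP; rewrite -cards_eq0.
have sF := flip_struct sI fl.
have [h hI pI] := potP _ sI; have [h' hF pF] := potP _ sF.
have := Imax _ (introT (PP _) sF); rewrite /= pI pF.
rewrite (eq_bigr _ (fun x _ => height_unique hF (height_flip fl hI) x)) big_split /=.
rewrite -natr_sum => H; have {}H : (\sum_i (i \in Z))%:R <= 0 :> rat by lra.
move: H; rewrite lern0 -[X in X == _]big_mkcond sum1_card //.
Qed.

End Minimal.

(** The successive images of [U] decrease until they are stable. On the stable set [g] is a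
    permutation, which is what balances the flow in [no_up_cycle]. *)
Lemma stable_core (T : finType) (g : T -> T) (U : {set T}) :
  U != set0 -> (forall x, x \in U -> g x \in U) ->
  exists X : {set T}, [/\ X \subset U, X != set0 & g @: X = X].
Proof.
move: {2}#|U| (leqnn #|U|) => n; elim: n U => [|n IH] U.
  by rewrite leqn0 cards_eq0 => ->.
move=> cU U0 gU; have sU : g @: U \subset U by apply/subsetP => y /imsetP[x xU ->]; exact: gU.
have [E|nE] := eqVneq (g @: U) U; first by exists U.
have pU : g @: U \proper U by rewrite properEneq nE.
have [||x /imsetP[y yU ->]|X [XU X0 XE]] := IH (g @: U).
- by have := proper_card pU; lia.
- by case/set0Pn: U0 => x xU; apply/set0Pn; exists (g x); apply: imset_f.
- by apply: imset_f; apply: gU.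
- by exists X; split=> //; apply: subset_trans XU sU.
Qed.

(** * The triangles of a minimal stem system are nested without cycles *)

Section Acyclic.
Import GRing.Theory Num.Theory Order.TTheory.
Variables (D : finType) (m : cmap D) (o : D).
Local Notation v := (vrot m).
Local Notation e := (erev m).
Local Notation f := (face m).
Local Notation inn := (inner_vertex m o).
Local Notation outd := (outer_dart m o).
Hypothesis it : irreducible_triangulation m o.
Variable w0 : D.
Hypothesis iw0 : inn w0.
Variable I : {set D}.
Hypothesis sI : stem_system m o I.
Let mp := irr_planar it.
Let me := irr_edges it.
Let mc := irr_conn it.
Let ms := irr_simple it.
Let fi : injective f := @face_inj _ m.
Let sf : connect_sym (frel f) := fc_symf m.
Let vi : injective v := @perm_inj _ v.

(** The default [x] occurs only on the outer face, which contains no dart of the system. *)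
Definition sel x := if [pick y in I | fconnect f x y] is Some y then y else x.

Lemma selP x : ~~ outd x -> sel x \in I /\ fconnect f x (sel x).
Proof.
move=> ox; rewrite /sel; case: pickP => [y /andP[]//|no].
by have := st_face sI ox; rewrite (_ : [set y in I | _] = set0) ?cards0 //; apply/setP => y; rewrite !in_set no.
Qed.

Lemma sel_uniq x y : ~~ outd x -> y \in I -> fconnect f x y -> y = sel x.
Proof.
move=> ox yI cy; have [sxI cs] := selP ox.
have /eqP/cards1P[z E] := st_face sI ox.
have : y \in [set z] by rewrite -E in_set yI.
have : sel x \in [set z] by rewrite -E in_set sxI.
by rewrite !in_set1 => /eqP-> /eqP.
Qed.

(* The dart of I in the triangle across the edge of l. *)
Definition up l := sel (e l).

Lemma upP l : l \in I -> up l \in I /\ fconnect f (e l) (up l).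
Proof. by case/(st_out sI) => _; exact: selP. Qed.

Lemma facep_inv_connect : fconnect (facep m)^-1%g =2 fconnect f.
Proof.
move=> x y; rewrite -facep_connect -same_fconnect_finv; last exact: perm_inj.
by apply: eq_fconnect => z; apply: (@perm_inj _ (facep m)^-1%g); rewrite permK f_finv //; exact: perm_inj.
Qed.

Local Open Scope ring_scope.

(** The case of [potential] where the invariant functions live on vertices: a flow across the edges,
    without sources in the faces, has winding numbers around the vertices. *)
Lemma potential_vertex (z : D -> rat) :
  (forall x, z (e x) = - z x) -> (forall x, \sum_(y | fconnect f x y) z y = 0) ->
  exists g : D -> rat, (forall x, g (v x) = g x) /\ forall x, z x = g x - g (e x).
Proof.
move=> zN zf.
have [||||||g [gv gz]] := @potential _ v e (facep m)^-1%g _ _ _ _ z.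
- by move=> x y; exact: (conn_map mc x y).
- move=> x y; have := conn_map mc x y; apply: connect_sub => {}x {}y /orP[]/eqP->.
    apply: (@connect_trans _ _ (e x)); first by apply: connect1; rewrite /= eqxx.
    have : fconnect (facep m)^-1%g (e x) (v x) by rewrite facep_inv_connect (vrot_face me) fconnect1.
    by apply: connect_sub => a b /eqP<-; apply: connect1; rewrite /= eqxx orbT.
  by apply: connect1; rewrite /= eqxx.
- move=> x; rewrite invgK facepE.
  have -> : (e^-1)%g x = e x by apply: (can_inj (permK e)); rewrite permKV erevK.
  exact: fc_ef.
- have := euler me mp; have := ncl_erev me.
  rewrite (@eq_ncl _ (frel (facep m)^-1%g) (frel f)); last exact: facep_inv_connect.
  by move=> <-; rewrite doubleK; lia.
- move=> x; rewrite (eq_bigl (mem [set x; e x])); last first.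
    by move=> y; rewrite -mem_cls (cls_erev me).
  rewrite (bigD1 x) ?inE ?eqxx //= (bigD1 (e x)) /=; last by rewrite !inE eqxx orbT erev_neq.
  rewrite big1 ?addr0 ?zN ?subrr // => y; rewrite !inE; by case/andP => /andP[/orP[]/eqP->]; rewrite eqxx.
- by move=> x; rewrite -[RHS](zf x); apply: eq_bigl => y; rewrite facep_inv_connect.
exists g; split=> // x; have := gz (e x); rewrite erevK //.
Qed.

Hypothesis mI : minimal m o I.

Lemma card_vertices (L : {set D}) : (forall x, (v x \in L) = (x \in L)) ->
  (forall x, x \in L -> inn x) -> (#|L :\: I| = 4 * nvert m L)%N.
Proof.
move=> Lv Li; rewrite setDE setIC (card_closed _ vi Lv) (eq_bigr (fun=> 4%N)).
  by rewrite sum_nat_const mulnC.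
move=> c /imsetP[x xL ->]; rewrite -(st_inn sI (Li x xL)); apply: eq_card => y.
by rewrite !in_set andbC.
Qed.

(** The four darts outside [I] at each vertex of [L] stay in [L], and each triangle inside [L] adds
    a dart of [I] to the induced graph: more edges than [induced_edges] allows. At most six darts
    leave room for one vertex only, which would carry a loop. *)
Lemma no_sink (L : {set D}) : (forall x, (v x \in L) = (x \in L)) ->
  (forall x, x \in L -> inn x) -> (forall x, x \in L -> e x \notin L -> x \in I) -> L = set0.
Proof.
move=> Lv Li Lx; apply/eqP; rewrite -cards_eq0; apply/negPn/negP; rewrite cards_eq0.
case/set0Pn => x0 x0L.
have fL x : (f x \in L) = (e x \in L) by exact: Lv.
have n1 : (0 < nvert m L)%N by apply/card_gt0P; exists (cls (frel v) x0); apply: imset_f.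
have cLI := card_vertices Lv Li.
have s1 : L :\: I \subset Gof m L.
  by apply/subsetP => x; rewrite !inE => /andP[nI xL]; rewrite xL /=; apply: contraNT nI; exact: Lx.
have cG : (#|Gof m L :&: I| + #|L :\: I| = #|Gof m L|)%N.
  rewrite -(cardsID I (Gof m L)); congr (_ + _)%N; apply: eq_card => x; rewrite !in_setD.
  apply/andP/andP => -[nI xL]; split=> //; first by apply: (subsetP s1); rewrite in_setD nI.
  by move: xL; rewrite inE => /andP[].
have ct : (3 * #|I :&: tri3 m L| = #|tri3 m L|)%N.
  have Tf x : (f x \in tri3 m L) = (x \in tri3 m L) by exact: tri3_f.
  have tno c x : x \in tri3 m L -> ~~ outd x := @tri3_nout _ _ _ it _ _.
  rewrite -[in RHS](setTI (tri3 m L)) !(card_closed _ fi Tf) big_distrr /=.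
  apply: eq_bigr => c /imsetP[x xT ->]; rewrite setTI (card_face3 it (tri3_nout it xT)).
  have -> : I :&: cls (frel f) x = [set y in I | fconnect f x y] by apply/setP => y; rewrite !in_set.
  by rewrite (st_face sI (tri3_nout it xT)).
have ts : I :&: tri3 m L \subset Gof m L :&: I.
  apply/subsetP => x; rewrite !in_setI andbC => /andP[xt ->]; rewrite andbT.
  by move: xt; rewrite !inE => /and4P[-> fx _ _]; rewrite -fL.
have ct2 := subset_leq_card ts.
have := induced_edges me ms (irr_nosep it) mp Lv.
case: (ltnP 6 #|Gof m L|) => [big /(_ isT)|small _]; first by lia.
have L1 : nvert m L = 1%N by lia.
have /card_gt0P[x xG] : (0 < #|L :\: I|)%N by lia.
have := subsetP s1 _ xG; rewrite inE => /andP[xL exL].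
have /eqP/cards1P[c cE] := L1.
have H y : y \in L -> cls (frel v) y = c.
  by move=> yL; apply/set1P; rewrite -cE; apply: imset_f.
have := noloop ms x; rewrite -eq_clsv (H x xL) (H _ exL) eqxx //.
Qed.

(* The successive crossings x -> up x would otherwise form a closed dual walk;
   the winding numbers g of X give either a set of vertices without enough
   outgoing edges, or a flippable set of edges. *)
Lemma no_up_cycle (U : {set D}) : (forall x, x \in U -> (x \in I) && inn x) ->
  (forall x, x \in U -> up x \in U) -> U = set0.
Proof.
move=> UI upU; apply/eqP/negPn/negP => U0.
have [X [XU X0 XE]] := stable_core U0 upU.
have XI x : x \in X -> x \in I by move/(subsetP XU)/UI/andP=> [].
have Xi x : x \in X -> inn x by move/(subsetP XU)/UI/andP=> [].
have upX x : x \in X -> up x \in X by move=> xX; rewrite -XE imset_f.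
have upi : {in X &, injective up} by apply/imset_injP; rewrite XE.
(* The flow of the dual walk across the edges. As [up] permutes [X], the walk enters every triangle
   as often as it leaves it. *)
pose z x : rat := (x \in X)%:R - (e x \in X)%:R.
have [||g [gv gz]] := @potential_vertex z.
- by move=> x; rewrite /z erevK // opprB.
- move=> x; rewrite /z sumrB (sum_ind X (mem (fconnect f x))).
  rewrite (eq_bigr (fun y => ((y \in e @^-1: X)%:R : rat))); last by move=> y _; rewrite inE.
  rewrite (sum_ind (e @^-1: X) (mem (fconnect f x))).
  apply/eqP; rewrite subr_eq0 eqr_nat; apply/eqP.
  have inj : {in [pred y | (e y \in X) && fconnect f x y] &, injective sel}.
    move=> a b /andP[aX _] /andP[bX _] E; apply: (@perm_inj _ e); apply: upi => //.
    by rewrite /up !erevK.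
  transitivity #|[pred y | (e y \in X) && fconnect f x y]|; last first.
    by apply: eq_card => y; rewrite !inE andbC.
  rewrite -(card_in_imset inj); apply: eq_card => y; rewrite [LHS]inE.
  apply/andP/imsetP => [[cy yX]|[w /andP[wX cw] ->]].
    have : y \in up @: X by rewrite XE.
    case/imsetP => l lX yl; exists (e l); last by rewrite yl.
    rewrite inE erevK // lX /=; have [_] := upP (XI _ lX); rewrite -yl => c.
    by rewrite sf (same_connect_r sf cy) // sf.
  have [_] := upP (XI _ wX); rewrite /up erevK // => c; split.
    exact: connect_trans cw c.
  by have := upX _ wX; rewrite /up erevK.
have gX x : x \notin X -> e x \notin X -> g (e x) = g x.
  by move=> nx nex; have := gz x; rewrite /z (negbTE nx) (negbTE nex); lra.
have go y : outd y -> g y = g o.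
  case/connectP => w; elim/last_ind: w y => [|w u IH] y /=; first by move=> _ ->.
  rewrite rcons_path last_rcons => /andP[pw /eqP uy] ->; rewrite -uy -(IH _ pw erefl) /face gv.
  have ou : outd (last o w) by apply/connectP; exists w.
  apply: gX; apply/negP => /XI/(st_out sI)[]; rewrite ?ou // erevK //; by rewrite ou.
have gn y : ~~ inn y -> g y = g o.
  case/innP => u ou /connectP[w]; elim/last_ind: w y => [|w t IH] y /=; first by move=> _ ->; apply: go.
  by rewrite rcons_path last_rcons => /andP[pw /eqP <-] ->; rewrite gv; apply: IH.
have [y1 _ hy1] := @arg_maxP _ _ _ o xpredT g isT.
have {}hy1 x : g x <= g y1 := hy1 x isT.
have [y2 _ hy2] := @arg_minP _ _ _ o xpredT g isT.
have {}hy2 x : g y2 <= g x := hy2 x isT.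
(* If the maximum of [g] exceeds its value on the outer cycle, every dart that leaves the set of
   maxima goes down, so it lies in [X], hence in [I], and [no_sink] applies. *)
have [gt1|] := ltP (g o) (g y1).
  pose L := [set x | g x == g y1].
  have : y1 \in L by rewrite inE.
  rewrite (@no_sink L) ?inE // => [x|x|x]; rewrite !inE ?gv //.
    by move=> /eqP E; apply: contraLR gt1 => /gn; rewrite E => ->; rewrite ltxx.
  move=> /eqP E nE; apply: XI; apply/contraT => nx.
  have := gz x; rewrite /z (negbTE nx) E; have := hy1 (e x).
  move: nE; case: (e x \in X) => /eqP; rewrite ?mulr1n ?mulr0n; lra.
(* If the minimum of [g] is below its value on the outer cycle, every dart entering the set of
   minima lies in [X], and the edges that meet this set are flippable. *)
move=> le1; have [lt2|ge2] := ltP (g y2) (g o).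
  pose R := [set x | g x == g y2].
  have inR x : (x \in R) = (g x == g y2) by rewrite inE.
  have Rv x : (v x \in R) = (x \in R) by rewrite !inR gv.
  have Ri x : x \in R -> inn x.
    by rewrite inR => /eqP E; apply: contraLR lt2 => /gn; rewrite E => ->; rewrite ltxx.
  have cross x : x \notin R -> e x \in R -> x \in X.
    rewrite !inR => nE /eqP E; apply/contraT => nx; have := gz x; rewrite /z (negbTE nx) E.
    have := hy2 x; move: nE; case: (e x \in X) => /eqP; rewrite ?mulr1n ?mulr0n; lra.
  pose Z := [set x | (x \in R) || (e x \in R)].
  have inZ x : (x \in Z) = (x \in R) || (e x \in R) by rewrite inE.
  have : y2 \in Z by rewrite inZ inR eqxx.
  rewrite (mI (Z := Z)) ?inE //; split.
  - by move=> x; rewrite !inZ erevK // orbC.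
  - move=> x; rewrite inZ; case: (boolP (x \in R)) => [/Ri//|nx] /= ex.
    by apply: Xi; apply: cross.
  - move=> x nI; rewrite !inZ Rv; case: (boolP (x \in R)) => //= nx evx.
    have : v x \in X by apply: cross; rewrite ?Rv.
    by move/XI; rewrite (negbTE nI).
  - move=> x vI; rewrite !inZ Rv; case: (boolP (x \in R)) => //= nx ex.
    have xX : x \in X := cross _ nx ex.
    have [oex _] : ~~ outd (e x) /\ true by have [] := st_out sI (XI _ xX).
    apply/contraT => nevx.
    have fE : face m (e x) = v x by rewrite (vrot_face me).
    have f3 := in3 it oex; rewrite fE in f3.
    have fvx : f (v x) \in X.
      apply: cross; first by rewrite Rv.
      by rewrite -Rv -/(f (f (v x))) f3.
    have c1 : fconnect f (e x) (v x) by rewrite -fE fconnect1.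
    have c2 : fconnect f (e x) (f (v x)) := connect_trans c1 (fconnect1 f _).
    have E1 := sel_uniq oex vI c1; have E2 := sel_uniq oex (XI _ fvx) c2.
    by have := face_neq it (v x); rewrite E2 -E1 eqxx.
(* When [g] is constant the flow vanishes, so [X] contains both halves of each of its edges, and a
   single such edge is flippable. *)
have gc x : g x = g o by have := hy1 x; have := hy2 x; lra.
case/set0Pn: X0 => l lX; have elX : e l \in X.
  by have := gz l; rewrite /z !gc lX; case: (e l \in X) => //=; rewrite ?mulr1n ?mulr0n; lra.
pose Z := [set l; e l].
have ZX x : x \in Z -> x \in X by rewrite !inE => /orP[]/eqP->.
have Zc : eclosed m Z by move=> x; rewrite !inE (inv_eq (erevK me)) (inj_eq perm_inj) orbC.
have : l \in Z by rewrite !inE eqxx.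
rewrite (mI (Z := Z)) ?inE //; split=> // [x /ZX/Xi//|x nI /ZX/XI|x vI xZ].
  by rewrite (negbTE nI).
have exI : e x \in I by apply/XI/ZX; rewrite Zc.
have oex : ~~ outd (e x) by have [] := st_out sI exI.
have c1 : fconnect f (e x) (v x) by rewrite (vrot_face me) fconnect1.
by rewrite (sel_uniq oex vI c1) -(sel_uniq oex exI (connect0 _ _)) Zc.
Qed.

End Acyclic.

(** * Opening a triangulation *)

Section Insert.
Variables (T : finType) (s : {perm T}) (l b : T).
Hypothesis sl : s l = l.
Hypothesis lb : b != l.
Let t := (tperm l b * s)%g.

Lemma insert_l : t l = s b. Proof. by rewrite permM tpermL. Qed.
Lemma insert_b : t b = l. Proof. by rewrite permM tpermR. Qed.
Lemma insert_o x : x != l -> x != b -> t x = s x.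
Proof. by move=> xl xb; rewrite permM tpermD // eq_sym. Qed.

Lemma insert_fc_to x y : fconnect s x y -> fconnect t x y.
Proof.
apply: connect_sub => {}x {}y /eqP <-.
have [->|xl] := eqVneq x l; first by rewrite sl connect0.
have [->|xb] := eqVneq x b; last by rewrite -insert_o // fconnect1.
by rewrite -insert_l -insert_b (connect_trans (fconnect1 t b)) // fconnect1.
Qed.

Lemma insert_fc_bl : fconnect t b l.
Proof. by have := fconnect1 t b; rewrite insert_b. Qed.

Lemma insert_fc x y : x != l -> y != l -> fconnect t x y = fconnect s x y.
Proof.
move=> xl yl; apply/idP/idP; last exact: insert_fc_to.
case/connectP => p; suff H z : path (frel t) x p -> z = last x p ->
    fconnect s x (if z == l then b else z).
  by move=> pp E; have := H _ pp E; rewrite (negbTE yl).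
elim/last_ind: p z {y yl} => [|p w IH] z /=; first by move=> _ ->; rewrite (negbTE xl) connect0.
rewrite rcons_path last_rcons => /andP[/IH/(_ erefl) H /eqP E ->].
move: H E; case: (eqVneq (last x p) l) => [->|ul] H E.
  rewrite -E insert_l; case: eqVneq => // _; exact: connect_trans H (fconnect1 s b).
move: E H; case: (eqVneq (last x p) b) => [->|ub] E H.
  by rewrite -E insert_b eqxx.
rewrite -E insert_o //; case: eqVneq => [E2|_]; last exact: connect_trans H (fconnect1 s _).
by case/eqP: ul; apply: (@perm_inj _ s); rewrite E2 sl.
Qed.

End Insert.

Section Glue.
Variables (D : finType).
Implicit Types (m : cmap D) (l : D).

Definition crel m : rel D := [rel a b | (b == vrot m a) || (b == erev m a)].

Lemma crel_sym m : edges_ok m -> connect_sym (crel m).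
Proof.
move=> me; apply: connect_sym_sub => x y /orP[]/eqP->; last first.
  by apply: connect1; rewrite /crel /= erevK // eqxx orbT.
have : fconnect (vrot m) (vrot m x) x by rewrite (fconnect_sym (@perm_inj _ _)) fconnect1.
by apply: connect_sub => a b /eqP<-; apply: connect1; rewrite /crel /= eqxx.
Qed.

Lemma crel_v m x : connect (crel m) x (vrot m x).
Proof. by apply: connect1; rewrite /crel /= eqxx. Qed.
Lemma crel_e m x : connect (crel m) x (erev m x).
Proof. by apply: connect1; rewrite /crel /= eqxx orbT. Qed.

Lemma crel_fc m x y : fconnect (vrot m) x y -> connect (crel m) x y.
Proof. by apply: connect_sub => a b /eqP<-; apply: crel_v. Qed.

Lemma crel_f m x : connect (crel m) x (face m x).
Proof. exact: connect_trans (crel_e m x) (crel_v m _). Qed.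

Lemma connected_mapP m : reflect (forall x y, connect (crel m) x y) (connected_map m).
Proof.
by apply: (iffP forallP) => [H x y|H x]; [have /forallP := H x|apply/forallP].
Qed.

Lemma erev_glue m l : erev (glue_leaf m l) = erev m.
Proof. by []. Qed.

Lemma vrot_glue m l : vrot (glue_leaf m l) = (tperm l (erev m (face m (face m l))) * vrot m)%g.
Proof. by []. Qed.

Section One.
Variables (m : cmap D) (l : D).
Hypothesis me : edges_ok m.
Hypothesis cl : closable m l.
Local Notation d1 := (face m l).
Local Notation d2 := (face m d1).
Local Notation b := (erev m d2).

Lemma closable_leaf : vrot m l = l. Proof. by case/and3P: cl => /eqP. Qed.

Lemma closable_bl : b != l.
Proof. by case/and3P: cl => ll _ /andP[_]; apply: contraNneq => ->. Qed.

Lemma closable_crel : connect (crel m) l b.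
Proof.
apply: connect_trans (crel_f m l) _; apply: connect_trans (crel_f m d1) _; exact: crel_e.
Qed.

Lemma glue_connected : connected_map (glue_leaf m l) = connected_map m.
Proof.
have sm := crel_sym me; have bl := closable_bl; have ll := closable_leaf.
apply/connected_mapP/connected_mapP => H x y; apply: connect_sub (H x y) => {H} {}x {}y /orP[]/eqP->;
  try exact: crel_e.
- rewrite vrot_glue; have [->|xl] := eqVneq x l.
    rewrite insert_l; apply: connect_trans closable_crel _; exact: crel_v.
  have [->|xb] := eqVneq x b; first by rewrite insert_b; have := closable_crel; rewrite sm.
  by rewrite insert_o ?crel_v.
- have : fconnect (vrot (glue_leaf m l)) x (vrot m x).
    by rewrite vrot_glue; apply: insert_fc_to => //; exact: fconnect1.
  exact: crel_fc.
Qed.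

End One.
End Glue.

Section Opening.
Variables (S : finType) (p : cmap S) (L : {set S}).
Local Notation v := (vrot p).
Local Notation e := (erev p).
Local Notation f := (face p).
Hypothesis pe : edges_ok p.
Hypothesis leafL : forall l, leaf p l -> l \in L.
Definition unopened := [set l in L | ~~ leaf p l].
Hypothesis tri : forall l, l \in unopened ->
  [/\ f (f (f l)) = l, f l \notin L, f (f l) \notin L & e l \notin L].
Hypothesis sides : forall l, l \in unopened -> ~~ leaf p (e (f l)) /\ ~~ leaf p (e (f (f l))).
Hypothesis acyc : forall U : {set S}, U \subset unopened -> U != set0 ->
  exists2 l, l \in U & forall l', l' \in U -> e l != f l' /\ e l != f (f l').
Hypothesis nodes : forall x, ~~ leaf p x -> exists y, [/\ y \notin L, y != x & fconnect v x y].

(** Here [q] is [p] with the darts of [J] detached. The rotation is prescribed only where it avoids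
    [J], since it now jumps over the detached darts. *)
Definition opened (J : {set S}) (q : cmap S) : Prop :=
  [/\ erev q = e, (forall x, x \in J -> vrot q x = x),
      (forall x, x \notin J -> v x \notin J -> vrot q x = v x),
      (forall x y, x \notin J -> y \notin J -> fconnect (vrot q) x y = fconnect v x y) &
      connect (@local_closure S) q p /\ connected_map q = connected_map p].

(** Detaching [l] undoes a gluing. By the last hypothesis the reversals of the two closed sides of
    its triangle are not yet leaves, so a local closure may put [l] back. *)
Lemma open_one J q l : opened J q -> J \subset L -> (forall x, leaf p x -> x \in J) ->
  l \in L -> l \notin J ->
  (forall l', l' \in L -> l' \notin J -> e (f l') \notin J /\ e (f (f l')) \notin J) ->
  exists q', opened (l |: J) q'.
Proof.
move=> [qe qJ qv qc [qp qcon]] JL lJ0 lL lJ side.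
have lU : l \in unopened by rewrite inE lL; apply: contraNN lJ; exact: lJ0.
have nl : ~~ leaf p l by move: lU; rewrite inE => /andP[].
have [f3 n1 n2 nel] := tri lU; have [s1 s2] := side l lL lJ.
set d1 := f l in f3 n1 n2 s1 s2; set d2 := f d1 in f3 n2 s2; set b := e d2 in s2.
have NL x : x \notin L -> x \notin J by apply: contraNN; exact: (subsetP JL).
have vb : vrot q b = l.
  by rewrite qv // ?f3 // -/(f d2) f3.
have bl : b != l.
  apply: contraNneq nl => E; rewrite /leaf -{1}E -/(f d2) f3 //.
pose q' : cmap S := ((tperm l b * vrot q)%g, e).
have v'l : vrot q' l = l by rewrite /vrot /= permM tpermL vb.
have v'b : vrot q' b = vrot q l by rewrite /vrot /= permM tpermR.
have v'o x : x != l -> x != b -> vrot q' x = vrot q x.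
  by move=> xl xb; rewrite /vrot /= permM tpermD // eq_sym.
have d12 : d1 != d2 by apply: contraNneq n1 => E; have := @face_inj _ p _ _ E => <-.
have d2l : d2 != l by apply: contraNneq n2 => ->.
have edl : e d1 != l.
  apply/eqP => E; have E' : d1 = e l by rewrite -E erevK.
  by move: nel; rewrite leafL // /leaf -{2}E'.
have eel : e l != b by rewrite (inj_eq perm_inj) eq_sym.
have eld : e l != l by exact: erev_neq.
have fq' x : face q' x = vrot q' (e x) by [].
have fq'l : face q' l = d1.
  by rewrite fq' (v'o _ eld eel) qv ?NL // -[v _]/d1 NL.
have fq'd : face q' d1 = d2.
  have n : e d1 != b by rewrite (inj_eq perm_inj).
  by rewrite fq' (v'o _ edl n) qv // -[v _]/d2 NL.
have glue_q : glue_leaf q' l = q.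
  rewrite /glue_leaf fq'l fq'd -[erev q' d2]/b.
  rewrite [RHS](_ : q = (vrot q, erev q)); last by rewrite /vrot /erev; case: (q).
  by congr (_, _); [rewrite /vrot /= mulgA tperm2 mul1g|rewrite qe].
have vq : vrot q = (tperm l b * vrot q')%g by rewrite -glue_q vrot_glue fq'l fq'd.
have q'c x y : x \notin l |: J -> y \notin l |: J -> fconnect (vrot q') x y = fconnect v x y.
  rewrite !inE !negb_or => /andP[xl xJ] /andP[yl yJ]; rewrite -qc // vq.
  by rewrite (insert_fc b v'l).
have lf x : x \notin J -> x != l -> vrot q' x != x.
  move=> xJ xl; have [y [yL yx cxy]] := nodes (contraNN (lJ0 x) xJ).
  apply: contraNneq yx => vx; have : fconnect (vrot q') x y.
    rewrite q'c // !inE negb_or ?xl ?xJ // NL // andbT.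
    by apply: contraNneq yL => ->.
  case/connectP => w; elim/last_ind: w y {yL cxy} => [|w z IH] y /=; first by move=> _ ->.
  by rewrite rcons_path last_rcons => /andP[/IH/(_ erefl)/eqP H /eqP <-] ->; rewrite H vx.
have clq : closable q' l.
  have d1l : d1 != l by apply: contraNneq n1 => ->.
  apply/and3P; split; first by rewrite /leaf v'l.
    by rewrite fq'l /closed_side /leaf (lf _ (NL _ n1) d1l) (lf _ s1 edl).
  by rewrite fq'l fq'd /closed_side /leaf (lf _ (NL _ n2) d2l) (lf _ s2 bl).
have q'e : edges_ok q' by exact: pe.
exists q'; split.
- by [].
- move=> x; rewrite !inE => /orP[/eqP->//|xJ]; rewrite v'o ?qJ //.
    by apply: contraNneq lJ => <-.
  by apply: contraNneq s2 => <-.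
- move=> x; rewrite !inE !negb_or => /andP[xl xJ] /andP[vxl vxJ].
  rewrite v'o ?qv //; apply: contraNneq vxl => ->.
  by rewrite -/(f d2) f3.
- exact: q'c.
- split; last by rewrite -qcon -glue_q glue_connected.
  apply: connect_trans qp; apply: connect1; apply/existsP; exists l.
  by rewrite clq glue_q eqxx.
Qed.

(** [acyc] always supplies a dart whose edge is not a closed side of a triangle still to be opened;
    detaching that dart preserves the side condition of [open_one]. *)
Lemma opening : exists A : cmap S,
  [/\ erev A = e, (forall x, leaf A x = (x \in L)),
      (forall x y, x \notin L -> y \notin L -> fconnect (vrot A) x y = fconnect v x y),
      connect (@local_closure S) A p & connected_map A = connected_map p].
Proof.
suff H n : forall J q, opened J q -> J \subset L -> (forall x, leaf p x -> x \in J) ->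
    (forall l', l' \in L -> l' \notin J -> e (f l') \notin J /\ e (f (f l')) \notin J) ->
    #|L :\: J| <= n -> exists q', opened L q'.
  have [| | | | |A [Ae AL Av Ac [Ap Acon]]] := H #|L| [set x | leaf p x] p.
  - split=> //; by move=> x; rewrite inE => /eqP.
  - by apply/subsetP => x; rewrite inE; exact: leafL.
  - by move=> x lx; rewrite inE.
  - move=> l lL; rewrite !inE => nl; apply: sides; by rewrite inE lL.
  - by apply: subset_leq_card; apply: subsetDl.
  exists A; split=> // x; apply/idP/idP => [/eqP lx|xL]; last by rewrite /leaf AL.
  apply/contraT => xL; have [y [yL yx cxy]] := nodes (contraNN (@leafL x) xL).
  move: cxy; rewrite -Ac // => cxy; case/negP: yx.
  case/connectP: cxy => w; elim/last_ind: w y {yL} => [|w z IH] y /=; first by move=> _ ->.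
  by rewrite rcons_path last_rcons => /andP[/IH/(_ erefl)/eqP H' /eqP <-] ->; rewrite H' lx.
elim: n => [|n IH] J q oq JL lJ side.
  rewrite leqn0 cards_eq0 setD_eq0 => LJ; exists q.
  by have -> : L = J by apply/eqP; rewrite eqEsubset LJ.
move=> cn; have [E|LJ] := eqVneq (L :\: J) set0.
  by apply: (IH J q) => //; rewrite E cards0.
have LU : L :\: J \subset unopened.
  by apply/subsetP => x; rewrite !inE => /andP[xJ ->] /=; apply: contraNN xJ; exact: lJ.
have [l lLJ lP] := acyc LU LJ.
have [lJ' lL] : l \notin J /\ l \in L by move: lLJ; rewrite inE => /andP[].
have [q' oq'] := open_one oq JL lJ lL lJ' side.
apply: (IH (l |: J) q') => //.
- by rewrite subUset sub1set lL.
- by move=> x /lJ xJ; rewrite !inE xJ orbT.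
- move=> l' l'L; rewrite !inE !negb_or => /andP[l'l l'J]; have [a1 a2] := side _ l'L l'J.
  have [b1 b2] := lP l' ltac:(by rewrite inE l'J l'L).
  rewrite a1 a2 !andbT; split; [apply: contraNneq b1|apply: contraNneq b2] => <-; by rewrite erevK.
- have := cardsD1 l (L :\: J); rewrite lLJ setDDl setUC /=; lia.
Qed.

End Opening.

(** * Counting in ternary trees *)

Section Tree.
Variables (S : finType) (A : cmap S).
Local Notation v := (vrot A).
Local Notation f := (face A).
Definition leaves := [set x | leaf A x].

Lemma inleaves x : (x \in leaves) = (v x == x). Proof. by rewrite inE. Qed.

Lemma leaves_v x : (v x \in leaves) = (x \in leaves).
Proof. by rewrite !inleaves (inj_eq perm_inj). Qed.

Lemma nodes_v x : (v x \in ~: leaves) = (x \in ~: leaves).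
Proof. by rewrite !in_setC leaves_v. Qed.

Lemma leaf_fc x y : leaf A x -> fconnect v x y -> y = x.
Proof.
move=> /eqP lx /connectP[p]; elim/last_ind: p y => [|p z IH] y /=; first by move=> _ ->.
by rewrite rcons_path last_rcons => /andP[/IH/(_ erefl) -> /eqP <-] ->; rewrite lx.
Qed.

Lemma order_cls x : fingraph.order v x = #|cls (frel v) x|.
Proof. by apply: eq_card => y; rewrite !inE. Qed.

Lemma leaf_order x : leaf A x = (fingraph.order v x == 1).
Proof.
rewrite order_cls; apply/idP/cards1P => [lx|[y E]].
  exists x; apply/setP => y; rewrite mem_cls in_set1; apply/idP/eqP => [/(leaf_fc lx)//|->].
  exact: connect0.
have : v x \in [set y] by rewrite -E mem_cls fconnect1.
have : x \in [set y] by rewrite -E cls_refl.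
by rewrite !in_set1 /leaf => /eqP-> /eqP->.
Qed.

Lemma nvert_leaves : nvert A leaves = #|leaves|.
Proof.
rewrite /nvert card_in_imset // => x y; rewrite inE => lx _ /eqP.
rewrite (eq_cls _ _ (fc_symv A)) => /(leaf_fc lx) //.
Qed.

Hypothesis deg : forall x, ~~ leaf A x -> #|cls (frel v) x| = 4.

Lemma nvert_nodes : 4 * nvert A (~: leaves) = #|~: leaves|.
Proof.
rewrite -[in RHS](setTI (~: leaves)) (card_closed _ (@perm_inj _ v) nodes_v).
rewrite (eq_bigr (fun=> 4)) ?sum_nat_const 1?mulnC // => c /imsetP[x].
by rewrite !inE setTI => nx ->; apply: deg.
Qed.

Lemma order4 x : (fingraph.order v x == 4) = ~~ leaf A x.
Proof.
rewrite leaf_order order_cls; case: (boolP (leaf A x)) => [|/deg->//].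
by rewrite leaf_order order_cls => /eqP->.
Qed.

Lemma fcard_nodes : fcard v [pred d | fingraph.order v d == 4] = nvert A (~: leaves).
Proof.
rewrite /nvert card_cls_imset; last 2 first.
- exact: fc_symv.
- by move=> x y /eqP <-; rewrite nodes_v.
by apply: eq_n_comp_r => x; rewrite !inE order4.
Qed.

(** [RC_le] for the set of all edges: the genus is nonnegative. *)
Lemma edge_count_conn (x0 : S) : edges_ok A -> connected_map A ->
  ncl (frel f) + ncl (frel v) <= #|S|./2 + 2.
Proof.
move=> Ae Ac; have Tc : eclosed A [set: S] by move=> x; rewrite !inE.
have := RC_le Ae Ac x0 Tc; rewrite cardsT.
have -> : ncl (regR A [set: S]) = ncl (frel f).
  by apply: eq_ncl; apply: eq_connect => x y; rewrite /regR /= inE andbF orbF eq_sym.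
have -> : ncl (verR A [set: S]) = 1.
  apply: (cls_all Ac x0); first exact: verR_sym.
    by move=> x; apply: connect1; rewrite verR_v.
  by move=> x; apply: connect1; rewrite verR_e ?inE.
lia.
Qed.

(** The counts give 3n + 2 vertices and 3n + 1 edges. With these numbers, nonnegativity of the genus
    leaves a single face, and planarity follows. *)
Lemma tree_build n : edges_ok A -> connected_map A ->
  #|leaves| = 2 * n + 2 -> #|S| = 6 * n + 2 -> ternary_tree A n.
Proof.
move=> Ae Ac cL cS; have cC := cardsC leaves.
have nn : nvert A (~: leaves) = n by have := nvert_nodes; lia.
have nV := nvertC leaves_v; rewrite nvert_leaves nn cL in nV.
have [x0 _] : exists x0 : S, x0 \in leaves by apply/card_gt0P; rewrite cL; lia.
have ee := ncl_erev Ae; have F := edge_count_conn x0 Ae Ac.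
have F0 : 0 < ncl (frel f) by apply/card_gt0P; exists (cls (frel f) x0); apply: imset_f.
have F1 : ncl (frel f) = 1 by move: F; rewrite -nV cS; lia.
rewrite /ternary_tree /plane_tree /planar_map Ae Ac /=.
rewrite !fcard_ncl; try exact: perm_inj; try exact: face_inj.
rewrite F1 -nV fcard_nodes nn !eqxx !andbT; apply/andP; split; first by lia.
apply/forallP => x; rewrite order4 -leaf_order; exact: orbN.
Qed.

End Tree.

Section TreeFacts.
Variables (S : finType) (A : cmap S) (n : nat).
Hypothesis At : ternary_tree A n.
Local Notation v := (vrot A).
Local Notation f := (face A).

Lemma tree_edges : edges_ok A. Proof. by case/and3P: At => /andP[/and3P[]]. Qed.
Lemma tree_conn : connected_map A. Proof. by case/and3P: At => /andP[/and3P[]]. Qed.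
Lemma tree_planar : planar_map A. Proof. by case/and3P: At => /andP[]. Qed.
Lemma tree_face : ncl (frel f) = 1.
Proof.
by case/and3P: At => /andP[_ /eqP <-] _ _; rewrite fcard_ncl //; exact: face_inj.
Qed.

Lemma tree_deg x : ~~ leaf A x -> #|cls (frel v) x| = 4.
Proof.
case/and3P: At => _ /forallP/(_ x) + _; rewrite leaf_order -order_cls.
by case/orP => /eqP->.
Qed.

Lemma tree_nodes : nvert A (~: leaves A) = n.
Proof. by case/and3P: At => _ _ /eqP <-; rewrite (fcard_nodes tree_deg). Qed.

Lemma tree_counts : #|leaves A| = 2 * n + 2 /\ #|S| = 6 * n + 2.
Proof.
have cC := cardsC (leaves A); have nn := nvert_nodes tree_deg.
have nV := nvertC (leaves_v A); rewrite nvert_leaves in nV; rewrite tree_nodes in nn nV.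
have ee := ncl_erev tree_edges; have E := euler tree_edges tree_planar.
rewrite tree_face -nV in E; have hD := doubleK (ncl (frel (erev A))).
rewrite ee in hD; lia.
Qed.

End TreeFacts.

(** * Removing the outer cycle and opening the triangles *)

Section Backward.
Variables (D : finType) (m : cmap D) (o : D).
Local Notation v := (vrot m).
Local Notation e := (erev m).
Local Notation f := (face m).
Local Notation inn := (inner_vertex m o).
Local Notation outd := (outer_dart m o).
Hypothesis it : irreducible_triangulation m o.
Variable w0 : D.
Hypothesis iw0 : inn w0.
Variable I : {set D}.
Hypothesis sI : stem_system m o I.
Hypothesis mI : minimal m o I.
Let mp := irr_planar it.
Let me := irr_edges it.
Let mc := irr_conn it.
Let sf : connect_sym (frel f) := fc_symf m.

Definition ins x := ~~ outd x && ~~ outd (e x).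

Lemma ins_e x : ins (e x) = ins x.
Proof. by rewrite /ins erevK // andbC. Qed.

Lemma inn_ins x : inn x -> ins x.
Proof.
move=> ix; apply/andP; split; first by apply: contraTN ix; exact: outd_ninn.
by rewrite -outd_ev //; apply: contraTN ix; rewrite -(inn_vrot m o x); exact: outd_ninn.
Qed.

Lemma inn_f x : inn (f x) = inn (e x).
Proof. by rewrite (inn_vrot m o (e x)). Qed.

Lemma ins_inn x : ins x -> ~~ inn x -> inn (e x).
Proof.
case/andP => ox oex nx; apply/contraT => nex.
by have := nochord it iw0 nx nex; rewrite (negbTE ox) (negbTE oex).
Qed.

Lemma I_ins x : x \in I -> ins x.
Proof. by case/(st_out sI) => ox oex; apply/andP. Qed.

Lemma ins_I x : ins x -> ~~ inn x -> x \in I.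
Proof. by case/andP => ox oex nx; apply: (st_outv sI). Qed.

Lemma I_triangle x : x \in I ->
  [/\ f (f (f x)) = x, f x \notin I & f (f x) \notin I].
Proof.
move=> xI; have [ox _] := st_out sI xI; have f3 := in3 it ox; split=> //.
  apply/negP => fI; have := face_neq it x.
  by rewrite (sel_uniq sI ox fI (fconnect1 _ _)) -(sel_uniq sI ox xI (connect0 _ _)) eqxx.
apply/negP => fI; have c2 := connect_trans (fconnect1 f x) (fconnect1 f (f x)).
have E := sel_uniq sI ox fI c2; rewrite -(sel_uniq sI ox xI (connect0 _ _)) in E.
by have := face_neq it x; rewrite -{1}E f3 eqxx.
Qed.

(** A triangle with an outer corner has its dart of [I] at an outer vertex, so the triangle of [x]
    has none. If both halves of the edge were in [I], [up] would exchange them, against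
    [no_up_cycle]. *)
Lemma I_inner x : x \in I -> inn x -> [/\ inn (e x), inn (e (f x)) & e x \notin I].
Proof.
move=> xI ix; have [f3 n1 n2] := I_triangle xI.
have [ox oex] := st_out sI xI.
have i3 : inn (e (f (f x))) by rewrite -inn_f f3.
have ins3 : ins (f (f x)) by rewrite -ins_e inn_ins.
have i2 : inn (e (f x)).
  by apply/contraT => nx; case/negP: n2; apply: ins_I => //; rewrite inn_f.
have ix1 : inn (e x).
  apply/contraT => nx; case/negP: n1; apply: ins_I; last by rewrite inn_f.
  by rewrite -ins_e inn_ins.
split=> //; apply/negP => exI.
have sx : up m I x = e x.
  by symmetry; apply: (sel_uniq sI) => //; rewrite connect0.
have sex : up m I (e x) = x.
  by symmetry; rewrite /up erevK //; apply: (sel_uniq sI) => //; rewrite connect0.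
have := @no_up_cycle _ _ _ it _ iw0 _ sI mI [set x; e x].
move=> H; have : x \in [set x; e x] by rewrite !inE eqxx.
rewrite H ?inE // => y; rewrite !inE => /orP[]/eqP->; rewrite ?xI ?exI ?sx ?sex ?eqxx ?orbT //.
Qed.

Definition inside_darts : finType := {x : D | ins x}.
Local Notation S := inside_darts.

Definition core_erev (s : S) : S := insubd s (e (val s)).
Definition core_vrot (s : S) : S := if inn (val s) then insubd s (v (val s)) else s.

Lemma val_e0 s : val (core_erev s) = e (val s).
Proof. by rewrite insubdK // -topredE /= ins_e (valP s). Qed.

Lemma val_v0 s : val (core_vrot s) = if inn (val s) then v (val s) else val s.
Proof.
rewrite /core_vrot; case: ifP => // ix; rewrite insubdK // -topredE /=; apply: inn_ins.
by rewrite inn_vrot.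
Qed.

Lemma e0_inj : injective core_erev.
Proof. by move=> a b /(congr1 val); rewrite !val_e0 => /perm_inj/val_inj. Qed.

Lemma v0_inj : injective core_vrot.
Proof.
move=> a b /(congr1 val); rewrite !val_v0; case: ifP => ia; case: ifP => ib.
- by move/perm_inj/val_inj.
- by move=> E; rewrite -E inn_vrot ia in ib.
- by move=> E; rewrite E inn_vrot ib in ia.
- exact: val_inj.
Qed.

(* The 4-cycle is removed and the edges that end on it become stems. *)
Definition core : cmap S := (perm v0_inj, perm e0_inj).
Local Notation p0 := core.

Lemma p0e s : val (erev p0 s) = e (val s).
Proof. by rewrite /erev permE val_e0. Qed.
Lemma p0v s : val (vrot p0 s) = if inn (val s) then v (val s) else val s.
Proof. by rewrite /vrot permE val_v0. Qed.

Lemma p0_edges : edges_ok p0.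
Proof.
apply/forallP => s; apply/andP; split.
  by apply/eqP => /(congr1 val); rewrite p0e => /eqP; rewrite (negbTE (erev_neq me _)).
by apply/eqP/val_inj; rewrite !p0e erevK.
Qed.

Lemma v_neq x : inn x -> v x != x.
Proof.
move=> ix; apply/eqP => E; have := vertex4 it iw0 ix.
suff -> : cls (frel v) x = [set x] by rewrite cards1.
apply/setP => y; rewrite mem_cls in_set1; apply/idP/eqP => [|->]; last exact: connect0.
case/connectP => p; elim/last_ind: p y => [|p z IH] y /=; first by move=> _ ->.
by rewrite rcons_path last_rcons => /andP[/IH/(_ erefl) -> /eqP <-] ->; rewrite E.
Qed.

Lemma p0_leaf s : leaf p0 s = ~~ inn (val s).
Proof.
rewrite /leaf -val_eqE p0v; case: ifP => ix /=; last by rewrite eqxx.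
exact/negbTE/v_neq.
Qed.

Lemma p0_face s : inn (e (val s)) -> val (face p0 s) = f (val s).
Proof. by move=> ix; rewrite /face p0v p0e ix. Qed.

Lemma p0_fc s t : inn (val s) -> fconnect (vrot p0) s t = fconnect v (val s) (val t).
Proof.
move=> ix; apply/idP/idP.
  case/connectP => p; elim/last_ind: p t => [|p z IH] t /=; first by move=> _ ->; rewrite connect0.
  rewrite rcons_path last_rcons => /andP[/IH/(_ erefl) H /eqP <-] ->.
  rewrite p0v -(inn_v o H) ix; exact: connect_trans H (fconnect1 _ _).
case/connectP => p; suff H y : path (frel v) (val s) p -> y = last (val s) p ->
    exists2 u, val u = y & fconnect (vrot p0) s u.
  by move=> pp E; case: (H _ pp E) => u /val_inj->.
elim/last_ind: p y {t} => [|p z IH] y /=; first by move=> _ ->; exists s; rewrite ?connect0.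
rewrite rcons_path last_rcons => /andP[pp /eqP <-] ->; have [u uE cu] := IH _ pp erefl.
exists (vrot p0 u); last exact: connect_trans cu (fconnect1 _ _).
rewrite p0v uE (_ : inn _) // -(@inn_v _ _ _ (val s)) //; by apply/connectP; exists p.
Qed.

Definition core_leaves : {set S} := [set s | val s \in I].

Lemma inL0 s : (s \in core_leaves) = (val s \in I). Proof. by rewrite inE. Qed.

Lemma unopenedP s : s \in unopened p0 core_leaves -> val s \in I /\ inn (val s).
Proof. by rewrite inE inL0 p0_leaf negbK => /andP[]. Qed.

Lemma p0_tri s : val s \in I -> inn (val s) ->
  [/\ val (face p0 s) = f (val s), val (face p0 (face p0 s)) = f (f (val s)) &
      face p0 (face p0 (face p0 s)) = s].
Proof.
move=> xI ix; have [i1 i2 _] := I_inner xI ix; have [f3 _ _] := I_triangle xI.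
have E1 : val (face p0 s) = f (val s) by apply: p0_face.
have E2 : val (face p0 (face p0 s)) = f (f (val s)) by rewrite p0_face E1.
by split=> //; apply: val_inj; rewrite p0_face E2 ?f3 // -inn_f f3.
Qed.

Lemma open_tree : exists A : cmap S,
  [/\ erev A = erev p0, (forall x, leaf A x = (x \in core_leaves)),
      (forall x y, x \notin core_leaves -> y \notin core_leaves -> fconnect (vrot A) x y = fconnect (vrot p0) x y),
      connect (@local_closure S) A p0 & connected_map A = connected_map p0].
Proof.
apply: opening; first exact: p0_edges.
- by move=> s; rewrite p0_leaf inL0 => ns; apply: ins_I => //; exact: (valP s).
- move=> s /unopenedP[xI ix]; have [E1 E2 E3] := p0_tri xI ix.
  have [_ n1 n2] := I_triangle xI; have [_ _ n3] := I_inner xI ix.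
  by rewrite !inL0 E1 E2 p0e.
- move=> s /unopenedP[xI ix]; have [E1 E2 E3] := p0_tri xI ix.
  have [f3 _ _] := I_triangle xI; have [_ i2 _] := I_inner xI ix.
  by rewrite !p0_leaf !p0e E1 E2 i2 -inn_f f3 ix.
(* If no dart of [U] could be opened, each [e l] would be a closed side of the triangle of some dart
   of [U], which is then [up] of [l]: [V] would be stable under [up]. *)
- move=> U UU U0; pose V := [set val s | s in U].
  have VP x : x \in V -> (x \in I) && inn x.
    by case/imsetP => s /(subsetP UU)/unopenedP[xI ix] ->; rewrite xI.
  case: (boolP [exists l in U, [forall l' in U, (erev p0 l != face p0 l') && (erev p0 l != face p0 (face p0 l'))]]).
    case/exists_inP => l lU /forall_inP H; exists l => // l' /H /andP[] //.
  move/exists_inPn => H; case/negP: U0; suff V0 : V = set0.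
    apply/eqP/setP => s; rewrite in_set0; apply/negP => sU.
    by have := imset_f val sU; rewrite -/V V0 inE.
  apply: (no_up_cycle it iw0 sI mI VP) => x /imsetP[l lU ->].
  have := H l lU; rewrite negb_forall => /existsP[l']; rewrite negb_imply negb_and !negbK => /andP[l'U cl].
  have [xI ix] := unopenedP (subsetP UU _ l'U); have [E1 E2 _] := p0_tri xI ix.
  apply/imsetP; exists l' => //; have [lI li] := unopenedP (subsetP UU _ lU).
  have [_ oex] := st_out sI lI.
  symmetry; apply: (sel_uniq sI oex xI); rewrite sf -p0e.
  case/orP: cl => /eqP->; rewrite ?E1 ?E2; first exact: fconnect1.
  exact: connect_trans (fconnect1 f _) (fconnect1 f _).
- move=> x; rewrite p0_leaf negbK => ix; have c4 := st_inn sI ix.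
  have : 0 < #|[set y | fconnect v (val x) y & y \notin I] :\ val x|.
    by have := cardsD1 (val x) [set y | fconnect v (val x) y & y \notin I]; rewrite c4; case: (_ \in _) => /=; lia.
  case/card_gt0P => y; rewrite in_setD1 in_set => /and3P[yx cy yI].
  have iy : ins y by apply: inn_ins; rewrite -(inn_v o cy).
  exists (Sub y iy); rewrite inL0 SubK; split=> //.
  by rewrite p0_fc.
Qed.

Local Notation cn := (connect (crel p0)).

Let cns : connect_sym (crel p0) := crel_sym p0_edges.

Lemma cn_step (s t : S) : f (val s) = val t -> inn (e (val s)) -> cn s t.
Proof.
move=> E ix; rewrite (_ : t = face p0 s); first exact: crel_f.
by apply: val_inj; rewrite p0_face.
Qed.

(** When the step passes through an outer vertex, which [core] has split, the other two corners of
    the triangle are inner, and the face is walked the other way round. *)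
Lemma face_step (s t : S) : f (val s) = val t -> cn s t.
Proof.
move=> E; case: (boolP (inn (e (val s)))) => [|nx]; first exact: cn_step.
have os : ~~ outd (val s) by have /andP[] := valP s.
have is_ : inn (val s).
  by rewrite -(erevK me (val s)); apply: ins_inn; rewrite // ins_e; exact: (valP s).
have f3 := in3 it os.
have ie : inn (e (f (f (val s)))) by rewrite -inn_f f3.
have iu : ins (f (f (val s))) by rewrite -ins_e inn_ins.
pose u : S := Sub _ iu.
have it_ : inn (e (val t)).
  by apply: ins_inn; [exact: (valP t)|rewrite -E inn_f].
rewrite cns; apply: (@connect_trans _ _ u); apply: cn_step; rewrite ?SubK -?E //.
by rewrite E.
Qed.

Lemma face_mates (s t : S) : fconnect f (val s) (val t) -> cn s t.
Proof.
have os : ~~ outd (val s) by have /andP[] := valP s.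
have ot : ~~ outd (val t) by have /andP[] := valP t.
case/(in_face it os) => E.
- by rewrite (val_inj E) connect0.
- exact: face_step.
rewrite cns; apply: face_step; rewrite E; exact: (in3 it).
Qed.

(** The half of an outer edge is represented by the dart of [I] in the inner triangle along that
    edge, so that walks in [m] project to walks in [core]. *)
Definition rep (z : D) : D := if ins z then z else if outd z then sel m I (e z) else sel m I z.

Lemma rep_ins z : ins (rep z).
Proof.
rewrite /rep; case: ifP => // nz; case: ifP => oz.
  by apply: I_ins; have [] := selP sI (outd_e it iw0 oz).
by apply: I_ins; have [] := selP sI (negbT oz).
Qed.

Definition repS z : S := Sub (rep z) (rep_ins z).

Lemma repE z : val (repS z) = rep z. Proof. exact: SubK. Qed.

Lemma rep_face z : ~~ outd z -> fconnect f z (rep z).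
Proof.
move=> oz; rewrite /rep; case: ifP => // _.
by rewrite (negbTE oz); have [] := selP sI oz.
Qed.

Lemma rep_mates z z' : ~~ outd z -> fconnect f z z' -> cn (repS z) (repS z').
Proof.
move=> oz c; apply: face_mates; rewrite !repE.
have oz' : ~~ outd z' by rewrite -(outd_fc o c).
rewrite sf in c; rewrite sf; apply: connect_trans (connect_trans c (rep_face oz)); rewrite sf.
exact: rep_face.
Qed.

Lemma rep_e z : cn (repS z) (repS (e z)).
Proof.
case: (boolP (ins z)) => iz.
  have E : repS (e z) = erev p0 (repS z).
    by apply: val_inj; rewrite p0e !repE /rep ins_e iz.
  rewrite E; exact: crel_e.
suff -> : repS (e z) = repS z by rewrite connect0.
apply: val_inj; rewrite !repE /rep ins_e (negbTE iz) erevK //.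
case: (boolP (outd z)) => oz; first by rewrite (negbTE (outd_e it iw0 oz)).
by move: iz; rewrite /ins oz /= negbK => ->.
Qed.

Lemma rep_v_in z : ~~ outd (e z) -> cn (repS z) (repS (v z)).
Proof.
move=> oe; apply: connect_trans (rep_e z) _; apply: rep_mates => //.
by rewrite (vrot_face me) fconnect1.
Qed.

(** When the rotation crosses the outer face, the path turns around the vertex in the other
    direction: by [out_vertex] it meets no second outer corner. *)
Lemma rep_v z : cn (repS z) (repS (v z)).
Proof.
case: (boolP (outd (e z))) => oe; last exact: rep_v_in.
have vi : injective v := @perm_inj _ v.
rewrite cns; suff H j : j < fingraph.order v z -> cn (repS (v z)) (repS (iter j v (v z))).
  have lt : (fingraph.order v z).-1 < fingraph.order v z by rewrite orderSpred.
  by have := H _ lt; rewrite -iterSr orderSpred iter_order.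
elim: j => [|j IH] lj; first by rewrite connect0.
apply: connect_trans (IH (ltnW lj)) _; rewrite iterS; apply: rep_v_in.
rewrite -outd_ev // -iterSr -iterS; apply/negP => ov.
have ovz : outd (v z) by rewrite outd_ev.
have c : fconnect v (v z) (iter j.+2 v z) by rewrite iterSr fconnect_iter.
have /vi := out_vertex it iw0 ovz ov c; rewrite -/(iter j.+1 v z) => E.
have := findex_iter lj; rewrite E findex0 //.
Qed.

Lemma p0_conn : connected_map p0.
Proof.
apply/connected_mapP => s t.
have rv (u : S) : repS (val u) = u.
  by apply: val_inj; rewrite repE /rep (valP u).
suff H x y : connect [rel a b | (b == v a) || (b == e a)] x y -> cn (repS x) (repS y).
  by rewrite -(rv s) -(rv t); apply: H; exact: (conn_map mc).
case/connectP => p; elim/last_ind: p y => [|p z IH] y /=; first by move=> _ ->; rewrite connect0.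
rewrite rcons_path last_rcons => /andP[/IH/(_ erefl) H /orP[]/eqP E ->]; rewrite E;
  apply: connect_trans H _; [exact: rep_v|exact: rep_e].
Qed.

End Backward.

(** * Putting the outer cycle back *)

Section Attach.
Variables (D : finType) (m : cmap D) (o : D).
Local Notation v := (vrot m).
Local Notation e := (erev m).
Local Notation f := (face m).
Local Notation inn := (inner_vertex m o).
Local Notation outd := (outer_dart m o).
Hypothesis it : irreducible_triangulation m o.
Variable w0 : D.
Hypothesis iw0 : inn w0.
Variable I : {set D}.
Hypothesis sI : stem_system m o I.
Hypothesis mI : minimal m o I.
Let me := irr_edges it.
Local Notation S := (inside_darts m o).
Local Notation p0 := (core it).

Definition outer_nth (i : 'I_4) : D := iter i f o.

Lemma outd_od i : outd (outer_nth i). Proof. exact: fconnect_iter. Qed.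

Lemma f_od i : f (outer_nth i) = outer_nth (ordS i).
Proof.
rewrite /outer_nth -iterS /=; case: i => [[|[|[|[|i]]]] hi] //=.
exact: (out4 it (outd_o m o)).
Qed.

Lemma od_inj : injective outer_nth.
Proof.
have U := out_uniq it (outd_o m o).
have E (i : 'I_4) : outer_nth i = nth o [:: o; f o; f (f o); f (f (f o))] i.
  by case: i => [[|[|[|[|i]]]] hi].
by move=> i j; rewrite !E => /eqP; rewrite nth_uniq // => /eqP/val_inj.
Qed.

Lemma od_surj x : outd x -> exists i, x = outer_nth i.
Proof.
case/(outdP it (outd_o m o)) => ->.
- by exists (@Ordinal 4 0 isT).
- by exists (@Ordinal 4 1 isT).
- by exists (@Ordinal 4 2 isT).
- by exists (@Ordinal 4 3 isT).
Qed.

Lemma od_vertex i j : fconnect v (outer_nth i) (outer_nth j) -> i = j.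
Proof. by move=> c; apply: od_inj; rewrite (out_vertex it iw0 (outd_od i) (outd_od j) c). Qed.

Definition core_label (s : S) : 'I_4 := odflt ord0 [pick i | fconnect v (outer_nth i) (val s)].

Lemma lab_uniq s i : fconnect v (outer_nth i) (val s) -> core_label s = i.
Proof.
move=> ci; rewrite /core_label; case: pickP => [j /= cj|/(_ i)]; last by rewrite ci.
by apply: od_vertex; apply: connect_trans cj _; rewrite (fc_sym m).
Qed.

Definition core_embedding (x : outer_darts S) : D :=
  match x with
  | inl s => val s
  | inr (i, true) => outer_nth i
  | inr (i, false) => e (outer_nth (ord_pred i))
  end.

Lemma ins_od i : ins m o (outer_nth i) = false.
Proof. by rewrite /ins outd_od. Qed.

Lemma beta_inj : injective core_embedding.
Proof.
have n1 (s : S) i : val s <> outer_nth i by move=> E; have := valP s; rewrite /= E ins_od.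
have n2 (s : S) i : val s <> e (outer_nth i).
  by move=> E; have := valP s; rewrite /= E ins_e // ins_od.
have n3 i j : outer_nth i <> e (outer_nth j).
  by move=> E; have := outd_e it iw0 (outd_od j); rewrite -E outd_od.
move=> [s|[i [|]]] [t|[j [|]]] //= E.
- by rewrite (val_inj E).
- by case: (n1 _ _ E).
- by case: (n2 _ _ E).
- by case: (n1 _ _ (esym E)).
- by rewrite (od_inj E).
- by case: (n3 _ _ E).
- by case: (n2 _ _ (esym E)).
- by case: (n3 _ _ (esym E)).
- by rewrite (can_inj (@ord_predK 4) (od_inj (perm_inj E))).
Qed.

Lemma beta_bij : bijective core_embedding.
Proof.
apply: (inj_card_bij beta_inj); rewrite -(card_codom beta_inj).
apply: subset_leq_card; apply/subsetP => x _; apply/codomP.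
case: (boolP (ins m o x)) => [ix|]; first by exists (inl (Sub x ix : S)).
rewrite negb_and !negbK => /orP[/od_surj[i ->]|/od_surj[i E]]; first by exists (inr (i, true)).
by exists (inr (ordS i, false)); rewrite /= ordSK -E erevK.
Qed.

(** [C] is [m] itself, carried over by [core_embedding]. The content is that the intervals of stems
    are the stars of the four outer vertices. *)
Lemma attach_p0 : exists C : cmap (outer_darts S), attach_stems p0 core_label C /\ iso C m.
Proof.
have [gam bK gK] := beta_bij.
have vi : injective (fun x => gam (v (core_embedding x))).
  by move=> x y /(can_inj gK)/perm_inj/beta_inj.
have ei : injective (fun x => gam (e (core_embedding x))).
  by move=> x y /(can_inj gK)/perm_inj/beta_inj.
pose C : cmap (outer_darts S) := (perm vi, perm ei).
have Cv x : vrot C x = gam (v (core_embedding x)) by rewrite /vrot permE.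
have Ce x : erev C x = gam (e (core_embedding x)) by rewrite /erev permE.
have vE x y : v (core_embedding x) = core_embedding y -> vrot C x = y by rewrite Cv => ->; rewrite bK.
have eE x y : e (core_embedding x) = core_embedding y -> erev C x = y by rewrite Ce => ->; rewrite bK.
exists C; split; last first.
  apply/existsP; exists [ffun x => core_embedding x]; apply/is_isoP; split=> [|x|x].
  - by apply: (eq_bij beta_bij) => x; rewrite ffunE.
  - by rewrite !ffunE Cv gK.
  - by rewrite !ffunE Ce gK.
split.
- by move=> s; apply: eE; rewrite /= p0e.
- move=> i; split; apply: eE => /=; rewrite ordSK // erevK //.
- move=> s; rewrite (p0_leaf it iw0) negbK => ix; apply: vE; by rewrite /= p0v ix.
- by move=> i; apply: vE; rewrite /= -[v _]/(f (outer_nth _)) f_od ord_predK.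
move=> l; rewrite (p0_leaf it iw0) => nx; set x := val l in nx.
have xins : ins m o x := valP l.
have [ox oex] := andP xins.
have iex : inn (e x) := ins_inn it iw0 xins nx.
have E1 : val (face p0 l) = f x by rewrite p0_face.
have f3 := in3 it ox.
(* In the first case the end of [f x] is outer as well. By [nochord] the third side of the triangle
   is then an outer edge, and the label moves on to the next vertex. *)
rewrite (p0_leaf it iw0) p0e E1; case: ifP => [nd|/negbFE id].
  have nd2 : ~~ inn (f (f x)) by rewrite inn_f.
  have nd2' : ~~ inn (e (f (f x))) by rewrite -inn_f f3.
  have := nochord it iw0 nd2 nd2'; rewrite !outd_f // (negbTE ox) /= => /od_surj[k Ek].
  have E2 : f (f x) = e (outer_nth k) by rewrite -Ek erevK.
  have Ex : x = v (outer_nth k) by rewrite -[LHS]f3 E2 /face erevK.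
  have lk : core_label l = k by apply: lab_uniq; rewrite -/x Ex fconnect1.
  have lk' : core_label (erev p0 (face p0 l)) = ordS k.
    apply: lab_uniq; rewrite p0e E1 -f_od (fc_sym m).
    have c1 : fconnect v (e (f x)) (f (f x)) by exact: fconnect1.
    apply: connect_trans c1 _; rewrite E2; exact: fconnect1.
  rewrite lk lk'; split=> //; apply: vE => /=.
    by rewrite -/x Ex.
  by rewrite p0e E1 ordSK -E2.
have E2 : val (face p0 (face p0 l)) = f (f x) by rewrite p0_face E1.
have c : fconnect v (e (f (f x))) x by rewrite -[X in fconnect _ _ X]f3 fconnect1.
split; last by apply: vE; rewrite /= p0e E2 -[v _]/(f (f (f x))) f3.
have [i ci] : exists i, fconnect v (outer_nth i) x.
  by have /innP[y /od_surj[i ->] c'] := nx; exists i.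
rewrite (lab_uniq ci); apply: lab_uniq; rewrite p0e E2.
by apply: connect_trans ci _; rewrite (fc_sym m).
Qed.

(** The third side of an inner triangle at an outer vertex returns to that vertex, so it is a stem
    and not a closed edge. *)
Lemma p0_stuck l : ~~ closable p0 l.
Proof.
apply/negP => /and3P[]; rewrite (p0_leaf it iw0) => nx; set x := val l in nx.
have xins : ins m o x := valP l.
have [ox oex] := andP xins.
have iex : inn (e x) := ins_inn it iw0 xins nx.
have E1 : val (face p0 l) = f x by rewrite p0_face.
case/andP => _; rewrite (p0_leaf it iw0) p0e E1 negbK => id.
case/andP => _; rewrite (p0_leaf it iw0) p0e negbK p0_face ?E1 // => id2.
by move: id2; rewrite -inn_f (in3 it ox) (negbTE nx).
Qed.

Lemma card_S : #|S| = 6 * nin m o + 2.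
Proof.
have cD := card_darts it iw0; have c8 := card_ring8 it iw0; have := cardsC (ring8 m o).
rewrite /S card_sig => cC.
have : #|[pred x | ins m o x]| = #|~: ring8 m o|.
  by apply: eq_card => x; rewrite !inE negb_or.
by move=> ->; lia.
Qed.

Lemma card_I : #|I| = 2 * nin m o + 2.
Proof.
have cD := card_darts it iw0; have c4 := card_outd it; have cC := cardsC [set x | outd x].
have fi : injective f := @face_inj _ m.
pose no := ~: [set x | outd x].
have nof x : (f x \in no) = (x \in no) by rewrite !inE outd_f.
have C1 := card_closed I fi nof; have C2 := card_closed [set: D] fi nof.
rewrite setTI (eq_bigr (fun=> 3)) ?sum_nat_const in C2; last first.
  by move=> c /imsetP[z zT ->]; rewrite setTI (card_face3 it) //; move: zT; rewrite !inE.
rewrite (eq_bigr (fun=> 1)) ?sum_nat_const in C1; last first.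
  move=> c /imsetP[z]; rewrite !inE => oz ->; rewrite -(st_face sI oz).
  by apply: eq_card => u; rewrite !in_set.
rewrite (_ : I :&: no = I) in C1; last first.
  by apply/setIidPl/subsetP => x /(st_out sI)[ox _]; rewrite !inE.
by rewrite /no in C1 C2; lia.
Qed.

Lemma opening_exists : exists A : cmap S, ternary_tree A (nin m o) /\ closure_of A m.
Proof.
have [A [Ae AL Ac Ap Acon]] := open_tree it iw0 sI mI.
have pc := p0_conn it iw0 sI.
have Aed : edges_ok A by have := p0_edges it; rewrite /edges_ok Ae.
have leavesE : leaves A = core_leaves m o I by apply/setP => x; rewrite inE AL.
have cL : #|leaves A| = 2 * nin m o + 2.
  rewrite leavesE -card_I -(card_imset (mem (core_leaves m o I)) val_inj); apply: eq_card => x.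
  apply/imsetP/idP => [[s]|xI]; first by rewrite inL0 => sI' ->.
  by exists (Sub x (I_ins sI xI)); rewrite ?inL0 SubK.
exists A; split.
  have deg x : ~~ leaf A x -> #|cls (frel (vrot A)) x| = 4; last first.
    by apply: (tree_build deg Aed _ cL card_S); rewrite Acon.
  rewrite AL => xL; have ix : inn (val x).
    apply/contraT => nx; case/negP: xL; rewrite inL0; apply: (ins_I sI) => //; exact: (valP x).
  rewrite -(st_inn sI ix) -(card_imset _ val_inj); apply: eq_card => y; rewrite in_set.
  apply/imsetP/andP => [[s]|[cy yI]].
    rewrite mem_cls => cs ->; have sL : s \notin core_leaves m o I.
      apply: contraNN xL; rewrite -!AL => ls; rewrite (fc_sym A) in cs.
      by rewrite (leaf_fc ls cs).
    by rewrite -inL0; split=> //; rewrite -p0_fc // -Ac.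
  have iy : ins m o y by apply: inn_ins => //; rewrite -(inn_v o cy).
  have yL : (Sub y iy : S) \notin core_leaves m o I by rewrite inL0.
  by exists (Sub y iy : S) => //; rewrite mem_cls (Ac _ _ xL yL) p0_fc.
have [C [aC iC]] := attach_p0.
exists p0, core_label, C; split=> //; apply/andP; split=> //.
by apply/forallP => l; exact: p0_stuck.
Qed.

End Attach.

Theorem closure_surjective (D : finType) (m : cmap D) (o : D) (n : nat) : 0 < n ->
  irreducible_triangulation m o -> inner_vertices m o = n ->
  exists (S : finType) (A : cmap S), ternary_tree A n /\ closure_of A m.
Proof.
move=> n0 it nE.
have [w0 iw0] : exists w0, inner_vertex m o w0.
  apply/existsP/contraT; rewrite negb_exists => /forallP H.
  move: n0; rewrite -nE /inner_vertices (_ : fcard _ _ = 0) //.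
  by apply/eq_card0 => x; apply/negP => /andP[_]; apply/negP/H.
have [I0 s0] := struct_exists it iw0.
have [I [sI mI]] := minimal_exists (irr_planar it) s0.
have [A [At cA]] := opening_exists it iw0 sI mI.
exists (inside_darts m o), A; split=> //; by rewrite -nE inner_vertices_nin.
Qed.

(** * Partial closures *)

(** It compares a rotation with the same one after insertion of points of [L]: around a node, the
    rotation of the tree is recovered from that of its closure by passing over the ends of stems. *)
Inductive skip (T : finType) (s : T -> T) (L : {set T}) : T -> T -> Prop :=
| Skip1 x : skip s L x (s x)
| SkipS x y : s x \in L -> skip s L (s x) y -> skip s L x y.

Lemma skip_fun (T : finType) (s : T -> T) (L : {set T}) x y y' :
  skip s L x y -> skip s L x y' -> y \notin L -> y' \notin L -> y = y'.
Proof.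
elim=> {x y} [x|x y sL _ IH] H yL y'L.
  by case: x y' / H yL y'L => // x y sL _; rewrite sL.
case: x y' / H sL IH y'L => [x|x z _ H] sL IH y'L; first by rewrite sL in y'L.
exact: IH.
Qed.

Lemma skip_fc (T : finType) (s : T -> T) (L : {set T}) x y : skip s L x y -> fconnect s x y.
Proof. by elim=> {x y} [x|x y _ _]; [exact: fconnect1|apply: connect_trans; exact: fconnect1]. Qed.

Lemma card_step x y z : x + 4 = 3 * z -> z = 1 + y -> 3 <= x -> x - 3 + 4 = 3 * y.
Proof. lia. Qed.

Section Forward.
Variables (S : finType) (A : cmap S) (n : nat).
Hypothesis At : ternary_tree A n.
Hypothesis n0 : 0 < n.
Local Notation L := (leaves A).
Local Notation e := (erev A).
Let Ae : edges_ok A := tree_edges At.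

(** The tree with one edge and two leaves is excluded by [n0]. *)
Lemma leaf_e x : x \in L -> e x \notin L.
Proof.
rewrite !inleaves => /eqP xx; apply/eqP => exx.
have all y : y = x \/ y = e x.
  have := conn_map (tree_conn At) x y.
  case/connectP => p; elim/last_ind: p y => [|p z IH] y /=; first by move=> _ ->; left.
  rewrite rcons_path last_rcons => /andP[/IH/(_ erefl) H /orP[]/eqP E ->]; rewrite E.
    by case: H => ->; [left|right].
  by case: H => ->; rewrite ?erevK //; [right|left].
have [_ cS] := tree_counts At.
have : #|S| <= #|[set x; e x]|.
  apply: subset_leq_card; apply/subsetP => y _; rewrite !inE.
  by case: (all y) => ->; rewrite eqxx ?orbT.
by rewrite cS cards2; case: (_ != _); lia.
Qed.

Definition glued (m : cmap S) x := (x \in L) && ~~ leaf m x.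
Definition Oset (m : cmap S) := [set x | [forall l, glued m l ==>
  [&& x != l, x != face m l & x != face m (face m l)]]].

(* The invariant of the local closures: a glued leaf closes a triangle, [Oset m]
   is the outer face, and [pi_min] is the germ of minimality. *)
Record pinv (m : cmap S) : Prop := PInv {
  pi_e : erev m = e;
  pi_leaf : forall x, leaf m x -> x \in L;
  pi_skip : forall x, x \notin L -> skip (vrot m) L x (vrot A x);
  pi_tri : forall l, glued m l ->
    [/\ face m (face m (face m l)) = l, face m l \notin L & face m (face m l) \notin L];
  pi_cycle : forall x y, x \in Oset m -> y \in Oset m -> fconnect (face m) x y;
  pi_card : #|Oset m| + 4 = 3 * #|leaves m|;
  pi_conn : connected_map m;
  pi_min : forall Z : {set S}, eclosed A Z ->
    (forall l, glued m l -> (face m (face m l) \in Z -> face m l \in Z) /\ (face m l \in Z -> l \in Z)) ->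
    Z != set0 -> exists2 x, x \in Z & x \in Oset m;
  pi_node : forall x, ~~ leaf m x -> exists2 d, d \notin L & fconnect (vrot m) d x }.

Lemma OsetP m x : reflect (forall l, glued m l -> [/\ x <> l, x <> face m l & x <> face m (face m l)])
  (x \in Oset m).
Proof.
rewrite inE; apply: (iffP forallP) => [H l gl|H l]; last first.
  by apply/implyP => /H[/eqP-> /eqP-> /eqP->].
by have /implyP/(_ gl)/and3P[/eqP ? /eqP ? /eqP ?] := H l.
Qed.

Lemma pinv_A : pinv A.
Proof.
have ng x : glued A x = false by rewrite /glued inE andbN.
have OT : Oset A = [set: S].
  by apply/setP => x; rewrite in_setT; apply/OsetP => l; rewrite ng.
have [cL cS] := tree_counts At.
split=> //.
- by move=> x; rewrite inE.
- by move=> x _; exact: Skip1.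
- by move=> l; rewrite ng.
- move=> x y _ _; rewrite -(eq_cls _ _ (fc_symf A)); have /eqP/cards1P[c E] := tree_face At.
  have H z : cls (frel (face A)) z = c by apply/set1P; rewrite -E; apply: imset_f.
  by rewrite !H.
(* There are 6n + 2 outer darts and 2n + 2 leaves at the start, and a local closure removes three of
   the former and one of the latter. The constant 4 becomes the number of intervals in
   [card_gaps]. *)
- by rewrite OT cardsT cL cS; lia.
- exact: tree_conn At.
- by move=> Z _ _ /set0Pn[x xZ]; exists x => //; rewrite OT.
- by move=> x nx; exists x; rewrite ?connect0 // inE.
Qed.

Section Step.
Variables (m : cmap S) (l : S).
Hypothesis im : pinv m.
Hypothesis cl : closable m l.
Local Notation f := (face m).
Local Notation v := (vrot m).
Local Notation d1 := (f l).
Local Notation d2 := (f d1).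
Local Notation b := (e d2).
Local Notation m' := (glue_leaf m l).
Local Notation f' := (face m').
Local Notation v' := (vrot m').
Let fi : injective f := @face_inj _ m.
Let me : edges_ok m. Proof. by rewrite /edges_ok (pi_e im). Qed.

Lemma m'e : erev m' = e. Proof. by rewrite erev_glue (pi_e im). Qed.
Let ll : v l = l. Proof. exact: closable_leaf. Qed.
Let lL : l \in L. Proof. by apply: (pi_leaf im); rewrite /leaf ll. Qed.
Let bl : b != l. Proof. by have := closable_bl cl; rewrite (pi_e im). Qed.
Lemma v'E : v' = (tperm l b * v)%g. Proof. by rewrite vrot_glue (pi_e im). Qed.

Lemma O_f x : (f x \in Oset m) = (x \in Oset m).
Proof.
apply/OsetP/OsetP => H l' gl; have [f3 _ _] := pi_tri im gl; have [h1 h2 h3] := H l' gl.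
  by split=> E; subst x; [apply: h2|apply: h3|apply: h1].
split=> E; first by apply: h3; apply: fi; rewrite f3.
  by apply: h1; apply: fi.
by apply: h2; apply: fi.
Qed.

Lemma leaf_O x : leaf m x -> x \in Oset m.
Proof.
move=> lx; have xL := pi_leaf im lx; apply/OsetP => l' gl'; have [_ n1 n2] := pi_tri im gl'.
split=> E; subst x; first by case/andP: gl' => _; rewrite lx.
  by rewrite xL in n1.
by rewrite xL in n2.
Qed.

Lemma O_leaf x : x \in Oset m -> x \in L -> leaf m x.
Proof. by move=> /OsetP xO xL; apply/contraT => nx; case: (xO x) => //; rewrite /glued xL. Qed.

Let lO : l \in Oset m. Proof. by apply: leaf_O; rewrite /leaf ll. Qed.
Let d1O : d1 \in Oset m. Proof. by rewrite O_f. Qed.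
Let d2O : d2 \in Oset m. Proof. by rewrite O_f. Qed.
Let el_f : f (e l) = l. Proof. by rewrite /face (pi_e im) erevK. Qed.
Let elO : e l \in Oset m. Proof. by rewrite -O_f el_f. Qed.
Let d1n : ~~ leaf m d1 /\ ~~ leaf m (e d1).
Proof. by case/and3P: cl => _ /andP[a c] _; split; rewrite -?(pi_e im). Qed.
Let d2n : ~~ leaf m d2 /\ ~~ leaf m b.
Proof. by case/and3P: cl => _ _ /andP[a c]; split; rewrite -?(pi_e im). Qed.
Let d1L : d1 \notin L. Proof. by apply: contra d1n.1; exact: O_leaf. Qed.
Let d2L : d2 \notin L. Proof. by apply: contra d2n.1; exact: O_leaf. Qed.
Let d1l : d1 != l. Proof. by apply: contraNneq d1L => ->. Qed.
Let d2l : d2 != l. Proof. by apply: contraNneq d2L => ->. Qed.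
Let d21 : d2 != d1. Proof. by rewrite (inj_eq fi). Qed.
Let leafl : leaf m l. Proof. by rewrite /leaf ll. Qed.
Let eld1 : e l != d1. Proof. by apply: contraNneq d1n.2 => <-; rewrite erevK. Qed.
Let eld2 : e l != d2. Proof. by apply: contraNneq d2n.2 => <-; rewrite erevK. Qed.
Let ell : e l != l. Proof. exact: erev_neq. Qed.

Lemma f'o x : x != e l -> x != d2 -> f' x = f x.
Proof.
move=> xl xd; rewrite /face m'e (pi_e im) v'E insert_o //.
  by rewrite -(inj_eq (@perm_inj _ e)) erevK.
by rewrite (inj_eq (@perm_inj _ e)).
Qed.

Lemma f'el : f' (e l) = f d2.
Proof. by rewrite {1}/face m'e erevK // v'E insert_l /face (pi_e im). Qed.
Lemma f'd2 : f' d2 = l.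
Proof. by rewrite {1}/face m'e v'E insert_b // /face (pi_e im). Qed.
Lemma f'l : f' l = d1. Proof. by rewrite f'o // eq_sym. Qed.
Lemma f'd1 : f' d1 = d2. Proof. by rewrite f'o // eq_sym. Qed.

Lemma leaf' x : leaf m' x = leaf m x && (x != l).
Proof.
rewrite /leaf v'E; have [->|xl] := eqVneq x l.
  rewrite insert_l andbF; apply/eqP => E; case/eqP: bl; apply: (@perm_inj _ v); by rewrite E ll.
have [->|xb] := eqVneq x b; last by rewrite insert_o // andbT.
by rewrite insert_b // eq_sym (negbTE bl) andbT; apply/esym/negbTE; case: d2n.
Qed.

Lemma glued' x : glued m' x = glued m x || (x == l).
Proof.
rewrite /glued leaf' negb_and negbK; have [->|xl] := eqVneq x l; first by rewrite lL !orbT.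
by rewrite !orbF.
Qed.

Lemma old_tri l' x : glued m l' -> x \in [:: l'; f l'; f (f l')] -> f' x = f x.
Proof.
move=> gl; have [f3 _ _] := pi_tri im gl => xin.
have nO : x \notin Oset m.
  apply/negP => /OsetP/(_ _ gl)[h1 h2 h3]; move: xin; rewrite !inE.
  by case/or3P => /eqP.
by apply: f'o; apply: contraNneq nO => ->.
Qed.

Lemma old_f l' : glued m l' -> f' l' = f l' /\ f' (f' l') = f (f l').
Proof.
move=> gl; have E1 : f' l' = f l' by apply: (old_tri gl); rewrite inE eqxx.
by split=> //; rewrite E1; apply: (old_tri gl); rewrite !inE eqxx orbT.
Qed.

Lemma Oset' : Oset m' = Oset m :\: [set l; d1; d2].
Proof.
apply/setP => x; rewrite in_setD; apply/OsetP/andP => [H|[xn xO] l'].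
  split.
    have [] := H l; first by rewrite glued' eqxx orbT.
    rewrite f'l f'd1 !inE => /eqP/negbTE-> /eqP/negbTE-> /eqP/negbTE-> //.
  apply/OsetP => l' gl; have [E1 E2] := old_f gl.
  by have [] := H l'; rewrite ?glued' ?gl // E2 E1.
rewrite glued' => /orP[gl|/eqP->].
  by have [-> ->] := old_f gl; move/OsetP: xO => /(_ _ gl).
rewrite f'l f'd1; move: xn; rewrite !inE !negb_or -andbA => /and3P[].
by move=> /eqP ? /eqP ? /eqP ?.
Qed.

Lemma elO' : e l \in Oset m'.
Proof. by rewrite Oset' in_setD elO !inE (negbTE ell) (negbTE eld1) (negbTE eld2). Qed.

Lemma cycle' x y : x \in Oset m' -> y \in Oset m' -> fconnect f' x y.
Proof.
rewrite Oset' !in_setD => /andP[xn xO] /andP[yn yO].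
have fd2n : f d2 \notin [set l; d1; d2].
  rewrite !inE !(inj_eq fi) (negbTE d2l) (negbTE d1l) !orbF.
  apply: contraNneq eld2 => E; apply/eqP; apply: fi; by rewrite E el_f.
(* The new outer face is the old one without [l], [d1] and [d2]. While the old walk runs along these
   three, the new one waits at [e l], just before them. *)
suff H z : fconnect f x z -> fconnect f' x (if z \in [set l; d1; d2] then e l else z).
  by have := H y (pi_cycle im xO yO); rewrite (negbTE yn).
case/connectP => p; elim/last_ind: p z => [|p w IH] z /=; first by move=> _ ->; rewrite (negbTE xn) connect0.
rewrite rcons_path last_rcons => /andP[/IH/(_ erefl) H /eqP <-] -> {z w}.
move: H; set w := last x p; case: ifP => [wn H|/negbT wn H].
  move: wn; rewrite !inE -orbA => /or3P[]/eqP E; rewrite E.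
  - by rewrite eqxx orbT.
  - by rewrite eqxx !orbT.
  - have := fd2n; rewrite !inE => /negbTE->.
    by apply: connect_trans H _; rewrite -f'el fconnect1.
have [E|wl] := eqVneq w (e l).
  by rewrite E el_f !inE eqxx; rewrite E in H.
have fw : f w \notin [set l; d1; d2].
  move: wn; rewrite !inE !negb_or !(inj_eq fi) => /andP[/andP[w1 w2] w3].
  rewrite w1 w2 !andbT; apply: contraNneq wl => E; apply/eqP; apply: fi; by rewrite E el_f.
rewrite (negbTE fw); apply: connect_trans H _.
rewrite -f'o ?fconnect1 //; apply: contraNneq wn => ->; by rewrite !inE eqxx orbT.
Qed.

Lemma skip' x y : skip v L x y -> x != l -> skip v' L x y.
Proof.
have s1 z : z != l -> z != b -> v' z = v z by move=> zl zb; rewrite v'E insert_o.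
have sb : v' b = l by rewrite v'E insert_b.
have sl : v' l = v b by rewrite v'E insert_l.
elim=> {x y} [x|x y sL sk IH] xl.
  have [->|xb] := eqVneq x b; last by rewrite -s1 //; exact: Skip1.
  by apply: SkipS; rewrite sb // -sl; exact: Skip1.
have vxl : v x != l by apply: contraNneq xl => E; apply/eqP; apply: (@perm_inj _ v); rewrite E ll.
have {}IH := IH vxl.
have [E|xb] := eqVneq x b; last by apply: SkipS; rewrite s1.
rewrite E in sL IH *; apply: SkipS; rewrite sb //.
by apply: SkipS; rewrite sl.
Qed.

Lemma pinv_step : pinv m'.
Proof.
split.
- exact: m'e.
- by move=> x; rewrite leaf' => /andP[/(pi_leaf im)].
- move=> x xL; apply: skip'; first exact: pi_skip.
  by apply: contraNneq xL => ->.
- move=> l'; rewrite glued' => /orP[gl|/eqP->].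
    have [f3 n1 n2] := pi_tri im gl; have [E1 E2] := old_f gl; rewrite E2 E1; split=> //.
    by rewrite (old_tri gl) // !inE eqxx !orbT.
  by rewrite f'l f'd1 f'd2.
- exact: cycle'.
- rewrite Oset'; have c := pi_card im.
  have -> : leaves m' = leaves m :\ l.
    by apply/setP => x; rewrite !inE leaf' andbC.
  have lm : l \in leaves m by rewrite inE.
  have := cardsD1 l (leaves m); rewrite lm => cm.
  have tO : [set l; d1; d2] \subset Oset m.
    by apply/subsetP => x; rewrite !in_setU !in_set1 -orbA => /or3P[]/eqP->.
  rewrite cardsDS // (_ : #|[set l; d1; d2]| = 3); last first.
    by rewrite setUC cardsU1 cardsU1 cards1 !inE (negbTE d2l) (negbTE d21) eq_sym (negbTE d1l).
  have := subset_leq_card tO; rewrite (_ : #|[set l; d1; d2]| = 3); last first.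
    by rewrite setUC cardsU1 cardsU1 cards1 !inE (negbTE d2l) (negbTE d21) eq_sym (negbTE d1l).
  by move=> c3; apply: (card_step c _ c3); rewrite cm.
- by rewrite glue_connected //; exact: pi_conn im.
(* If the outer dart found for [m] belongs to the new triangle, the conditions on [Z] lead back to
   [l], and [e l] is still an outer dart. *)
- move=> Z Zc Zr Z0.
  have [x xZ xO] : exists2 x, x \in Z & x \in Oset m.
    apply: (pi_min im) => // l' gl; have [E1 E2] := old_f gl.
    by have := Zr l'; rewrite glued' gl E2 E1; apply.
  case: (boolP (x \in [set l; d1; d2])) => xt; last by exists x; rewrite // Oset' in_setD xt.
  exists (e l); last exact: elO'.
  rewrite Zc; have [] := Zr l; first by rewrite glued' eqxx orbT.
  rewrite f'l f'd1 => h1 h2; move: xt xZ; rewrite !inE -orbA => /or3P[]/eqP-> //.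
  by move=> /h1.
- move=> x; rewrite leaf' negb_and negbK; have [-> _|xl] := eqVneq x l.
    have [d dL c] := pi_node im d2n.2; exists d => //; rewrite v'E.
    have c1 : fconnect (tperm l b * v)%g d b by apply: insert_fc_to.
    by apply: connect_trans c1 _; exact: insert_fc_bl.
  rewrite orbF => /(pi_node im)[d dL c]; exists d => //; rewrite v'E; exact: insert_fc_to.
Qed.

End Step.

Lemma pinv_closure m : connect (@local_closure S) A m -> pinv m.
Proof.
case/connectP => p; elim/last_ind: p m => [|p z IH] m /=; first by move=> _ ->; exact: pinv_A.
rewrite rcons_path last_rcons => /andP[/IH/(_ erefl) H /existsP[l /andP[cl /eqP E]]] ->.
by rewrite E; apply: pinv_step.
Qed.

End Forward.

Lemma cmap_eq (D : finType) (m m' : cmap D) : vrot m = vrot m' -> erev m = erev m' -> m = m'.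
Proof. by case: m m' => [a b] [c d]; rewrite /vrot /erev /= => -> ->. Qed.

(** * Confluence of the local closures *)

Section Confluence.
Variables (S : finType) (A : cmap S) (n : nat).
Hypothesis At : ternary_tree A n.
Hypothesis n0 : 0 < n.
Local Notation e := (erev A).

Definition stuck (m : cmap S) := [forall l, ~~ closable m l].

(** The sides after two closable leaves are disjoint, because a closed side is never a leaf. So
    neither gluing disturbs the other, and the two transpositions commute. *)
Lemma diamond m l l' : pinv A m -> closable m l -> closable m l' -> l != l' ->
  closable (glue_leaf m l) l' /\
  glue_leaf (glue_leaf m l) l' = glue_leaf (glue_leaf m l') l.
Proof.
have half a b : pinv A m -> closable m a -> closable m b -> a != b ->
    [/\ face (glue_leaf m a) b = face m b,
        face (glue_leaf m a) (face m b) = face m (face m b) &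
        closable (glue_leaf m a) b].
  move=> im ca cb ab.
  have lb : leaf m b by case/and3P: cb.
  have la : leaf m a by case/and3P: ca.
  have bL := pi_leaf im lb; have aL := pi_leaf im la.
  have n1 : ~~ leaf m (face m b) by case/and3P: cb => _ /andP[].
  have n2 : ~~ leaf m (e (face m b)) by rewrite -(pi_e im); case/and3P: cb => _ /andP[].
  have na1 : ~~ leaf m (face m a) by case/and3P: ca => _ /andP[].
  have na2 : ~~ leaf m (face m (face m a)) by case/and3P: ca => _ _ /andP[].
  have ne := erevK (tree_edges At).
  have F1 : face (glue_leaf m a) b = face m b.
    apply: (f'o At im).
      by apply: contraTneq bL => ->; exact: (leaf_e At n0).
    by apply: contraNneq na2 => <-.
  have F2 : face (glue_leaf m a) (face m b) = face m (face m b).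
    apply: (f'o At im).
      by apply: contraNneq n2 => ->; rewrite ne.
    rewrite (inj_eq (@face_inj _ m)); apply: contraNneq na1 => <-; exact: lb.
  split=> //; have [c1 c2 c3] := and3P cb.
  have nl x : ~~ leaf m x -> ~~ leaf (glue_leaf m a) x.
    by rewrite (leaf' im ca) negb_and => ->.
  apply/and3P; split; first by rewrite (leaf' im ca) lb eq_sym.
    by rewrite F1 /closed_side; case/andP: c2 => /nl-> /nl->.
  by rewrite F1 F2 /closed_side; case/andP: c3 => /nl-> /nl->.
move=> im cl cl' ll'; have [F1 F2 C1] := half _ _ im cl cl' ll'.
have ll2 : l' != l by rewrite eq_sym.
have [G1 G2 C2] := half _ _ im cl' cl ll2.
split=> //; apply: cmap_eq; last by rewrite !erev_glue.
have lf : leaf m l by case/and3P: cl.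
have lf' : leaf m l' by case/and3P: cl'.
have b1 : ~~ leaf m (erev m (face m (face m l))) by case/and3P: cl => _ _ /andP[].
have b2 : ~~ leaf m (erev m (face m (face m l'))) by case/and3P: cl' => _ _ /andP[].
rewrite !vrot_glue F1 F2 G1 G2 !erev_glue !mulgA; congr (_ * _)%g; rewrite conjgC tpermJ !tpermD //.
all: try by apply: contraNneq b1 => E; (rewrite E || rewrite -E).
all: try by apply: contraNneq b2 => E; (rewrite E || rewrite -E).
all: try by rewrite (inj_eq perm_inj) !(inj_eq (@face_inj _ m)) // eq_sym.
Qed.

Lemma pinv_step' m m' : pinv A m -> local_closure m m' -> pinv A m'.
Proof.
by move=> im /existsP[l /andP[cl /eqP->]]; apply: (pinv_step At).
Qed.

Lemma stuck_step m m' : stuck m -> local_closure m m' = false.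
Proof.
move=> /forallP H; apply/negbTE/existsP => -[l]; by rewrite (negbTE (H l)).
Qed.

(** The diamond closes with one step on each side, so induction on the path to the stuck map
    suffices. *)
Lemma connect_stuck m t m1 : pinv A m -> connect (@local_closure S) m t -> stuck t ->
  local_closure m m1 -> connect (@local_closure S) m1 t.
Proof.
move=> im /connectP[p]; elim: p m m1 im => [|m2 p IH] m m1 im /=.
  by move=> _ -> st; rewrite stuck_step.
case/andP => s2 pp tE st s1.
have c2 : connect (@local_closure S) m2 t by apply/connectP; exists p.
case/existsP: (s1) => l1 /andP[cl1 /eqP E1]; case/existsP: (s2) => l2 /andP[cl2 /eqP E2].
have [E|ne] := eqVneq l1 l2; first by rewrite E1 E -E2.
have [c12 cE] := diamond im cl1 cl2 ne.
have ne' : l2 != l1 by rewrite eq_sym.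
have [c21 _] := diamond im cl2 cl1 ne'.
have st1 : local_closure m1 (glue_leaf m1 l2).
  by apply/existsP; exists l2; rewrite E1 c12 eqxx.
apply: connect_trans (connect1 st1) _; apply: (IH m2) => //; first exact: pinv_step' s2.
by apply/existsP; exists l1; rewrite E1 cE -E2 eqxx andbT E2.
Qed.

Lemma stuck_unique m t t' : pinv A m -> connect (@local_closure S) m t -> stuck t ->
  connect (@local_closure S) m t' -> stuck t' -> t = t'.
Proof.
move=> im /connectP[p]; elim: p m im => [|m2 p IH] m im /=.
  move=> _ -> st /connectP[[|m2 q] /=]; first by move=> _ ->.
  by case/andP; rewrite stuck_step.
case/andP => s2 pp tE st c' st'; apply: (IH m2) => //; first exact: pinv_step' s2.
exact: connect_stuck c' st' s2.
Qed.

Lemma partial_closure_unique p p' : partial_closure A p -> partial_closure A p' -> p = p'.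
Proof.
move=> /andP[c s] /andP[c' s']; apply: (stuck_unique (m := A)) => //.
exact: (pinv_A At).
Qed.

(** Each local closure consumes a leaf. *)
Lemma partial_closure_exists : exists p, partial_closure A p.
Proof.
suff H k m : pinv A m -> #|leaves m| <= k -> exists2 p, connect (@local_closure S) m p & stuck p.
  have [p c s] := H #|leaves A| A (pinv_A At n0) (leqnn _); by exists p; rewrite /partial_closure c.
elim: k m => [|k IH] m im ck.
  exists m => //; apply/forallP => l; apply/negP => /and3P[ll _ _].
  move: ck; rewrite leqn0 cards_eq0 => /eqP E; have : l \in leaves m by rewrite inE.
  by rewrite E inE.
case: (boolP (stuck m)) => [st|]; first by exists m.
rewrite negb_forall => /existsP[l]; rewrite negbK => cl.
have lm : l \in leaves m by rewrite inE; case/and3P: cl.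
have [||p c s] := IH (glue_leaf m l); first exact: (pinv_step At).
  have := cardsD1 l (leaves m); rewrite lm => E; rewrite -ltnS.
  apply: leq_trans ck; rewrite E add1n ltnS; apply: subset_leq_card.
  by apply/subsetP => x; rewrite !inE (leaf' im cl) andbC.
exists p => //; apply: connect_trans c; apply: connect1; apply/existsP; exists l.
by rewrite cl eqxx.
Qed.

End Confluence.

(** * The outer face of a partial closure and its four intervals *)

Section Stuck.
Variables (S : finType) (A : cmap S) (n : nat).
Hypothesis At : ternary_tree A n.
Hypothesis n0 : 0 < n.
Variable p : cmap S.
Hypothesis pA : partial_closure A p.
Local Notation L := (leaves A).
Local Notation e := (erev p).
Local Notation f := (face p).
Local Notation v := (vrot p).
Local Notation O := (Oset A p).

Lemma stuck_pinv : pinv A p.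
Proof. by case/andP: pA => c _; exact: (pinv_closure At). Qed.
Let ip := stuck_pinv.
Lemma stuck_e : e = erev A. Proof. exact: pi_e ip. Qed.
Lemma stuck_edges : edges_ok p. Proof. by rewrite /edges_ok stuck_e; exact: (tree_edges At). Qed.
Let pe := stuck_edges.
Let fi : injective f := @face_inj _ p.

Lemma leaf_er l : leaf p l -> ~~ leaf p (e l).
Proof.
move=> /(pi_leaf ip) lL; apply: contraNN (leaf_e At n0 lL) => /(pi_leaf ip).
by rewrite stuck_e.
Qed.

Lemma face_er l : leaf p l -> f (e l) = l.
Proof. by move=> /eqP ll; rewrite /face erevK. Qed.

Lemma leaf_face x : leaf p (f x) -> e x = f x.
Proof. by move=> /eqP E; apply: (@perm_inj _ v); rewrite E. Qed.

Lemma leaf_face_leaf l : leaf p l -> ~~ leaf p (f l).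
Proof.
move=> ll; apply/negP => lf; have := leaf_er ll.
by rewrite (leaf_face lf) lf.
Qed.

(* No side of a closed edge separates the stem of l from the next stem. *)
Definition gap_after l := leaf p (e (f l)).
Definition next_stem l := if gap_after l then e (f l) else e (f (f l)).

Lemma nongap_side l : leaf p l -> ~~ gap_after l -> leaf p (e (f (f l))) /\ ~~ leaf p (f (f l)).
Proof.
move=> ll ng; have nf := leaf_face_leaf ll.
have nff : ~~ leaf p (f (f l)).
  by apply/negP => lf; move: ng; rewrite /gap_after (leaf_face lf) lf.
split=> //; apply/contraT => nef; case/andP: pA => _ /forallP/(_ l).
by rewrite /closable ll /closed_side nf ng nff nef.
Qed.

Lemma nx_leaf l : leaf p l -> leaf p (next_stem l).
Proof.
by move=> ll; rewrite /next_stem; case: ifP => // /negbT ng; case: (nongap_side ll ng).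
Qed.

Lemma face_gap l : gap_after l -> f (f l) = next_stem l.
Proof. by move=> g; rewrite /next_stem g -{1}(erevK pe (f l)) face_er. Qed.

Lemma face_nongap l : leaf p l -> ~~ gap_after l -> f (f (f l)) = next_stem l.
Proof.
move=> ll ng; have [l3 _] := nongap_side ll ng.
by rewrite /next_stem (negbTE ng) -{1}(erevK pe (f (f l))) face_er.
Qed.

Lemma nx_inj l l' : leaf p l -> leaf p l' -> next_stem l = next_stem l' -> l = l'.
Proof.
move=> ll ll'; rewrite /next_stem; case: ifP => g; case: ifP => g' /perm_inj.
- exact: fi.
- by move/fi => E; move: ll; rewrite E => ll; have := leaf_face_leaf ll'; rewrite ll.
- by move/fi => E; have := leaf_face_leaf ll; rewrite E ll'.
- by move/fi/fi.
Qed.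

Lemma sO x : (f x \in O) = (x \in O). Proof. exact: O_f. Qed.
Lemma leafO l : leaf p l -> l \in O. Proof. exact: leaf_O. Qed.
Lemma OL x : x \in O -> x \in L -> leaf p x. Proof. exact: O_leaf. Qed.

Lemma exists_leaf : exists l, leaf p l.
Proof.
have c := pi_card ip; have : 0 < #|leaves p| by lia.
by case/card_gt0P => l; rewrite inE; exists l.
Qed.

Lemma O_iter x y : x \in O -> y \in O -> exists k, y = iter k f x.
Proof.
by move=> xO yO; have := pi_cycle ip xO yO; move/iter_findex => <-; exists (findex f x y).
Qed.

(** In a stuck map, at most one closed side separates a stem from the next one; the walk along the
    outer face is followed step by step. *)
Lemma O_cases x : x \in O ->
  [\/ leaf p x, leaf p (e x) | exists2 l, leaf p l & ~~ gap_after l /\ x = f l].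
Proof.
have [l0 ll0] := exists_leaf; move=> /(O_iter (leafO ll0))[k ->].
elim: k => [|k IH]; first by constructor 1.
rewrite iterS; set z := iter k f l0 in IH *.
case: IH => [lz|lz|[l ll [ng E]]].
- by case: (boolP (gap_after z)) => g; [constructor 2|constructor 3; exists z].
- by constructor 1; rewrite -{1}(erevK pe z) face_er.
- by constructor 2; rewrite E; case: (nongap_side ll ng).
Qed.

(** The leaf at [z] or the next one ahead; through it, transitivity of the walk along the outer face
    becomes transitivity of [next_stem]. *)
Definition nl z := if leaf p z then z else if leaf p (e z) then e z else e (f z).

Lemma nl_f z : z \in O -> nl (f z) = if leaf p z then next_stem z else nl z.
Proof.
case/O_cases => [lz|lz|[l ll [ng ->]]].
- rewrite lz /nl (negbTE (leaf_face_leaf lz)) /next_stem -/(gap_after z); case: ifP => //.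
- have nz : ~~ leaf p z by rewrite -(erevK pe z); apply: leaf_er.
  rewrite (negbTE nz) /nl (negbTE nz) lz.
  by rewrite -{1 2}(erevK pe z) face_er // lz.
- have [l3 nl3] := nongap_side ll ng; rewrite /nl (negbTE nl3) l3.
  by rewrite (negbTE (leaf_face_leaf ll)) -/(gap_after l) (negbTE ng).
Qed.

Lemma iter_nx_leaf j l : leaf p l -> leaf p (iter j next_stem l).
Proof. by move=> ll; elim: j => //= j; exact: nx_leaf. Qed.

Lemma nx_trans l l' : leaf p l -> leaf p l' -> exists j, l' = iter j next_stem l.
Proof.
move=> ll ll'; have [k E] := O_iter (leafO ll) (leafO ll').
have -> : l' = nl (iter k f l) by rewrite /nl -E ll'.
have itO i : iter i f l \in O by elim: i => [|i IH]; [exact: leafO|rewrite iterS sO].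
elim: k {E} => [|k [j IH]]; first by exists 0; rewrite /nl ll.
rewrite iterS nl_f // IH /nl; case: ifP => lk; last by exists j; rewrite -IH /nl lk.
by exists j.+1; rewrite iterS -IH /nl lk.
Qed.

Definition gaps := [set l in leaves p | gap_after l].

(** The outer face is made of both sides of every stem and one closed side after every stem without
    a gap. With s stems and g gaps this is 2s + (s - g) darts, and [pi_card] says 3s - 4. *)
Lemma card_gaps : #|gaps| = 4.
Proof.
pose ng := leaves p :\: gaps.
have ngP l : l \in ng -> leaf p l /\ ~~ gap_after l.
  by rewrite !inE => /andP[+ ll]; rewrite ll.
have OE : O = leaves p :|: e @: leaves p :|: f @: ng.
  apply/setP => x; apply/idP/idP.
    rewrite !in_setU; case/O_cases => [lx|lx|[l ll [g ->]]].
    - by rewrite inE lx.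
    - by apply/orP; left; apply/orP; right; apply/imsetP; exists (e x); rewrite ?inE // erevK.
    - by apply/orP; right; apply: imset_f; rewrite !inE ll (negbTE g).
  rewrite !in_setU => /orP[/orP[]|/imsetP[l /ngP[ll _] ->]].
  - by rewrite inE; exact: leafO.
  - by case/imsetP => l; rewrite inE => ll ->; rewrite -sO face_er // leafO.
  - by rewrite sO leafO.
have c := pi_card ip; move: c; rewrite OE cardsU disjoint_setI0; last first.
  apply/pred0P => x /=; apply/andP => -[+ /imsetP[l /ngP[ll g] E]]; subst x.
  rewrite in_setU inE (negbTE (leaf_face_leaf ll)) /= => /imsetP[l']; rewrite inE => ll' E.
  by move: g; rewrite /gap_after E erevK // ll'.
rewrite cards0 subn0 cardsU disjoint_setI0; last first.
  apply/pred0P => x /=; apply/andP => -[]; rewrite inE => lx /imsetP[l']; rewrite inE => ll' E.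
  by have := leaf_er ll'; rewrite -E lx.
rewrite cards0 subn0 !card_imset //; last exact: perm_inj.
have gs : gaps \subset leaves p by apply/subsetP => x; rewrite inE => /andP[].
have := cardsDS gs; have := subset_leq_card gs; rewrite -/ng => c1 c2.
by rewrite c2; move: c1; move: (#|leaves p|) (#|gaps|) => a b; lia.
Qed.

Definition gapz z := leaf p z && gap_after z.

Section Labels.
Variable l0 : S.
Hypothesis ll0 : leaf p l0.
Local Notation N := (fingraph.order f l0).
Local Notation idx := (findex f l0).

(** The label of a stem will be the number of gaps before it modulo 4, which is consistent because a
    full turn meets exactly four gaps. *)
Definition cum k := \sum_(i < k) gapz (iter i f l0).

Lemma cumS k : cum k.+1 = cum k + gapz (iter k f l0).
Proof. by rewrite /cum big_ord_recr. Qed.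

Lemma cum_mono i k : i <= k -> cum i <= cum k.
Proof. by move/subnKC <-; elim: (k - i) => [|j IH]; rewrite ?addn0 // addnS cumS; lia. Qed.

Lemma OE0 z : (z \in O) = fconnect f l0 z.
Proof.
apply/idP/idP => [zO|/iter_findex <-]; first exact: (pi_cycle ip (leafO ll0) zO).
by elim: (findex _ _ _) => [|k IH]; [exact: leafO|rewrite iterS sO].
Qed.

Lemma cumN : cum N = 4.
Proof.
rewrite -card_gaps /cum -sum1_card.
have -> : \sum_(i < N) gapz (iter i f l0) = \sum_(z <- fingraph.orbit f l0) gapz z.
  rewrite (big_nth l0) size_orbit big_mkord; apply: eq_bigr => i _.
  by rewrite /fingraph.orbit nth_traject.
rewrite big_uniq ?orbit_uniq //= big_mkcond [RHS]big_mkcond /=; apply: eq_bigr => z _.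
rewrite -fconnect_orbit -OE0.
have -> : (z \in gaps) = gapz z by rewrite inE [z \in leaves p]inE.
case: (boolP (gapz z)) => [/andP[lz _]|_]; last by rewrite if_same.
by rewrite leafO.
Qed.

Lemma idx_iter z : z \in O -> iter (idx z) f l0 = z.
Proof. by rewrite OE0 => /iter_findex. Qed.

Lemma cum_f z : z \in O -> cum (idx (f z)) = cum (idx z) + gapz z %[mod 4].
Proof.
move=> zO; set k := idx z; have kE : iter k f l0 = z := idx_iter zO.
have fE : iter k.+1 f l0 = f z by rewrite iterS kE.
have kN : k < N by apply: findex_max; rewrite -OE0.
rewrite -{2}kE -cumS; move: kN; rewrite leq_eqVlt => /orP[/eqP kN|kN]; last first.
  by rewrite -fE findex_iter.
by rewrite -fE kN (iter_order fi) findex0 cumN /cum big_ord0.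
Qed.

Lemma cum_nx l : leaf p l -> cum (idx (next_stem l)) = cum (idx l) + gap_after l %[mod 4].
Proof.
move=> ll; have lO := leafO ll; have flO : f l \in O by rewrite sO.
have g0 z : ~~ leaf p z -> gapz z = false by rewrite /gapz => /negbTE->.
have gl : gapz l = gap_after l by rewrite /gapz ll.
have E1 := cum_f lO; rewrite gl in E1.
have E2 := cum_f flO; rewrite (g0 _ (leaf_face_leaf ll)) addn0 in E2.
case: (boolP (gap_after l)) => g; first by rewrite -(face_gap g) E2 E1 g.
have [_ nff] := nongap_side ll g.
have E3 : cum (idx (f (f (f l)))) = cum (idx (f (f l))) + gapz (f (f l)) %[mod 4].
  by apply: cum_f; rewrite !sO.
rewrite (g0 _ nff) addn0 in E3.
by rewrite -(face_nongap ll g) E3 E2 E1 (negbTE g).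
Qed.

Lemma cum_gap_lt l : leaf p l -> gap_after l -> cum (idx l) < 4.
Proof.
move=> ll g; have lO := leafO ll; rewrite -cumN.
apply: (@leq_trans (cum (idx l).+1)); last by apply/cum_mono/findex_max; rewrite -OE0.
by rewrite cumS (idx_iter lO) /gapz ll g addn1.
Qed.

Lemma cum_gap_inj l l' : leaf p l -> gap_after l -> leaf p l' -> gap_after l' ->
  cum (idx l) = cum (idx l') -> l = l'.
Proof.
have H a b : leaf p a -> gap_after a -> idx a < idx b -> cum (idx a) < cum (idx b).
  move=> la ga ab; apply: leq_trans (cum_mono ab).
  by rewrite cumS (idx_iter (leafO la)) /gapz la ga addn1.
move=> ll g ll' g' E; rewrite -(idx_iter (leafO ll)) -(idx_iter (leafO ll')).
case: (ltngtP (idx l) (idx l')) => [/(H _ _ ll g)|/(H _ _ ll' g')|-> //]; by rewrite E ltnn.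
Qed.

End Labels.

Definition labelling (lab : S -> 'I_4) : Prop :=
  forall l, leaf p l -> lab (next_stem l) = if gap_after l then ordS (lab l) else lab l.

Lemma val_iter_ordS c (i : 'I_4) : val (iter c (@ordS 4) i) = (i + c) %% 4.
Proof.
elim: c => [|c IH]; first by rewrite addn0 modn_small.
by rewrite iterS /= IH -addn1 modnDml addn1 addnS.
Qed.

Lemma iter_ordS_inj c : injective (iter c (@ordS 4)).
Proof. by elim: c => [|c IH] i j //; rewrite !iterS => /(can_inj (@ordSK 4))/IH. Qed.

(** By transitivity of [next_stem], one value determines the labels of all leaves; two labellings
    therefore differ by a rotation of the outer cycle. *)
Lemma label_shift lab lab' : labelling lab -> labelling lab' ->
  exists c, forall l, leaf p l -> lab' l = iter c (@ordS 4) (lab l).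
Proof.
move=> hl hl'; have [l0 ll0] := exists_leaf.
exists (lab' l0 + 4 - lab l0) => l ll.
have [j ->] := nx_trans ll0 ll; elim: j => [|j IH].
  apply: val_inj; rewrite val_iter_ordS /=.
  have := ltn_ord (lab l0); have := ltn_ord (lab' l0) => h1 h2.
  rewrite addnBA; last by lia.
  by rewrite addKn modnDr modn_small.
rewrite iterS; set z := iter j next_stem l0 in IH *.
have lz : leaf p z by exact: iter_nx_leaf.
by rewrite hl // hl' // IH; case: ifP => // _; rewrite -iterS iterSr.
Qed.

Lemma label_exists : exists2 lab, labelling lab &
  forall l l', leaf p l -> gap_after l -> leaf p l' -> gap_after l' -> lab l = lab l' -> l = l'.
Proof.
have [l0 ll0] := exists_leaf; pose idx := findex f l0.
pose lab z : 'I_4 := Ordinal (ltn_pmod (cum l0 (idx z)) (isT : 0 < 4)).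
exists lab => [l ll|l l' ll g ll' g' /(congr1 val) /=].
  apply: val_inj; have /= := cum_nx ll0 ll; rewrite -/idx => ->.
  by case: ifP => _ /=; rewrite ?addn0 // addn1 -addn1 -[in RHS]addn1 modnDml.
rewrite !modn_small ?(cum_gap_lt ll0) //; exact: cum_gap_inj.
Qed.

Lemma label_gap_inj lab : labelling lab ->
  forall l l', leaf p l -> gap_after l -> leaf p l' -> gap_after l' -> lab l = lab l' -> l = l'.
Proof.
have [lab0 h0 inj0] := label_exists; move=> hl l l' ll g ll' g'.
have [c E] := label_shift h0 hl; rewrite !E // => /iter_ordS_inj; exact: inj0.
Qed.

Lemma label_gap_surj lab : labelling lab -> forall i, exists l, [/\ leaf p l, gap_after l & lab l = i].
Proof.
move=> hl i; have inj := label_gap_inj hl.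
have c : #|lab @: gaps| = 4.
  rewrite card_in_imset ?card_gaps // => l l'; rewrite !inE => /andP[ll g] /andP[ll' g']; exact: inj.
have : i \in lab @: gaps.
  suff -> : lab @: gaps = [set: 'I_4] by rewrite inE.
  by apply/eqP; rewrite eqEcard subsetT cardsT card_ord c.
by case/imsetP => l; rewrite !inE => /andP[ll g] ->; exists l.
Qed.

End Stuck.

(** * The closure of a tree *)

Section Attached.
Variables (S : finType) (A : cmap S) (n : nat).
Hypothesis At : ternary_tree A n.
Hypothesis n0 : 0 < n.
Variable p : cmap S.
Hypothesis pA : partial_closure A p.
Local Notation L := (leaves A).
Local Notation e := (erev p).
Local Notation f := (face p).
Local Notation v := (vrot p).
Local Notation O := (Oset A p).
Local Notation gap := (gap_after p).
Local Notation nx := (next_stem p).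
Let ip : pinv A p := stuck_pinv At n0 pA.
Let pe : edges_ok p := stuck_edges At n0 pA.

Lemma leaf_v x : leaf p (v x) = leaf p x.
Proof. by rewrite /leaf (inj_eq perm_inj). Qed.

Lemma attach_exists : exists lab C, attach_stems p lab C.
Proof.
have [lab hl inj] := label_exists At n0 pA.
have surj := label_gap_surj At n0 pA hl.
have nxi := @nx_inj _ _ _ At n0 _ pA; have nxl := @nx_leaf _ _ _ At n0 _ pA.
have /fin_all_exists[gl glP] : forall i, exists l, [/\ leaf p l, gap l & lab l = i] := surj.
(* The inverse of the rotation to be built, because the clockwise neighbour of a stem end is what
   the walk provides: the next stem of its interval, or the edge of the cycle after the last one.
   [gl i] is the last stem of interval [i]. *)
pose w (x : outer_darts S) : outer_darts S :=
  match x with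
  | inl d => if leaf p d then (if gap d then to_next S (lab d) else inl (nx d))
             else inl ((v^-1)%g d)
  | inr (i, true) => to_prev S i
  | inr (i, false) => inl (nx (gl (ord_pred i)))
  end.
have vl d : leaf p ((v^-1)%g d) = leaf p d by rewrite -leaf_v permKV.
have glg l : leaf p l -> gap l -> gl (lab l) = l.
  by move=> ll g; have [a b c] := glP (lab l); apply: inj.
have inr_eq i j b b' : inr (i, b) = inr (j, b') :> outer_darts S -> i = j by case.
have wi : injective w.
  move=> [d|[i [|]]] [d'|[j [|]]] //=; rewrite /to_next /to_prev; try by do ?case: ifP.
  - case: (boolP (leaf p d)) => ld; case: (boolP (leaf p d')) => ld'.
    + case: (boolP (gap d)) => g; case: (boolP (gap d')) => g' // [E].
        by rewrite (inj _ _ ld g ld' g' E).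
      by rewrite (nxi _ _ ld ld' E).
    + case: (boolP (gap d)) => // g [E]; have := nxl _ ld; by rewrite E vl (negbTE ld').
    + case: (boolP (gap d')) => // g [E]; have := nxl _ ld'; by rewrite -E vl (negbTE ld).
    + by case=> /perm_inj->.
  - have [a b c] := glP (ord_pred j).
    case: (boolP (leaf p d)) => ld; first case: (boolP (gap d)) => // g [E].
      by move: g; rewrite (nxi _ _ ld a E) b.
    by case=> E; have := nxl _ a; rewrite -E vl (negbTE ld).
  - by move/inr_eq->.
  - have [a b c] := glP (ord_pred i).
    case: (boolP (leaf p d')) => ld; first case: (boolP (gap d')) => // g [E].
      by move: g; rewrite -(nxi _ _ a ld E) b.
    by case=> E; have := nxl _ a; rewrite E vl (negbTE ld).
  - have [a b c] := glP (ord_pred i); have [a' b' c'] := glP (ord_pred j).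
    case=> /(nxi _ _ a a') E; congr (inr (_, _)); apply: (can_inj (@ord_predK 4)).
    by rewrite -c -c' E.
pose u (x : outer_darts S) : outer_darts S :=
  match x with
  | inl d => inl (e d)
  | inr (i, true) => to_prev S (ordS i)
  | inr (i, false) => to_next S (ord_pred i)
  end.
have ui : injective u.
  move=> [d|[i [|]]] [d'|[j [|]]] //=; rewrite /to_next /to_prev.
  - by case=> /perm_inj->.
  - by move/inr_eq/(can_inj (@ordSK 4))->.
  - by move/inr_eq/(can_inj (@ord_predK 4))->.
pose C : cmap (outer_darts S) := (((perm wi)^-1)%g, perm ui).
have CE x : erev C x = u x by rewrite /erev permE.
have CV x y : w y = x -> vrot C x = y.
  by move=> <-; rewrite /vrot /= -[w y](permE wi) permK.
exists lab, C; split.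
- by move=> d; rewrite CE.
- by move=> i; rewrite !CE /= ordSK.
- by move=> d nd; apply: CV; rewrite /= leaf_v (negbTE nd) permK.
- by move=> i; apply: CV.
move=> l ll; rewrite -/(gap l); case: ifP => g.
  have E : nx l = e (f l) by rewrite /next_stem g.
  have := hl l ll; rewrite g E => lE; split=> //; apply: CV; first by rewrite /= ll g.
  by rewrite /= lE ordSK (glg _ ll g) E.
have E : nx l = e (f (f l)) by rewrite /next_stem g.
have := hl l ll; rewrite g E => lE; split=> //; apply: CV.
by rewrite /= ll g E.
Qed.

Lemma attach_labelling lab C : attach_stems p lab C -> labelling p lab.
Proof.
case=> _ _ _ _ H l ll; have := H l ll; rewrite -/(gap l) /next_stem.
by case: ifP => _ [].
Qed.

Variables (lab : S -> 'I_4) (C : cmap (outer_darts S)).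
Hypothesis aC : attach_stems p lab C.
Let hl := attach_labelling aC.
Local Notation old := (@old_dart S).
Local Notation tn := (to_next S).
Local Notation tp := (to_prev S).
Local Notation Ce := (erev C).
Local Notation Cv := (vrot C).
Local Notation Cf := (face C).

Lemma Ce_old d : Ce (old d) = old (e d). Proof. by case: aC. Qed.
Lemma Ce_tn i : Ce (tn i) = tp (ordS i). Proof. by case: aC => _ /(_ i)[]. Qed.
Lemma Ce_tp i : Ce (tp i) = tn (ord_pred i).
Proof. by case: aC => _ /(_ (ord_pred i))[_]; rewrite ord_predK. Qed.
Lemma Cv_old d : ~~ leaf p d -> Cv (old d) = old (v d). Proof. by case: aC => _ _ + _ _; apply. Qed.
Lemma Cv_tp i : Cv (tp i) = tn i. Proof. by case: aC. Qed.
Lemma Cv_tn l : leaf p l -> gap l -> Cv (tn (lab l)) = old l.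
Proof. by move=> ll g; case: aC => _ _ _ _ /(_ l ll); rewrite -/(gap l) g => -[]. Qed.
Lemma Cv_gap l : leaf p l -> gap l -> Cv (old (nx l)) = tp (lab (nx l)).
Proof.
move=> ll g; case: aC => _ _ _ _ /(_ l ll); rewrite -/(gap l) g => -[_ _].
by rewrite /next_stem g.
Qed.
Lemma Cv_nongap l : leaf p l -> ~~ gap l -> Cv (old (nx l)) = old l.
Proof.
move=> ll g; case: aC => _ _ _ _ /(_ l ll); rewrite -/(gap l) (negbTE g) => -[_].
by rewrite /next_stem (negbTE g).
Qed.

Lemma outer_ind (P : outer_darts S -> Prop) :
  (forall d, P (old d)) -> (forall i, P (tn i)) -> (forall i, P (tp i)) -> forall x, P x.
Proof. by move=> h1 h2 h3 [d|[i [|]]]; [exact: h1|exact: h2|exact: h3]. Qed.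

Lemma old_inj : injective old. Proof. by move=> a b []. Qed.

Lemma C_edges : edges_ok C.
Proof.
apply/forallP; apply: outer_ind => [d|i|i].
- by rewrite !Ce_old (inj_eq old_inj) (erev_neq pe) (erevK pe) eqxx.
- by rewrite Ce_tn Ce_tp ordSK eqxx andbT; apply/eqP.
- by rewrite Ce_tp Ce_tn ord_predK eqxx andbT; apply/eqP.
Qed.

Lemma Cf_tn i : Cf (tn i) = tn (ordS i).
Proof. by rewrite /face Ce_tn Cv_tp. Qed.

Lemma Cf_old d : ~~ leaf p (e d) -> Cf (old d) = old (f d).
Proof. by move=> nl; rewrite /face Ce_old Cv_old. Qed.

Lemma Cf_stem l : leaf p l -> Cf (old (e (nx l))) = Cv (old (nx l)).
Proof. by move=> ll; rewrite /face Ce_old erevK. Qed.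

Lemma gl_exists i : exists l, [/\ leaf p l, gap l & lab l = i].
Proof. exact: (label_gap_surj At n0 pA hl). Qed.

Lemma lab_gap l : leaf p l -> gap l -> lab (nx l) = ordS (lab l).
Proof. by move=> ll g; rewrite hl // g. Qed.

Lemma nx_surj l : leaf p l -> exists2 l', leaf p l' & nx l' = l.
Proof.
move=> ll; have [[|j] E] := nx_trans At n0 pA (nx_leaf At n0 pA ll) ll; first by exists l.
exists (iter j nx (nx l)); last by rewrite -iterS.
exact: (iter_nx_leaf At n0 pA j (nx_leaf At n0 pA ll)).
Qed.

Lemma triangle_not_stem l x : glued A p l -> x \in [:: l; f l; f (f l)] -> ~~ leaf p (e x).
Proof.
move=> gl xin; have nO : x \notin O.
  apply/negP => /OsetP/(_ _ gl)[h1 h2 h3]; move: xin; rewrite !inE.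
  by case/or3P => /eqP.
apply: contraNN nO => le; rewrite -(sO At n0 pA) -{1}(erevK pe x) (face_er At n0 pA le).
exact: (leafO At n0 pA).
Qed.

(** Three kinds of triangles: those closed locally, those made of a closed side and two consecutive
    stems of one interval, and those made of an outer edge and two stems of the same node. *)
Lemma C_triangle l : l \in L -> exists x y, [/\ Cf (old l) = x, Cf x = y, Cf y = old l,
   forall d, x = old d -> d \notin L & forall d, y = old d -> d \notin L].
Proof.
move=> lL; case: (boolP (leaf p l)) => ll; last first.
  have gl : glued A p l by rewrite /glued lL.
  have [f3 n1 n2] := pi_tri ip gl; have ts := triangle_not_stem gl.
  exists (old (f l)), (old (f (f l))); split; try by rewrite Cf_old ?f3 // ts // !inE eqxx ?orbT.
    by move=> d /old_inj<-.
  by move=> d /old_inj<-.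
have fl : Cf (old l) = old (f l) by apply: Cf_old; exact: (leaf_er At n0 pA ll).
have nL x : x \in O -> ~~ leaf p x -> x \notin L.
  by move=> xO; apply: contraNN; exact: (OL xO).
have lO := leafO At n0 pA ll.
have n1 : f l \notin L by apply: nL; rewrite ?(sO At n0 pA) //; exact: (leaf_face_leaf At n0 pA ll).
case: (boolP (gap l)) => g.
  have E : f l = e (nx l) by rewrite /next_stem g erevK.
  exists (old (f l)), (tp (lab (nx l))); split=> //.
  - by rewrite E Cf_stem // Cv_gap.
  - by rewrite /face Ce_tp lab_gap // ordSK Cv_tn.
  - by move=> d /old_inj<-.
have [l3 nff] := nongap_side At n0 pA ll g.
have E : f (f l) = e (nx l) by rewrite /next_stem (negbTE g) erevK.
exists (old (f l)), (old (f (f l))); split=> //.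
- exact: Cf_old.
- by rewrite E Cf_stem // Cv_nongap.
- by move=> d /old_inj<-.
- by move=> d /old_inj<-; apply: nL; rewrite ?(sO At n0 pA).
Qed.

Lemma C_cover x : (exists i, x = tn i) \/
  exists2 l, l \in L & [\/ x = old l, x = Cf (old l) | x = Cf (Cf (old l))].
Proof.
elim/outer_ind: x => [d|i|i]; last 2 first.
- by left; exists i.
- right; have [l [ll g E]] := gl_exists (ord_pred i); exists l; first exact: (pi_leaf ip).
  constructor 3; rewrite Cf_old; last exact: (leaf_er At n0 pA ll).
  have -> : f l = e (nx l) by rewrite /next_stem g erevK.
  by rewrite Cf_stem // Cv_gap // lab_gap // E ord_predK.
right; case: (boolP (d \in O)) => dO; last first.
  move: dO; rewrite inE negb_forall => /existsP[l]; rewrite negb_imply => /andP[gl].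
  have ts := triangle_not_stem gl; exists l; first by case/andP: gl.
  have F1 : Cf (old l) = old (f l) by rewrite Cf_old // ts // inE eqxx.
  have F2 : Cf (old (f l)) = old (f (f l)) by rewrite Cf_old // ts // !inE eqxx orbT.
  rewrite F1 F2; move: b; rewrite !negb_and !negbK => /or3P[]/eqP->;
    [constructor 1|constructor 2|constructor 3]; done.
have fl l : leaf p l -> Cf (old l) = old (f l).
  by move=> ll; apply: Cf_old; exact: (leaf_er At n0 pA ll).
case: (O_cases At n0 pA dO) => [ld|ld|[l ll [g E]]].
- by exists d; [exact: (pi_leaf ip)|constructor 1].
- have [l ll E] := nx_surj ld; exists l; first exact: (pi_leaf ip).
  have dE : d = e (nx l) by rewrite E erevK.
  case: (boolP (gap l)) => g.
    by constructor 2; rewrite fl // dE /next_stem g erevK.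
  constructor 3; rewrite fl // Cf_old; last by [].
  by rewrite dE /next_stem (negbTE g) erevK.
- by exists l; [exact: (pi_leaf ip)|constructor 2; rewrite fl // E].
Qed.

Section Rooted.
Variable i0 : 'I_4.
Local Notation o := (tn i0).
Local Notation outd := (outer_dart C o).
Local Notation inn := (inner_vertex C o).

Lemma iter_tn k i : iter k Cf (tn i) = tn (iter k (@ordS 4) i).
Proof. by elim: k => // k IH; rewrite !iterS IH Cf_tn. Qed.

Lemma C_outdP x : reflect (exists i, x = tn i) (outd x).
Proof.
apply: (iffP idP) => [/iter_findex <-|[i ->]].
  by rewrite iter_tn; exists (iter (findex Cf o x) (@ordS 4) i0).
suff -> : tn i = iter (i + 4 - i0) Cf o by exact: fconnect_iter.
rewrite iter_tn; congr (tn _); apply: val_inj; rewrite val_iter_ordS.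
have := ltn_ord i; have := ltn_ord i0 => h1 h2.
by rewrite addnBA ?addKn ?modnDr ?modn_small //; lia.
Qed.

Definition inner_old (x : outer_darts S) := if x is inl d then ~~ leaf p d else false.

Lemma innC_v x : inner_old (Cv x) = inner_old x.
Proof.
elim/outer_ind: x => [d|i|i] /=.
- case: (boolP (leaf p d)) => ld; last by rewrite Cv_old //= leaf_v ld.
  have [l ll <-] := nx_surj ld; case: (boolP (gap l)) => g; first by rewrite Cv_gap.
  by rewrite Cv_nongap //= ll.
- by have [l [ll g <-]] := gl_exists i; rewrite Cv_tn //= ll.
- by rewrite Cv_tp.
Qed.

Lemma tn_leaf l : leaf p l -> fconnect Cv (tn (lab l)) (old l).
Proof.
move=> ll; have [l1 [ll1 g1 _]] := gl_exists ord0.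
have [j E] := nx_trans At n0 pA ll ll1.
elim: j l ll E => [|j IH] l ll E.
  by rewrite -[l]E -(Cv_tn ll1 g1) fconnect1.
case: (boolP (gap l)) => g; first by rewrite -(Cv_tn ll g) fconnect1.
have lx : leaf p (nx l) := nx_leaf At n0 pA ll.
have := IH (nx l) lx; rewrite -iterSr => /(_ E); rewrite hl // (negbTE g) => c.
by apply: connect_trans c _; rewrite -(Cv_nongap ll g) fconnect1.
Qed.

Lemma C_inn x : inn x = inner_old x.
Proof.
have Csym := fconnect_sym (@perm_inj _ Cv).
apply: negb_inj; apply/innP/idP => [[y /C_outdP[i ->] c]|].
  have cc : closed (frel Cv) inner_old by move=> a b /eqP <-; rewrite -!topredE /= innC_v.
  by have := closed_connect cc c; rewrite -!topredE /= => <-.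
elim/outer_ind: x => [d|i|i] /= nx.
- exists (tn (lab d)); first by apply/C_outdP; exists (lab d).
  by apply: tn_leaf; rewrite negbK in nx.
- by exists (tn i); [apply/C_outdP; exists i|].
- by exists (tn i); [apply/C_outdP; exists i|rewrite Csym -Cv_tp fconnect1].
Qed.

Definition stem_ends : {set outer_darts S} := old @: L.

Lemma inIC x : (x \in stem_ends) = (if x is inl d then d \in L else false).
Proof.
apply/imsetP/idP => [[l lL ->] //|]; case: x => [d|[i b]] // dL; by exists d.
Qed.

(* Along non-leaf darts, the rotation of A is the rotation of C skipping L. *)
Lemma C_skip d : d \notin L -> skip Cv stem_ends (old d) (old (vrot A d)).
Proof.
move=> dL; have nd : ~~ leaf p d by apply: contraNN dL; exact: (pi_leaf ip).
have := pi_skip ip dL; move: nd {dL}; set y := vrot A d.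
move=> nd sk; elim: sk nd => {d y} [x|x y sL _ IH] nx.
  by rewrite -Cv_old //; exact: Skip1.
by apply: SkipS; rewrite Cv_old ?inIC //; apply: IH; rewrite leaf_v.
Qed.

(** Repeated skips go around the vertex, and everything between two successive darts of the tree is
    a stem end. *)
Lemma C_vertex d x : d \notin L -> (fconnect Cv (old d) x && (x \notin stem_ends)) =
  (x \in old @: cls (frel (vrot A)) d).
Proof.
move=> dL; apply/andP/imsetP => [[c xI]|[y]]; last first.
  rewrite mem_cls => c ->; have yL : y \notin L.
    have cL : closed (frel (vrot A)) (mem L) by move=> a b /eqP <-; rewrite leaves_v.
    by have := closed_connect cL c; rewrite !inE => <-; move: dL; rewrite inE.
  split; last by rewrite inIC.
  case/connectP: c => q; elim/last_ind: q y yL => [|q z IH] y yL /=; first by move=> _ ->; rewrite connect0.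
  rewrite rcons_path last_rcons => /andP[pq /eqP E] Ey; rewrite Ey -E in yL *.
  have zL : last d q \notin L by move: yL; rewrite leaves_v.
  by apply: connect_trans (IH _ zL pq erefl) _; apply: skip_fc (C_skip zL).
move: (iter_findex c); move: (findex _ _ _) => k; rewrite {c}.
have [N] := ubnP k; elim: N k d dL => // N IH k d dL kN E.
case: k kN E => [|k] kN E; first by exists d; rewrite ?cls_refl.
(* A skip makes at least one rotation and cannot jump over [x], which is not a stem end, so the
   number of rotations left decreases. *)
have [j [jk Ej]] : exists j, j <= k /\ iter (k - j) Cv (old (vrot A d)) = x.
  have := C_skip dL; move: E; rewrite iterSr => E; set s0 := old (vrot A d) => sk.
  have {}E : iter k.+1 Cv (old d) = x by rewrite iterSr.
  move: E kN {dL IH}; elim: sk k => {d s0} [z|z y zI sk IHs] k E kN.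
    by exists 0; rewrite subn0 -iterSr.
  case: k E kN => [|k] E kN; first by move: xI; rewrite -E /= zI.
  have [||j [jk Ej]] := IHs k; first by move: E; rewrite iterSr.
    exact: ltnW.
  by exists j.+1; rewrite subSS.
have vL : vrot A d \notin L by rewrite leaves_v.
have [|y yc ->] := IH (k - j) (vrot A d) vL _ Ej; first by lia.
exists y => //; move: yc; rewrite !mem_cls => c; exact: connect_trans (fconnect1 _ _) c.
Qed.

Lemma C_node x : inner_old x -> exists2 d, d \notin L & fconnect Cv (old d) x.
Proof.
case: x => // d /= nd; have [d' d'L c] := pi_node ip nd; exists d' => //.
have nd' : ~~ leaf p d' by apply: contraNN d'L; exact: (pi_leaf ip).
case/connectP: c => q; elim/last_ind: q d {nd} => [|q z IH] d /=; first by move=> _ ->; rewrite connect0.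
rewrite rcons_path last_rcons => /andP[pq /eqP <-] ->.
have c := IH _ pq erefl; apply: connect_trans c _.
have cl : closed (frel v) [pred x | ~~ leaf p x] by move=> a b /eqP <-; rewrite !inE leaf_v.
have : ~~ leaf p (last d' q).
  have cc : fconnect v d' (last d' q) by apply/connectP; exists q.
  by have := closed_connect cl cc; rewrite !inE nd' => <-.
by move=> nl; have := fconnect1 Cv (old (last d' q)); rewrite Cv_old.
Qed.

End Rooted.
End Attached.

Lemma fc_period3 (T : finType) (s : T -> T) x y : s (s (s x)) = x -> fconnect s x y ->
  [\/ y = x, y = s x | y = s (s x)].
Proof.
move=> s3 /connectP[q]; elim/last_ind: q y => [|q z IH] y /=; first by move=> _ ->; constructor 1.
rewrite rcons_path last_rcons => /andP[/IH/(_ erefl) H /eqP <-] ->.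
by case: H => ->; [constructor 2|constructor 3|rewrite s3; constructor 1].
Qed.

(** * The stem system of a closure, and its counts *)

Section Closed.
Variables (S : finType) (A : cmap S) (n : nat).
Hypothesis At : ternary_tree A n.
Hypothesis n0 : 0 < n.
Variable p : cmap S.
Hypothesis pA : partial_closure A p.
Variables (lab : S -> 'I_4) (C : cmap (outer_darts S)).
Hypothesis aC : attach_stems p lab C.
Variable i0 : 'I_4.
Local Notation L := (leaves A).
Local Notation e := (erev p).
Local Notation f := (face p).
Local Notation gap := (gap_after p).
Local Notation nx := (next_stem p).
Local Notation old := (@old_dart S).
Local Notation tn := (to_next S).
Local Notation Cv := (vrot C).
Local Notation Cf := (face C).
Local Notation o := (tn i0).
Local Notation outd := (outer_dart C o).
Local Notation inn := (inner_vertex C o).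
Local Notation stem_ends := (stem_ends A).
Let ip : pinv A p := stuck_pinv At n0 pA.
Let Ced : edges_ok C := C_edges At n0 pA aC.
Let Cfi : injective Cf := @face_inj _ C.
Let oP x : reflect (exists i, x = tn i) (outd x) := C_outdP At n0 pA aC i0 x.
Let inE' x : inn x = inner_old p x := C_inn At n0 pA aC i0 x.

Lemma nout_old d : ~~ outd (old d). Proof. by apply/oP => -[]. Qed.

Lemma C_in3 x : ~~ outd x -> exists l y z, [/\ l \in L, Cf (old l) = y, Cf y = z, Cf z = old l &
   [/\ forall d, y = old d -> d \notin L, forall d, z = old d -> d \notin L &
     x \in [:: old l; y; z]]].
Proof.
move=> nx; case: (C_cover At n0 pA aC x) => [xi|[l lL H]]; first by case/oP: nx.
have [y [z [E1 E2 E3 h1 h2]]] := C_triangle At n0 pA aC lL.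
exists l, y, z; split=> //; split=> //; rewrite !inE.
by rewrite E1 E2 in H; case: H => ->; rewrite eqxx ?orbT.
Qed.

Lemma Cf3 x : ~~ outd x -> Cf (Cf (Cf x)) = x.
Proof.
case/C_in3 => l [y [z [_ E1 E2 E3 [_ _]]]]; rewrite !inE => /or3P[]/eqP->.
- by rewrite E1 E2 E3.
- by rewrite E2 E3 E1.
- by rewrite E3 E1 E2.
Qed.

Lemma C_fne x : ~~ outd x -> Cf x != x.
Proof.
move=> nx; apply/eqP => fx; have [l [y [z [lL E1 E2 E3 [h1 _ xin]]]]] := C_in3 nx.
have xl : x = old l.
  by move: xin fx; rewrite !inE => /or3P[]/eqP-> // fx; move: E1 E2 E3; rewrite ?fx; congruence.
have yl : y = old l by rewrite -E1 -xl.
by have := h1 l yl; rewrite lL.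
Qed.

Lemma C_struct : stem_system C o stem_ends.
Proof.
split.
- by move=> x nx; rewrite Cf3 ?C_fne.
- move=> x nx; have [l [y [z [lL E1 E2 E3 [h1 h2 xin]]]]] := C_in3 nx.
  have -> : [set y0 in stem_ends | fconnect Cf x y0] = [set old l]; last by rewrite cards1.
  have sf : connect_sym (frel Cf) := fc_symf C.
  have lx : fconnect Cf (old l) x.
    by move: xin; rewrite !inE => /or3P[]/eqP->; rewrite -?E2 -?E1; [exact: connect0|exact: fconnect1|exact: (fconnect_iter Cf 2)].
  apply/setP => w; rewrite in_set in_set1 inIC; apply/andP/eqP => [[wL xw]|->]; last by rewrite sf.
  have := connect_trans lx xw; move/(@fc_period3 _ _ _ _ (Cf3 (nout_old l))); rewrite E1 E2.
  case=> // E; case: w wL E {xw} => [d|//] dL E; [have := h1 d|have := h2 d];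
    by rewrite -E dL => /(_ erefl).
- by move=> x /imsetP[l lL ->]; rewrite (Ce_old aC) !nout_old.
- move=> x; rewrite inE' => /(C_node At n0 pA aC)[d dL c].
  have -> : [set y | fconnect Cv x y & y \notin stem_ends] = old @: cls (frel (vrot A)) d.
    apply/setP => y; rewrite -(C_vertex At n0 pA aC _ dL) in_set; congr (_ && _).
    exact: (esym (same_connect (fconnect_sym (@perm_inj _ _)) c y)).
  rewrite card_imset; last exact: old_inj.
  by apply: (tree_deg At); rewrite inE in dL.
- move=> x; rewrite inE'; elim/outer_ind: x => [d|i|i] /=.
  + by rewrite negbK inIC => ld _ _; exact: (pi_leaf ip).
  + by move=> _ /oP[]; exists i.
  + by move=> _ _; rewrite (Ce_tp aC) => /oP[]; exists (ord_pred i).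
Qed.

(** Along a triangle, flippability carries membership in [Z] from a dart outside the system back to
    the preceding one. By [pi_min] this reaches the outer face of the partial closure, where one
    more step at most leads to an outer vertex, and [Z] has no dart there. *)
Lemma C_minimal : minimal C o stem_ends.
Proof.
move=> Z [Ze Zi Z1 Z2]; apply/eqP/contraT => Zn.
pose Zp := [set d | old d \in Z].
have inZp d : (d \in Zp) = (old d \in Z) by rewrite in_set.
have Zpe : eclosed A Zp by move=> d; rewrite !inZp -(stuck_e At n0 pA) -(Ce_old aC) Ze.
have back y : Cf y \notin stem_ends -> Cf y \in Z -> y \in Z by move=> h1 h2; rewrite -Ze; exact: (Z1 _ h1 h2).
have [] := pi_min ip Zpe.
- move=> l gl; have [f3 n1 n2] := pi_tri ip gl; have ts := triangle_not_stem At n0 pA gl.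
  have Cf1 : Cf (old l) = old (f l) by apply: (Cf_old aC); apply: ts; rewrite inE eqxx.
  have Cf2 : Cf (old (f l)) = old (f (f l)) by apply: (Cf_old aC); apply: ts; rewrite !inE eqxx orbT.
  by rewrite !inZp; split=> [|] h; apply: back; rewrite ?Cf1 ?Cf2 ?inIC.
- have /set0Pn[[z|z] zZ] := Zn; first by apply/set0Pn; exists z; rewrite inZp.
  by have := Zi _ zZ; rewrite inE'.
move=> x; rewrite inZp => xZ xO.
case: (O_cases At n0 pA xO) => [ld|ld|[l ll [g E]]].
- by have := Zi _ xZ; rewrite inE' /= ld.
- by have := Zi (old (e x)); rewrite -(Ce_old aC) Ze => /(_ xZ); rewrite inE' (Ce_old aC) /= ld.
have nfl := leaf_face_leaf At n0 pA ll.
have xL : x \notin L.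
  by apply: contraNN nfl; rewrite -E; exact: (OL xO).
have fl : Cf (old l) = old x by rewrite E; apply: (Cf_old aC); exact: (leaf_er At n0 pA ll).
have : old l \in Z by apply: back; rewrite fl ?inIC.
by move/Zi; rewrite inE' /= ll.
Qed.

Lemma C_conn : connected_map C.
Proof.
apply/connected_mapP; have cs := crel_sym Ced.
have oldc a b : connect (crel C) (old a) (old b).
  have := conn_map (pi_conn ip) a b; case/connectP => q.
  elim/last_ind: q b => [|q z IH] b /=; first by move=> _ ->; exact: connect0.
  rewrite rcons_path last_rcons => /andP[/IH/(_ erefl) c H ->].
  apply: connect_trans c _; case/orP: H => /eqP->; last by rewrite -(Ce_old aC); exact: crel_e.
  case: (boolP (leaf p (last a q))) => [/eqP-> //|nl].
  by rewrite -(Cv_old aC) //; exact: crel_v.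
have [l0 ll0] := exists_leaf At n0 pA.
have tnc i : connect (crel C) (old l0) (tn i).
  have [l [ll g E]] := gl_exists At n0 pA aC i; apply: connect_trans (oldc _ l) _.
  by rewrite cs -(Cv_tn aC ll g) E; exact: crel_v.
have all x : connect (crel C) (old l0) x.
  elim/outer_ind: x => [d|i|i]; [exact: oldc|exact: tnc|].
  by rewrite -[i]ord_predK -(Ce_tn aC); apply: connect_trans (tnc _) _; exact: crel_e.
by move=> a b; apply: connect_trans (all b); rewrite cs.
Qed.

Definition inner_darts := [set x | inner_old p x].

Lemma Yc_v x : (Cv x \in inner_darts) = (x \in inner_darts).
Proof. by rewrite !in_set (innC_v At n0 pA aC). Qed.

Definition olab (x : outer_darts S) := match x with inl d => lab d | inr (i, _) => i end.

Lemma olab_v x : ~~ inner_old p x -> olab (Cv x) = olab x.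
Proof.
elim/outer_ind: x => [d|i|i] /=.
- rewrite negbK => ld; have [l ll <-] := nx_surj At n0 pA ld; case: (boolP (gap l)) => g.
    by rewrite (Cv_gap aC).
  by rewrite (Cv_nongap aC) //= (attach_labelling aC) // (negbTE g).
- by have [l [ll g <-]] := gl_exists At n0 pA aC i; rewrite (Cv_tn aC).
- by rewrite (Cv_tp aC).
Qed.

Lemma nvert_outer : nvert C (~: inner_darts) = 4.
Proof.
have cs := fconnect_sym (@perm_inj _ Cv).
have tnN i : tn i \notin inner_darts by rewrite in_set.
rewrite /nvert; have -> : cls (frel Cv) @: (~: inner_darts) = (fun i => cls (frel Cv) (tn i)) @: [set: 'I_4].
  apply/setP => c; apply/imsetP/imsetP => [[x xY ->]|[i _ ->]]; last by exists (tn i); rewrite ?in_setC ?tnN.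
  exists (olab x) => //; apply/eqP; rewrite (eq_cls _ _ cs) cs.
  move: xY; rewrite in_setC in_set; elim/outer_ind: x => [d|i|i] /=.
  - by rewrite negbK; exact: (tn_leaf At n0 pA aC).
  - by rewrite connect0.
  - by rewrite cs -(Cv_tp aC) fconnect1.
rewrite card_imset ?cardsT ?card_ord // => i j /eqP; rewrite (eq_cls _ _ cs) => c.
have cl : closed (frel Cv) [pred x | ~~ inner_old p x && (olab x == i)].
  move=> a b /eqP <-; rewrite !inE (innC_v At n0 pA aC); case: (boolP (inner_old p a)) => //= na.
  by rewrite olab_v.
by have := closed_connect cl c; rewrite !inE /= eqxx => /esym/eqP.
Qed.

Lemma nvert_inner : nvert C inner_darts = n.
Proof.
have := card_closed (~: stem_ends) (@perm_inj _ Cv) Yc_v.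
have -> : ~: stem_ends :&: inner_darts = old @: (~: L).
  apply/setP => x; rewrite in_setI in_setC inIC in_set; apply/idP/imsetP.
    by case: x => //= d /andP[dL _]; exists d; rewrite ?in_setC.
  case=> d; rewrite in_setC => dL ->; rewrite dL /=.
  by apply: contraNN dL; exact: (pi_leaf ip).
rewrite card_imset; last exact: old_inj.
rewrite -(nvert_nodes (tree_deg At)) (tree_nodes At).
rewrite (eq_bigr (fun=> 4)); last first.
  move=> c /imsetP[x xY ->]; have := st_inn C_struct (x := x); rewrite inE' -in_set xY => /(_ isT) <-.
  by apply: eq_card => y; rewrite !in_set andbC.
by rewrite sum_nat_const mulnC => /eqP; rewrite eqn_mul2r => /eqP.
Qed.

Lemma card_C : #|outer_darts S| = 6 * n + 10.
Proof.
rewrite card_sum card_prod card_ord card_bool; have [_ ->] := tree_counts At; lia.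
Qed.

Lemma C_order_out x : outd x -> #|cls (frel Cf) x| = 4.
Proof.
case/oP => i ->; have -> : cls (frel Cf) (tn i) = tn @: [set: 'I_4].
  apply/setP => y; rewrite in_set; apply/idP/imsetP => [c|[j _ ->]].
    by have /(C_outdP At n0 pA aC)[j ->] : outer_dart C (tn i) y := c; exists j.
  by apply/(C_outdP At n0 pA aC); exists j.
by rewrite card_imset ?cardsT ?card_ord // => a b [].
Qed.

Lemma C_order_in x : ~~ outd x -> #|cls (frel Cf) x| = 3.
Proof.
move=> nx; have x3 := Cf3 nx; have n1 := C_fne nx.
have -> : cls (frel Cf) x = [set x; Cf x; Cf (Cf x)].
  apply/setP => y; rewrite in_set !in_setU !in_set1; apply/idP/idP.
    by case/(fc_period3 x3) => ->; rewrite eqxx ?orbT.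
  by rewrite -orbA => /or3P[]/eqP->; [exact: connect0|exact: fconnect1|exact: (fconnect_iter Cf 2)].
rewrite setUC cardsU1 cardsU1 cards1 !in_setU !in_set1 (inj_eq Cfi) (negbTE n1).
rewrite orbF; have -> : (Cf (Cf x) == x) = false.
  by apply/eqP => E; have := n1; rewrite -{2}x3 E eqxx.
by rewrite eq_sym (negbTE n1).
Qed.

Lemma C_faces : ncl (frel Cf) = 2 * n + 3.
Proof.
have cs : connect_sym (frel Cf) := fc_symf C.
have := sum_card_cls [set: outer_darts S] cs; rewrite cardsT card_C.
rewrite (bigD1 (cls (frel Cf) o)) /=; last by apply: imset_f; rewrite in_setT.
rewrite setTI C_order_out; last by apply/oP; exists i0.
rewrite (eq_bigr (fun=> 3)); last first.
  move=> c /andP[/imsetP[x _ ->]]; rewrite setTI (eq_cls _ _ cs) cs => nx; exact: C_order_in.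
rewrite sum_nat_const /ncl.
have -> : #|cls (frel Cf) @: [set: outer_darts S]| =
  (#|[pred c | (c \in cls (frel Cf) @: [set: outer_darts S]) && (c != cls (frel Cf) o)]|).+1.
  rewrite (cardD1 (cls (frel Cf) o)) imset_f ?in_setT // add1n; congr _.+1.
  by apply: eq_card => c; rewrite !inE andbC.
move: #|_| => k; lia.
Qed.

(** Euler's formula is checked on the counts: n + 4 vertices, 2n + 3 faces and 6n + 10 darts. *)
Lemma C_planar : planar_map C.
Proof.
apply/and3P; split; [exact: Ced|exact: C_conn|].
rewrite !fcard_ncl; try exact: perm_inj; try exact: Cfi.
have := ncl_erev Ced; rewrite card_C C_faces -(nvertC Yc_v) nvert_outer nvert_inner.
move: (ncl _) => k; lia.
Qed.

Lemma C_inner_vertices : inner_vertices C o = n.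
Proof.
rewrite /inner_vertices -nvert_inner /nvert card_cls_imset //.
- apply: eq_n_comp_r => x; rewrite in_set; exact: inE'.
- exact: fconnect_sym (@perm_inj _ Cv).
- by move=> a b /eqP <-; rewrite [RHS]Yc_v.
Qed.

Lemma C_faces_order : fingraph.order Cf o == 4 /\
  [forall d, ~~ outd d ==> (fingraph.order Cf d == 3)].
Proof.
have oc x : fingraph.order Cf x = #|cls (frel Cf) x| by apply: eq_card => y; rewrite !inE.
split; first by rewrite oc C_order_out //; apply/oP; exists i0.
by apply/forallP => x; apply/implyP => nx; rewrite oc C_order_in.
Qed.

End Closed.

(** * Euler's inequality for a region with connected boundary *)

Section RegionEdges.
Variables (D : finType) (m : cmap D).
Local Notation v := (vrot m).
Local Notation e := (erev m).
Local Notation f := (face m).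
Hypothesis mp : planar_map m.
Let me : edges_ok m. Proof. by case/and3P: mp. Qed.
Let mc : connected_map m. Proof. by case/and3P: mp. Qed.

Lemma nfacesC (r : {set D}) : (forall x, (f x \in r) = (x \in r)) ->
  #|cls (frel f) @: r| + #|cls (frel f) @: (~: r)| = ncl (frel f).
Proof.
move=> fr; have sf : connect_sym (frel f) := fc_symf m.
have cr : closed (frel f) (mem r) by move=> x y /eqP <-; rewrite [RHS]fr.
rewrite !card_cls_imset //; first last.
  by move=> x y /eqP <-; rewrite !inE fr.
rewrite -ncl_n_comp // (n_compC (mem r)); congr (_ + _); apply: eq_n_comp_r => x.
by rewrite !inE.
Qed.

Lemma bd_nonempty (r : {set D}) x0 y0 : (forall x, (f x \in r) = (x \in r)) ->
  x0 \in r -> y0 \notin r -> bd m r != set0.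
Proof.
move=> fr x0r; apply: contraNneq => b0; have := conn_map mc x0 y0; case/connectP => q.
have er x : x \in r -> e x \in r.
  move=> xr; apply/contraT => nx; have : x \in bd m r by rewrite in_set xr.
  by rewrite b0 in_set0.
elim/last_ind: q y0 => [|q z IH] y /=; first by move=> _ ->.
rewrite rcons_path last_rcons => /andP[/IH/(_ erefl) h H ->]; case/orP: H => /eqP->; last exact: er.
by rewrite (vrot_face me) fr er.
Qed.

Variable r : {set D}.
Hypothesis fr : forall x, (f x \in r) = (x \in r).
Local Notation G := (Gof m r).
Local Notation H := (~: G).

(* The darts whose origin is in the interior of the region r. *)
Definition inside := [set x | cls (frel v) x \subset G].

Lemma inGof x : (x \in G) = (x \in r) && (e x \in r). Proof. by rewrite in_set. Qed.

Let Gc : eclosed m G. Proof. exact: Gof_closed. Qed.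
Let Hc : eclosed m H. Proof. exact: eclosedC. Qed.

Lemma inside_v x : (v x \in inside) = (x \in inside).
Proof.
have sv := fconnect_sym (@perm_inj _ v).
rewrite !in_set; have -> // : cls (frel v) (v x) = cls (frel v) x.
by apply/eqP; rewrite (eq_cls _ _ sv) sv fconnect1.
Qed.

Lemma rotate_bd z h : z \in G -> h \notin G -> fconnect v z h -> exists2 b, b \in bd m r & fconnect v z b.
Proof.
move=> zG hG /connectP[q]; elim: q z zG => [|y q IH] z zG /=.
  by move=> _ E; move: hG; rewrite E zG.
case/andP => /eqP E pq hE; have vr : y \in r.
  by rewrite -E (vrot_face me) fr; move: zG; rewrite inGof => /andP[].
case: (boolP (y \in G)) => [yG|]; last first.
  by rewrite inGof vr /= => ey; exists y; rewrite ?in_set ?vr // -E fconnect1.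
have [b bb c] := IH y yG pq hE; exists b => //; apply: connect_trans c.
by rewrite -E fconnect1.
Qed.

Variables (z0 b0 : D).
Hypothesis z0r : z0 \in r.
Hypothesis b0b : b0 \in bd m r.
Hypothesis bc : forall x, x \in bd m r -> connect (verR m H) x b0.

(** Turning around a vertex from an interior edge of [r] to another edge meets a boundary dart. So a
    path to [b0] either reaches the boundary, which is connected, or stays off the interior
    edges. *)
Lemma outside_connected y : y \notin inside -> connect (verR m H) y b0.
Proof.
have sH : connect_sym (verR m H) := verR_sym me Hc.
rewrite in_set => /subsetPn[h]; rewrite mem_cls => yh hG.
apply: connect_trans (verR_vrot H yh) _; move: hG {yh y} => hG; apply/contraT => nc.
have nob b : b \in bd m r -> ~~ connect (verR m H) h b.
  by move=> bb; apply: contraNN nc => c; exact: connect_trans c (bc bb).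
have [] : connect (verR m H) h b0 /\ b0 \notin G; last by rewrite (negbTE nc).
case/connectP: (conn_map mc h b0) => q.
elim/last_ind: q {nc} b0 => [|q z IH] y /=; first by move=> _ ->; split.
rewrite rcons_path last_rcons => /andP[/IH/(_ erefl)[c wG] K ->]; case/orP: K => /eqP->.
  split; first by apply: connect_trans c _; exact/connect1/verR_v.
  apply/negP => vG; have [|b bb cb] := rotate_bd vG wG.
    by rewrite fconnect_sym ?fconnect1 //; exact: perm_inj.
  case/negP: (nob _ bb); apply: connect_trans c _; apply: verR_vrot.
  by apply: connect_trans cb; exact: fconnect1.
split; last by rewrite Gc.
by apply: connect_trans c _; apply/connect1/verR_e; rewrite in_setC.
Qed.

(** [RC_le] for the edges not interior to [r]: the faces off [r] remain separate regions and [r]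
    adds at least one, while the vertices inside [r] are isolated and all the others lie in one
    component. *)
Lemma region_edges : #|G|./2 + 1 <= #|cls (frel f) @: r| + nvert m inside.
Proof.
have sH : connect_sym (verR m H) := verR_sym me Hc.
have sR : connect_sym (regR m H) := regR_sym me Hc.
have cR : closed (regR m H) (mem (~: r)).
  move=> a b /orP[/eqP->|/andP[/eqP->]]; rewrite !in_setC ?fr // negbK inGof => /andP[-> ->] //.
have h1 : #|cls (frel f) @: (~: r)| < ncl (regR m H).
  apply: leq_ltn_trans (ncl_ltn_sub sR cR (x := z0) _); last by rewrite in_setC z0r.
  rewrite -card_cls_imset //; apply: eq_leq; congr #|pred_of_set _|.
  apply: eq_in_imset => x; rewrite in_setC => xr; apply/setP => y; rewrite !mem_cls.
  apply/idP/idP; first exact: regR_face.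
  case/connectP => q; elim/last_ind: q y => [|q z IH] y /=; first by move=> _ ->.
  rewrite rcons_path last_rcons => /andP[/IH/(_ erefl) zc] K ->; case/orP: K => [/eqP->|/andP[_ zG]].
    by apply: connect_trans zc _; exact: fconnect1.
  have cr : closed (frel f) (mem r) by move=> a b /eqP <-; rewrite [RHS]fr.
  by move: zG; rewrite in_setC negbK inGof -[_ \in r](closed_connect cr zc) (negbTE xr).
have h2 : ncl (verR m H) <= (nvert m inside).+1.
  rewrite -add1n -(cards1 (cls (verR m H) b0)); apply: leq_trans (leq_card_setU _ _).
  apply: subset_leq_card; apply/subsetP => c /imsetP[x _ ->]; rewrite in_setU in_set1.
  case: (boolP (x \in inside)) => xi; last by rewrite (eq_cls _ _ sH) outside_connected.
  apply/orP; right; apply/imsetP; exists x => //; apply/setP => y; rewrite !mem_cls.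
  apply/idP/idP; last exact: verR_vrot.
  case/connectP => q; elim/last_ind: q y => [|q z IH] y /=; first by move=> _ ->.
  rewrite rcons_path last_rcons => /andP[/IH/(_ erefl) zc] K ->; case/orP: K => [/eqP->|/andP[_ zH]].
    by apply: connect_trans zc _; exact: fconnect1.
  have /subsetP xG : cls (frel v) x \subset G by move: xi; rewrite in_set.
  by move: zH; rewrite in_setC xG // mem_cls.
have := RC_le me mc z0 Hc; have := euler me mp; rewrite -(nfacesC fr).
have := cardsC G; rewrite (card_eclosed me Gc) (card_eclosed me Hc) !doubleK.
rewrite -(ncl_erev me) doubleK; lia.
Qed.

Lemma card_region : #|r| = #|G| + #|bd m r|.
Proof.
rewrite -(cardsID G r); congr (_ + _); apply: eq_card => x; rewrite !in_set.
  by case: (x \in r).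
by case: (x \in r); rewrite ?andbT ?andbF.
Qed.

End RegionEdges.

(** A tree has one face, so cutting along a subgraph leaves one region, and [RC_ge] then bounds its
    edges as in a forest. *)
Lemma tree_forest (S : finType) (A : cmap S) n (X : {set S}) x0 : ternary_tree A n ->
  (forall x, (vrot A x \in X) = (x \in X)) -> x0 \in X -> #|Gof A X| + 2 <= 2 * nvert A X.
Proof.
move=> At vX x0X; have Ae := tree_edges At; have Ac := tree_conn At; have Ap := tree_planar At.
have Gc : eclosed A (Gof A X) by exact: Gof_closed.
have := RC_ge Ae Ac Ap x0 Gc; have := ncl_verR_ge Ae vX Gc (subxx _) x0X.
have : ncl (regR A (Gof A X)) <= 1.
  have /eqP/cards1P[c0 E] := tree_face At.
  have all x y : fconnect (face A) x y.
    rewrite -(eq_cls _ _ (fc_symf A)); have H z : cls (frel (face A)) z \in [set c0] by rewrite -E imset_f ?in_setT.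
    by have := H x; have := H y; rewrite !in_set1 => /eqP-> /eqP->.
  rewrite -(cards1 (cls (regR A (Gof A X)) x0)); apply: subset_leq_card.
  apply/subsetP => c /imsetP[x _ ->]; rewrite in_set1 (eq_cls _ _ (regR_sym Ae Gc)).
  exact: regR_face.
rewrite (card_eclosed Ae Gc) doubleK; lia.
Qed.

(** * Irreducibility of closures *)

Section Irr.
Variables (S : finType) (A : cmap S) (n : nat).
Hypothesis At : ternary_tree A n.
Hypothesis n0 : 0 < n.
Variable p : cmap S.
Hypothesis pA : partial_closure A p.
Variables (lab : S -> 'I_4) (C : cmap (outer_darts S)).
Hypothesis aC : attach_stems p lab C.
Variable i0 : 'I_4.
Local Notation L := (leaves A).
Local Notation old := (@old_dart S).
Local Notation tn := (to_next S).
Local Notation Ce := (erev C).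
Local Notation Cv := (vrot C).
Local Notation Cf := (face C).
Local Notation o := (tn i0).
Local Notation outd := (outer_dart C o).
Local Notation inn := (inner_vertex C o).
Local Notation stem_ends := (stem_ends A).
Let Ced : edges_ok C := C_edges At n0 pA aC.
Let Cp : planar_map C := C_planar At n0 pA aC i0.
Let Cc : connected_map C := C_conn At n0 pA aC.
Let Cst : stem_system C o stem_ends := C_struct At n0 pA aC i0.
Let inE' x : inn x = inner_old p x := C_inn At n0 pA aC i0 x.
Let cs := fconnect_sym (@perm_inj _ Cv).

Section Region.
Variables (r : {set outer_darts S}) (z0 : outer_darts S).
Hypothesis fr : forall x, (Cf x \in r) = (x \in r).
Hypothesis z0r : z0 \in r.
Hypothesis nor : forall x, outd x -> x \notin r.
Hypothesis b3 : #|bd C r| <= 3.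
Hypothesis bc : forall x y, x \in bd C r -> y \in bd C r -> connect (verR C (~: Gof C r)) x y.
Local Notation G := (Gof C r).
Local Notation K := (inside C r).
Local Notation k := (nvert C K).

Lemma K_G x : x \in K -> x \in G.
Proof. by rewrite in_set => /subsetP; apply; exact: cls_refl. Qed.

Lemma K_inn x : x \in K -> inn x.
Proof.
move=> xK; apply/contraT => /innP[y oy c].
have yK : y \in K by rewrite (vclosed (inside_v C r) c).
by have := K_G yK; rewrite inGof (negbTE (nor oy)).
Qed.

Lemma K_out : #|K :\: stem_ends| = 4 * k.
Proof.
rewrite setDE setIC (card_closed _ (@perm_inj _ Cv) (inside_v C r)) (eq_bigr (fun=> 4)).
  by rewrite sum_nat_const mulnC.
move=> c /imsetP[x xK ->]; rewrite -(st_inn Cst (K_inn xK)).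
by apply: eq_card => y; rewrite !in_set andbC.
Qed.

Lemma K_old x : x \in K -> x \notin stem_ends -> exists2 d, d \notin L & x = old d.
Proof.
move=> /K_inn; rewrite inE' inIC; case: x => // d _ dL; by exists d.
Qed.

Lemma K_forest x1 : x1 \in K ->
  #|[set x | [&& x \in K, Ce x \in K, x \notin stem_ends & Ce x \notin stem_ends]]| + 2 <= 2 * k.
Proof.
move=> x1K; pose X := [set d | (d \notin L) && (old d \in K)].
have vK x y : fconnect Cv x y -> (x \in K) = (y \in K) := vclosed (inside_v C r).
have inX d : (d \in X) = (d \notin L) && (old d \in K) by rewrite [LHS]in_set.
have vX d : (vrot A d \in X) = (d \in X).
  rewrite !inX leaves_v; case: (boolP (d \in L)) => //= dL.
  by apply/esym/vK/skip_fc; exact: (C_skip At n0 pA aC).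
have cX : #|X| = 4 * k.
  rewrite -K_out -(card_imset _ (@old_inj S)); apply: eq_card => x; rewrite in_setD.
  apply/imsetP/andP => [[d]|[xI xK]].
    by rewrite inX => /andP[dL dK] ->; rewrite inIC dK.
  by have [d dL E] := K_old xK xI; exists d; rewrite ?inX ?dL -?E.
have nX : nvert A X = k.
  have H := card_closed setT (@perm_inj _ (vrot A)) vX.
  move: H; rewrite setTI cX (eq_bigr (fun=> 4)).
    by rewrite sum_nat_const mulnC => /eqP; rewrite eqn_mul2r => /eqP.
  move=> c /imsetP[d]; rewrite inX => /andP[dL _] ->; rewrite setTI.
  by apply: (tree_deg At); rewrite in_set in dL.
have [d1 d1X] : exists d, d \in X.
  have [d dL c] := C_node At n0 pA aC (etrans (esym (inE' x1)) (K_inn x1K)).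
  by exists d; rewrite inX dL (vK _ _ c).
have := tree_forest At vX d1X; rewrite nX; apply: leq_trans; rewrite leq_add2r.
rewrite -(card_imset _ (@old_inj S)); apply: subset_leq_card; apply/subsetP => x.
rewrite in_set => /and4P[xK exK xI exI]; have [d dL E] := K_old xK xI.
apply/imsetP; exists d => //; move: exK exI; rewrite E (Ce_old aC) inIC (stuck_e At n0 pA) => exK exI.
by rewrite in_set !inX dL exI exK -E xK.
Qed.

(** Suppose k >= 1 vertices are inside. With a boundary of length at most 3, Euler's inequality
    allows at most 3k interior edges. But the k nodes have 4k darts outside [stem_ends], all on
    interior edges, and by [tree_forest] at most k - 1 edges carry two of them, which makes at least
    3k + 1. For k = 0, Euler's inequality leaves a single triangle. *)
Lemma region_small : r = bd C r /\ #|bd C r| = 3.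
Proof.
have out : o \notin r by apply: nor; exact: connect0.
have /set0Pn[b0 b0b] := bd_nonempty Cp fr z0r out.
have E1 := region_edges Cp fr z0r b0b (fun x xb => bc xb b0b).
have cr := card_region C r.
have Gc : eclosed C G := Gof_closed Ced r.
have evG : #|G| = (#|G|./2).*2 by rewrite (card_eclosed Ced Gc) doubleK.
have f3 : #|r| = 3 * #|cls (frel Cf) @: r|.
  rewrite -[r in LHS]setTI (card_closed _ (@face_inj _ C) fr) (eq_bigr (fun=> 3)).
    by rewrite sum_nat_const mulnC.
  move=> c /imsetP[x xr ->]; rewrite setTI.
  have nx : ~~ outd x by apply: contraL xr => /nor.
  exact: (C_order_in At n0 pA aC nx).
have inG x : (x \in G) = (x \in r) && (Ce x \in r) := inGof C r x.
case: (set_0Vmem K) => [K0|[x1 x1K]].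
  have k0 : k = 0 by rewrite /nvert K0 imset0 cards0.
  rewrite k0 in E1; have G0 : #|G| = 0 by lia.
  split; last by lia.
  apply/eqP; rewrite eq_sym eqEcard; apply/andP; split; last by lia.
  by apply/subsetP => x; rewrite in_set => /andP[].
pose Ain := G :&: stem_ends; pose Aout := [set x in G | Ce x \in stem_ends].
pose B2 := [set x in G | (x \notin stem_ends) && (Ce x \notin stem_ends)].
pose B2K := [set x | [&& x \in K, Ce x \in K, x \notin stem_ends & Ce x \notin stem_ends]].
pose Sx := (G :\: stem_ends) :\: K.
have IE x : x \in stem_ends -> Ce x \notin stem_ends.
  move=> /imsetP[l lL ->]; rewrite (Ce_old aC) inIC (stuck_e At n0 pA).
  exact: (leaf_e At n0).
have ei : injective Ce := @perm_inj _ Ce.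
have cA : #|Aout| = #|Ain|.
  rewrite -(card_imset _ ei); apply: eq_card => x; rewrite in_setI; apply/imsetP/andP.
    by case=> y; rewrite in_set => /andP[yG yI] ->; rewrite Gc.
  by case=> xG xI; exists (Ce x); rewrite ?(erevK Ced) // in_set Gc xG (erevK Ced).
have inU x : (x \in [set x | Ce x \in stem_ends]) = (Ce x \in stem_ends) by rewrite [LHS]in_set.
have inAout x : (x \in Aout) = (x \in G) && (Ce x \in stem_ends) by rewrite [LHS]in_set.
have inB2 x : (x \in B2) = [&& x \in G, x \notin stem_ends & Ce x \notin stem_ends] by rewrite [LHS]in_set.
have c1 : #|G :\: stem_ends| = #|Aout| + #|B2|.
  rewrite -(cardsID [set x | Ce x \in stem_ends]); congr (_ + _); apply: eq_card => x.
    rewrite !(in_setI, in_setD) inU inAout; case: (boolP (Ce x \in stem_ends)); rewrite ?andbF // => /IE.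
    by rewrite (erevK Ced) => ->; rewrite !andbT.
  by rewrite !in_setD inU inB2; case: (x \in stem_ends); case: (x \in G); rewrite ?andbF ?andbT.
have c2 : #|G| = #|Ain| + #|G :\: stem_ends| by rewrite cardsID.
have c3 : #|G :\: stem_ends| = 4 * k + #|Sx|.
  rewrite -K_out -(cardsID K); congr (_ + _); apply: eq_card => x.
  rewrite !(in_setI, in_setD); case: (boolP (x \in K)) => xK; rewrite ?andbF ?andbT //.
  by rewrite (K_G xK) andbT.
have c4 : #|B2| <= #|B2K| + (#|Sx| + #|Sx|).
  have -> : #|Sx| + #|Sx| = #|Sx| + #|Ce @: Sx| by rewrite (card_imset _ ei).
  apply: leq_trans (_ : #|B2K :|: (Sx :|: Ce @: Sx)| <= _); last first.
    by apply: leq_trans (leq_card_setU _ _) _; rewrite leq_add2l; exact: leq_card_setU.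
  apply: subset_leq_card; apply/subsetP => x; rewrite in_set => /and3P[xG xI exI].
  rewrite !in_setU; case: (boolP (x \in K)) => xK; last first.
    by apply/orP; right; apply/orP; left; rewrite !in_setD xK xI xG.
  case: (boolP (Ce x \in K)) => exK; first by rewrite in_set xK exK xI exI.
  apply/orP; right; apply/orP; right; apply/imsetP; exists (Ce x); rewrite ?(erevK Ced) //.
  by rewrite !in_setD exK exI Gc xG.
have c5 := K_forest x1K; rewrite -/B2K in c5.
move: E1 cr evG f3 cA c1 c2 c3 c4 c5 b3.
move: #|G| #|r| #|bd C r| #|Ain| #|Aout| #|B2| #|B2K| #|Sx| (nvert _ _) #|_ @: r| #|G :\: stem_ends|.
clear; lia.
Qed.
End Region.

Lemma region_class (H : {set outer_darts S}) : eclosed C H -> 1 < ncl (regR C H) ->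
  exists z, ~~ connect (regR C H) z o.
Proof.
move=> Hc; have sR := regR_sym Ced Hc.
case: (boolP [exists z, ~~ connect (regR C H) z o]) => [/existsP //|/existsPn h].
rewrite ltnNge => /negP[]; rewrite -(cards1 (cls (regR C H) o)); apply: subset_leq_card; apply/subsetP => c /imsetP[x _ ->].
rewrite in_set1 (eq_cls _ _ sR); by have := h x; rewrite negbK.
Qed.

Lemma class_region (H : {set outer_darts S}) z : eclosed C H -> ~~ connect (regR C H) z o ->
  let r := cls (regR C H) z in
  [/\ forall x, (Cf x \in r) = (x \in r), z \in r, forall x, outd x -> x \notin r &
      forall x, x \in bd C r -> x \in H /\ Ce x \notin bd C r].
Proof.
move=> Hc nz r; have sR := regR_sym Ced Hc; split.
- by move=> x; rewrite cls_regR_f.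
- exact: cls_refl.
- move=> x ox; apply: contraNN nz; rewrite mem_cls => c; apply: connect_trans c _.
  by rewrite sR; apply: regR_face.
- move=> x; rewrite in_set => /andP[xr exr]; split; last by rewrite in_set (negbTE exr).
  apply: contraNT exr => xH; by rewrite (cls_regR_e Ced).
Qed.

Lemma bd_edge (r : {set outer_darts S}) x y : x \in bd C r -> fconnect Cv (Ce x) y ->
  connect (verR C (~: Gof C r)) x y.
Proof.
rewrite in_set => /andP[xr exr] c; apply: connect_trans (verR_vrot _ c).
by apply/connect1/verR_e; rewrite in_setC in_set xr.
Qed.

Lemma card_bd (H r : {set outer_darts S}) : eclosed C H ->
  (forall x, x \in bd C r -> x \in H /\ Ce x \notin bd C r) -> 2 * #|bd C r| <= #|H|.
Proof.
move=> Hc bH; have ei : injective Ce := @perm_inj _ Ce.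
rewrite mul2n -addnn -{2}(card_imset _ ei) -cardsUI.
have -> : bd C r :&: Ce @: bd C r = set0.
  apply/eqP/set0Pn => -[x]; rewrite in_setI => /andP[/bH[_ nx] /imsetP[y yb E]].
  by move: nx; rewrite E (erevK Ced) yb.
rewrite cards0 addn0; apply: subset_leq_card; apply/subsetP => x; rewrite in_setU.
by case/orP => [/bH[]//|/imsetP[y /bH[yH _] ->]]; rewrite Hc.
Qed.

(** At most two edges bound a region of length at most 2, too short for [region_small]. *)
Lemma small_cut (H : {set outer_darts S}) : eclosed C H -> #|H| <= 4 -> 1 < ncl (regR C H) ->
  (forall r x y, x \in H -> y \in H -> x \in bd C r -> y \in bd C r ->
     connect (verR C (~: Gof C r)) x y) -> False.
Proof.
move=> Hc H4 /(region_class Hc)[z nz] con.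
have [fr zr nor bH] := class_region Hc nz; set r := cls _ z in fr zr nor bH.
have b2 := leq_trans (card_bd Hc bH) H4.
have [|x y xb yb|_] := region_small fr zr nor; last by lia.
- by lia.
- by apply: con => //; [case: (bH _ xb)|case: (bH _ yb)].
Qed.

(** The form of Jordan's theorem used here: a subgraph with as many edges as vertices contains a
    cycle, and in genus 0 it separates the sphere. *)
Lemma cut_count (X H : {set outer_darts S}) x0 : (forall x, (Cv x \in X) = (x \in X)) ->
  eclosed C H -> H \subset Gof C X -> x0 \in X -> #|H|./2 = nvert C X -> 1 < ncl (regR C H).
Proof.
move=> vX Hc HX x0X cH; have := RC_ge Ced Cc Cp x0 Hc.
have := ncl_verR_ge Ced vX Hc HX x0X; rewrite cH; lia.
Qed.

Lemma C_noloop d : ~~ fconnect Cv d (Ce d).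
Proof.
apply/negP => c; pose H : {set outer_darts S} := [set d; Ce d].
have Hc : eclosed C H by move=> x; rewrite !in_set2 (inv_eq (erevK Ced)) orbC (inj_eq perm_inj).
have cH : #|H| = 2 by rewrite cards2 eq_sym erev_neq.
pose X := cls (frel Cv) d.
have vX x : (Cv x \in X) = (x \in X) by rewrite !mem_cls -(same_fconnect1_r (@perm_inj _ Cv)).
have HX : H \subset Gof C X.
  by apply/subsetP => x; rewrite in_set2 => /orP[]/eqP->; rewrite in_set !mem_cls ?(erevK Ced) c connect0.
have nX : nvert C X = 1.
  apply/eqP/cards1P; exists X; apply/setP => y; rewrite in_set1; apply/imsetP/eqP => [[x xX ->]|->].
    by apply/eqP; rewrite (eq_cls _ _ cs) cs -mem_cls.
  by exists d; rewrite ?cls_refl.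
apply: (@small_cut H) => //; first by rewrite cH.
  by apply: (cut_count vX Hc HX (cls_refl _ d)); rewrite cH nX.
move=> r x y; rewrite !in_set2 => /orP[]/eqP-> /orP[]/eqP-> // _ _; try exact: connect0.
  exact: verR_vrot.
by apply: verR_vrot; rewrite cs.
Qed.

Lemma C_nopar d d' : fconnect Cv d d' -> fconnect Cv (Ce d) (Ce d') -> d = d'.
Proof.
move=> c c'; apply/eqP/contraT => nd; exfalso.
have ed' : d' != Ce d by apply: contraNneq (C_noloop d) => <-.
have K := erevK Ced.
pose H : {set outer_darts S} := [set d; Ce d] :|: [set d'; Ce d'].
have Hc : eclosed C H.
  move=> x; rewrite !in_setU !in_set1 !(inv_eq K) !K.
  by rewrite (orbC (x == Ce d)) (orbC (x == Ce d')).
have cH : #|H| = 4.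
  rewrite cardsU !cards2 !(eq_sym _ (Ce _)) !(erev_neq Ced).
  have -> : [set d; Ce d] :&: [set d'; Ce d'] = set0; last by rewrite cards0.
  apply/eqP/set0Pn => -[x]; rewrite in_setI !in_set2 => /andP[/orP[]/eqP->].
    rewrite (negbTE nd) /= => /eqP E; by move: ed'; rewrite E K eqxx.
  by rewrite eq_sym (negbTE ed') (inj_eq perm_inj) (negbTE nd).
pose X := cls (frel Cv) d :|: cls (frel Cv) (Ce d).
have vX x : (Cv x \in X) = (x \in X) by rewrite !in_setU !mem_cls -!(same_fconnect1_r (@perm_inj _ Cv)).
have HX : H \subset Gof C X.
  apply/subsetP => x; rewrite !in_setU !in_set1 => /orP[]/orP[]/eqP->;
  by rewrite in_set !in_setU !mem_cls ?K ?c ?c' ?connect0 ?orbT.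
have dX : d \in X by rewrite in_setU cls_refl.
have nX : nvert C X = 2.
  have -> : 2 = #|[set cls (frel Cv) d; cls (frel Cv) (Ce d)]|.
    by rewrite cards2 (eq_cls _ _ cs) C_noloop.
  apply: eq_card => y; rewrite in_set2; apply/imsetP/orP.
    case=> x; rewrite in_setU !mem_cls => /orP[] cx ->; [left|right];
    by rewrite (eq_cls _ _ cs) cs.
  by case=> /eqP->; [exists d|exists (Ce d)]; rewrite // in_setU cls_refl ?orbT.
apply: (@small_cut H) => //; first by rewrite cH.
  by apply: (cut_count vX Hc HX dX); rewrite cH nX.
have c1 : fconnect Cv d' d by rewrite cs.
have c2 : fconnect Cv (Ce d') (Ce d) by rewrite cs.
have c3 : fconnect Cv (Ce (Ce d)) d' by rewrite K.
have c4 : fconnect Cv (Ce (Ce d')) d by rewrite K.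
have c5 : fconnect Cv (Ce d) (Ce d') by [].
have e0 x : fconnect Cv (Ce x) (Ce x) by exact: connect0.
have e1 x : fconnect Cv (Ce (Ce x)) x by rewrite K connect0.
move=> r x y; rewrite !in_setU !in_set1 => /orP[]/orP[]/eqP-> /orP[]/orP[]/eqP-> xb yb;
  by [exact: connect0|exact: verR_vrot|exact: bd_edge].
Qed.

Lemma C_simple : simple_map C.
Proof.
apply/andP; split; apply/forallP => d; first exact: C_noloop.
apply/forallP => d'; apply/implyP => /andP[c c']; apply/eqP; exact: C_nopar.
Qed.

(** One of the two vertices is cut off from the outer face. By [region_small] its region is a single
    triangular face bounded by the given darts, so it has no corner off the triangle. *)
Lemma C_nosep d1 d2 d3 : ~~ separating_triangle C d1 d2 d3.
Proof.
apply/negP => /andP[tr /existsP[x /existsP[y /and3P[ox oy nxy]]]].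
have K := erevK Ced.
pose T := [:: d1; d2; d3; Ce d1; Ce d2; Ce d3].
pose H := [set z in T].
have Hc : eclosed C H.
  move=> z; rewrite !inE !(inv_eq K) !K.
  by do 6! case: (z == _).
have sR := regR_sym Ced Hc.
have ss a b : connect (regR C H) a b -> same_side C d1 d2 d3 a b.
  apply: connect_sub => {}a {}b ab; apply: connect1; move: ab; rewrite /regR /= in_set.
  by [].
have [z [oz nz]] : exists z, off_triangle C d1 d2 d3 z /\ ~~ connect (regR C H) z o.
  case: (boolP (connect (regR C H) x o)) => cx; last by exists x.
  case: (boolP (connect (regR C H) y o)) => cy; last by exists y.
  by case/negP: nxy; apply: ss; apply: connect_trans cx _; rewrite sR.
have [fr zr nor bH] := class_region Hc nz; set r := cls _ z in fr zr nor bH.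
have H6 : #|H| <= 6 by rewrite cardsE; exact: card_size.
have b3 := leq_trans (card_bd Hc bH) H6.
have {}b3 : #|bd C r| <= 3 by move: b3; move: #|_| => k; clear; lia.
have on : o \notin r by apply: nor; exact: connect0.
have bn := bd_nonempty Cp fr zr on.
have [a [b [c [/and3P[ab bc ca] bE]]]] := bd_triangle Ced C_simple fr bn b3.
have [x' y'|rE _] := region_small fr zr nor b3.
  have [ba bb bc'] : [/\ a \in bd C r, b \in bd C r & c \in bd C r] by rewrite bE !inE !eqxx !orbT.
  have Cab := bd_edge ba ab; have Cbc := bd_edge bb bc; have Cca := bd_edge bc' ca.
  have Cac := connect_trans Cab Cbc; have Cba := connect_trans Cbc Cca.
  have Ccb := connect_trans Cca Cab.
  by rewrite bE !inE -!orbA => /or3P[]/eqP-> /or3P[]/eqP->.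
have : z \in H by have := zr; rewrite rE => /bH[].
case/and3P: oz => /negP z1 /negP z2 /negP z3; case/and3P: tr => t1 t2 t3.
rewrite in_set !inE => /or4P[/eqP E|/eqP E|/eqP E|/or3P[]/eqP E].
- by case: z1; rewrite E connect0.
- by case: z2; rewrite E connect0.
- by case: z3; rewrite E connect0.
- by case: z2; rewrite E cs.
- by case: z3; rewrite E cs.
- by case: z1; rewrite E cs.
Qed.

Lemma C_irreducible : irreducible_triangulation C o.
Proof.
have [h1 h2] := C_faces_order At n0 pA aC i0.
apply/and5P; split=> //; first exact: C_simple.
by do 3![apply/forallP => ?]; exact: C_nosep.
Qed.

End Irr.

(** * Isomorphisms and rooted classes *)

Definition map_isom (D D' : finType) (m : cmap D) (m' : cmap D') (f : D -> D') : Prop :=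
  [/\ bijective f, forall d, f (vrot m d) = vrot m' (f d) &
      forall d, f (erev m d) = erev m' (f d)].

Lemma map_isoP (D D' : finType) (m : cmap D) (m' : cmap D') :
  reflect (exists f, map_isom m m' f) (iso m m').
Proof.
apply: (iffP existsP) => [[f /is_isoP h]|[f [fB fv fe]]]; first by exists f.
exists [ffun x => f x]; apply/is_isoP; split=> [|d|d]; rewrite ?ffunE //.
by apply: (eq_bij fB) => x; rewrite ffunE.
Qed.

Lemma map_isom_comp (D1 D2 D3 : finType) (m1 : cmap D1) (m2 : cmap D2) (m3 : cmap D3) f g :
  map_isom m1 m2 f -> map_isom m2 m3 g -> map_isom m1 m3 (fun x => g (f x)).
Proof.
move=> [fB fv fe] [gB gv ge]; split=> [|d|d]; rewrite ?fv ?fe //; exact: bij_comp.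
Qed.

Lemma map_isom_inv (D D' : finType) (m : cmap D) (m' : cmap D') f : map_isom m m' f ->
  exists g, [/\ map_isom m' m g, cancel f g & cancel g f].
Proof.
move=> [[g fK gK] fv fe]; exists g; split=> //; split; first by exists f.
- by move=> d; apply: (can_inj fK); rewrite fv !gK.
- by move=> d; apply: (can_inj fK); rewrite fe !gK.
Qed.

(** Rigidity of connected maps, which makes rooted objects free of automorphisms and the final
    matching single-valued. *)
Lemma map_isom_eq (D D' : finType) (m : cmap D) (m' : cmap D') f g x : connected_map m ->
  map_isom m m' f -> map_isom m m' g -> f x = g x -> f =1 g.
Proof.
move=> mc [_ fv fe] [_ gv ge] E y; have := conn_map mc x y; case/connectP => q.
elim/last_ind: q y => [|q z IH] y /=; first by move=> _ ->.
by rewrite rcons_path last_rcons => /andP[/IH/(_ erefl) h /orP[]/eqP-> ->]; rewrite ?fv ?gv ?fe ?ge h.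
Qed.

Section Transport.
Variables (D D' : finType) (f : D -> D').
Hypothesis fB : bijective f.
Let fI : injective f := bij_inj fB.

Lemma forall_bij (P : D' -> Prop) : (forall x, P (f x)) -> forall x, P x.
Proof. by case: fB => g _ gK H x; rewrite -(gK x). Qed.

Lemma connect_bij (e : rel D) (e' : rel D') : (forall x y, e' (f x) (f y) = e x y) ->
  forall x y, connect e' (f x) (f y) = connect e x y.
Proof.
move=> H x y; apply/idP/idP; last first.
  case/connectP => q; elim: q x => [|z q IH] x /=; first by move=> _ ->; exact: connect0.
  by rewrite -H => /andP[xz /IH h /h]; apply: connect_trans; exact: connect1.
case/connectP => q; elim: q x => [|z q IH] x /=; first by move=> _ /fI ->; exact: connect0.
case: fB => g fK gK; rewrite -(gK z) H => /andP[xz /IH h /h]; apply: connect_trans; exact: connect1.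
Qed.

Section Fun.
Variables (s : D -> D) (s' : D' -> D').
Hypothesis fs : forall x, f (s x) = s' (f x).

Lemma fconnect_bij x y : fconnect s' (f x) (f y) = fconnect s x y.
Proof. by apply: connect_bij => {}x {}y; rewrite /= -fs (inj_eq fI). Qed.

Lemma cls_bij x : cls (frel s') (f x) = f @: cls (frel s) x.
Proof.
apply/setP; apply: forall_bij => y; rewrite mem_cls fconnect_bij.
by rewrite mem_imset // mem_cls.
Qed.

Lemma order_bij x : fingraph.order s' (f x) = fingraph.order s x.
Proof.
have oc (T : finType) (t : T -> T) z : fingraph.order t z = #|cls (frel t) z|.
  by apply: eq_card => y; rewrite !inE.
by rewrite !oc cls_bij card_imset.
Qed.

Lemma fcard_bij (a : {pred D}) (a' : {pred D'}) : injective s -> injective s' ->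
  closed (frel s) a -> (forall x, (f x \in a') = (x \in a)) -> fcard s' a' = fcard s a.
Proof.
move=> si si' ca fa; have ca' : closed (frel s') a'.
  apply: forall_bij => x; apply: forall_bij => y; rewrite /= -fs (inj_eq fI) !fa => E; exact: ca.
rewrite -(card_cls_imset (fconnect_sym si) ca) -(card_cls_imset (fconnect_sym si') ca').
rewrite -(card_imset _ (imset_inj fI)); apply: eq_card; move=> c.
apply/imsetP/imsetP => [[x xa ->]|[_ /imsetP[x xa ->] ->]].
  have [g fK gK] := fB; exists (cls (frel s) (g x)); last by rewrite -cls_bij gK.
  by apply/imsetP; exists (g x); rewrite // -fa gK.
by exists (f x); rewrite ?fa // cls_bij.
Qed.

End Fun.

Variables (m : cmap D) (m' : cmap D').
Hypothesis fv : forall d, f (vrot m d) = vrot m' (f d).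
Hypothesis fe : forall d, f (erev m d) = erev m' (f d).
Local Notation v := (vrot m).
Local Notation e := (erev m).
Local Notation v' := (vrot m').
Local Notation e' := (erev m').

Lemma face_bij d : f (face m d) = face m' (f d).
Proof. by rewrite /face fv fe. Qed.

Lemma leaf_bij d : leaf m' (f d) = leaf m d.
Proof. by rewrite /leaf -fv (inj_eq fI). Qed.

Lemma edges_bij : edges_ok m -> edges_ok m'.
Proof.
move/forallP => H; apply/forallP; apply: forall_bij => d; have := H d.
by rewrite -!fe !(inj_eq fI).
Qed.

Lemma planar_bij : planar_map m -> planar_map m'.
Proof.
case/and3P => me mc /eqP E; apply/and3P; split; first exact: edges_bij.
  apply/forallP; apply: forall_bij => x; apply/forallP; apply: forall_bij => y.
  rewrite (connect_bij (e := [rel a b | (b == v a) || (b == e a)])) ?conn_map //.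
  by move=> a b /=; rewrite -fv -fe !(inj_eq fI).
have c1 : fcard v' D' = fcard v D by apply: (fcard_bij fv) => //; exact: perm_inj.
have c2 : fcard (face m') D' = fcard (face m) D by apply: (fcard_bij face_bij) => //; exact: face_inj.
have c3 : fcard e' D' = fcard e D by apply: (fcard_bij fe) => //; exact: perm_inj.
by rewrite c1 c2 c3 E.
Qed.

Lemma tree_bij n : ternary_tree m n -> ternary_tree m' n.
Proof.
case/and3P => /andP[mp /eqP f1] /forallP o14 /eqP c4; apply/and3P; split.
- rewrite /plane_tree planar_bij //= -f1; apply/eqP.
  by apply: fcard_bij => //; [exact: face_bij|exact: face_inj|exact: face_inj].
- by apply/forallP; apply: forall_bij => d; rewrite !(order_bij fv).
- rewrite -c4; apply/eqP; apply: (fcard_bij fv); try exact: perm_inj.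
    move=> x y /eqP <-; rewrite !inE; congr (_ == 4).
    by rewrite !order_cls; apply: eq_card => z; rewrite !mem_cls -(same_fconnect1 (@perm_inj _ v)).
  by move=> x; rewrite !inE (order_bij fv).
Qed.

Lemma inner_bij o d : inner_vertex m' (f o) (f d) = inner_vertex m o d.
Proof.
apply/forallP/forallP => H; last first.
  by apply: forall_bij => y; rewrite (fconnect_bij face_bij) (fconnect_bij fv).
by move=> y; have := H (f y); rewrite (fconnect_bij face_bij) (fconnect_bij fv).
Qed.

Lemma inner_vertices_bij o : inner_vertices m' (f o) = inner_vertices m o.
Proof.
apply: (fcard_bij fv); try exact: perm_inj; last by move=> x; exact: inner_bij.
by move=> x y /eqP <-; rewrite [RHS]inn_vrot.
Qed.

Lemma irreducible_bij o : irreducible_triangulation m o -> irreducible_triangulation m' (f o).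
Proof.
case/and5P => mp /andP[/forallP s1 /forallP s2] o4 /forallP o3 /forallP nosep.
have fc := fconnect_bij fv; apply/and5P; split.
- exact: planar_bij.
- apply/andP; split; apply/forallP; apply: forall_bij => d; first by rewrite -fe fc.
  apply/forallP; apply: forall_bij => d'; rewrite -!fe !fc (inj_eq fI).
  by have /forallP := s2 d; apply.
- by rewrite (order_bij face_bij).
- apply/forallP; apply: forall_bij => d.
  by rewrite (fconnect_bij face_bij) (order_bij face_bij).
apply/forallP; apply: forall_bij => d1; apply/forallP; apply: forall_bij => d2.
apply/forallP; apply: forall_bij => d3; have /forallP/(_ d2)/forallP/(_ d3) := nosep d1.
apply: contra; rewrite /separating_triangle /triangle -!fe !fc => /andP[-> /=].
case/existsP => x' /existsP[y' H].
have [x xE] : exists x, f x = x' by case: fB => g _ gK; exists (g x').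
have [y yE] : exists y, f y = y' by case: fB => g _ gK; exists (g y').
apply/existsP; exists x; apply/existsP; exists y; move: H.
rewrite -xE -yE /off_triangle !fc; congr [&& _, _ & ~~ _].
apply: connect_bij => a b /=; rewrite -!fe -!face_bij !inE !(inj_eq fI) //.
Qed.

End Transport.

Lemma struct_isom (D D' : finType) (m : cmap D) (m' : cmap D') f o I : map_isom m m' f ->
  stem_system m o I -> stem_system m' (f o) (f @: I).
Proof.
move=> [fB fv fe] st; have fI := bij_inj fB; have ff := face_bij fv fe.
have inI x : (f x \in f @: I) = (x \in I) by rewrite mem_imset.
have outf x : outer_dart m' (f o) (f x) = outer_dart m o x by rewrite /outer_dart (fconnect_bij fB ff).
split.
- apply: (forall_bij fB) => x; rewrite outf -!ff (inj_eq fI) => /(st_tri st)[-> ->] //.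
- apply: (forall_bij fB) => x; rewrite outf => /(st_face st) <-.
  rewrite -(card_imset _ fI); apply: eq_card; apply: (forall_bij fB) => y.
  by rewrite mem_imset // !in_set (fconnect_bij fB ff) inI.
- apply: (forall_bij fB) => x; rewrite inI -fe !outf; exact: st_out.
- apply: (forall_bij fB) => x; rewrite (inner_bij fB fv fe) => /(st_inn st) <-.
  rewrite -(card_imset _ fI); apply: eq_card; apply: (forall_bij fB) => y.
  by rewrite mem_imset // !in_set (fconnect_bij fB fv) inI.
- apply: (forall_bij fB) => x; rewrite (inner_bij fB fv fe) -fe !outf inI; exact: st_outv.
Qed.

Lemma minimal_isom (D D' : finType) (m : cmap D) (m' : cmap D') f o I : map_isom m m' f ->
  minimal m o I -> minimal m' (f o) (f @: I).
Proof.
move=> [fB fv fe] mi Z [Ze Zi Z1 Z2]; have fI := bij_inj fB.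
have inI x : (f x \in f @: I) = (x \in I) by rewrite mem_imset.
have inZ x : (x \in f @^-1: Z) = (f x \in Z) by rewrite in_set.
have Z0 : f @^-1: Z = set0.
  apply: mi; split.
  - by move=> x; rewrite !inZ fe Ze.
  - by move=> x; rewrite inZ => /Zi; rewrite (inner_bij fB fv fe).
  - by move=> x; rewrite !inZ fv -inI fv; exact: Z1.
  - by move=> x; rewrite !inZ fv -inI fv; exact: Z2.
by apply/setP; apply: (forall_bij fB) => x; rewrite -inZ Z0 !in_set0.
Qed.

(** * Isomorphisms of trees and of their closures *)

Section ClosureIsom.
Variables (S S' : finType) (f : S -> S').

Lemma closable_isom m m' l : map_isom m m' f -> closable m' (f l) = closable m l.
Proof.
move=> [fB fv fe]; have ff := face_bij fv fe.
by rewrite /closable /closed_side -!ff -!fe !(leaf_bij fB fv).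
Qed.

Lemma glue_isom m m' l : map_isom m m' f -> map_isom (glue_leaf m l) (glue_leaf m' (f l)) f.
Proof.
move=> [fB fv fe]; have ff := face_bij fv fe; split=> // d.
by rewrite !vrot_glue !permM fv (inj_tperm _ _ _ (bij_inj fB)) fe !ff.
Qed.

Lemma closure_isom m m' q : map_isom m m' f -> connect (@local_closure S) m q ->
  exists2 q', connect (@local_closure S') m' q' & map_isom q q' f.
Proof.
move=> mm /connectP[s]; elim: s m m' mm => [|z s IH] m m' mm /=.
  by move=> _ ->; exists m'; rewrite ?connect0.
case/andP => /existsP[l /andP[cl /eqP zE]] ps qE; rewrite zE in ps qE.
have [q' c qq] := IH _ _ (glue_isom l mm) ps qE; exists q' => //.
apply: connect_trans c; apply: connect1; apply/existsP; exists (f l).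
by rewrite (closable_isom _ mm) cl eqxx.
Qed.

Lemma partial_closure_isom A A' p : map_isom A A' f -> partial_closure A p ->
  exists2 p', partial_closure A' p' & map_isom p p' f.
Proof.
move=> aa /andP[/(closure_isom aa)[p' c pp] /forallP st]; exists p' => //.
apply/andP; split=> //; apply/forallP; have [fB _ _] := aa.
by apply: (forall_bij fB) => l; rewrite (closable_isom _ pp).
Qed.

Variables (A : cmap S) (A' : cmap S') (n : nat).
Hypothesis At : ternary_tree A n.
Hypothesis At' : ternary_tree A' n.
Hypothesis n0 : 0 < n.
Variables (p : cmap S) (p' : cmap S').
Hypothesis pA : partial_closure A p.
Hypothesis pA' : partial_closure A' p'.
Variables (lab : S -> 'I_4) (lab' : S' -> 'I_4).
Variables (C : cmap (outer_darts S)) (C' : cmap (outer_darts S')).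
Hypothesis aC : attach_stems p lab C.
Hypothesis aC' : attach_stems p' lab' C'.

(** The two labellings may start at different intervals. By [label_shift] they differ by a rotation,
    which is then applied to the outer cycle. *)
Lemma attach_isom : map_isom p p' f -> exists2 F, map_isom C C' F & forall d, F (old_dart d) = old_dart (f d).
Proof.
move=> [fB fv fe]; have ff := face_bij fv fe; have lf := leaf_bij fB fv.
have gf l : gap_after p' (f l) = gap_after p l by rewrite /gap_after -ff -fe lf.
have nf l : next_stem p' (f l) = f (next_stem p l) by rewrite /next_stem gf; case: ifP => _; rewrite -!ff -fe.
have hl := attach_labelling aC; have hl' := attach_labelling aC'.
have hf : labelling p (fun d => lab' (f d)).
  by move=> l ll; rewrite -nf hl' ?lf // gf.
have [c hc] := label_shift At n0 pA hl hf.
pose F (x : outer_darts S) : outer_darts S' :=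
  match x with inl d => inl (f d) | inr (i, b) => inr (iter c (@ordS 4) i, b) end.
have FI : injective F.
  move=> [d|[i b]] [d'|[j b']] //= [].
    by move/(bij_inj fB)->.
  by move/iter_ordS_inj-> => ->.
have cS : #|outer_darts S| = #|outer_darts S'| by rewrite !card_sum (bij_eq_card fB).
exists F => //; split.
- by apply: inj_card_bij => //; rewrite cS.
- elim/outer_ind => [d|i|i].
  + case: (boolP (leaf p d)) => ld; last first.
      by rewrite (Cv_old aC ld) /= (Cv_old aC') ?lf // fv.
    have [l ll <-] := nx_surj At n0 pA ld; have ll' : leaf p' (f l) by rewrite lf.
    have lx := nx_leaf At n0 pA ll.
    case: (boolP (gap_after p l)) => g; last first.
      by rewrite (Cv_nongap aC ll g) /= -/(old_dart _) -nf (Cv_nongap aC') ?gf.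
    by rewrite (Cv_gap aC ll g) /= -/(old_dart _) -nf (Cv_gap aC') ?gf // nf hc.
  + have [l [ll g <-]] := gl_exists At n0 pA aC i.
    rewrite (Cv_tn aC ll g) /= -hc // -/(to_next _ _) (Cv_tn aC') ?lf ?gf //.
  + by rewrite (Cv_tp aC) /= -/(to_prev _ _) (Cv_tp aC').
elim/outer_ind => [d|i|i].
- by rewrite (Ce_old aC) /= -/(old_dart _) (Ce_old aC') fe.
- by rewrite (Ce_tn aC) /= -/(to_next _ _) (Ce_tn aC') -iterS iterSr.
- by rewrite -[i]ord_predK (Ce_tp aC) ordSK /= -iterSr iterS -/(to_prev _ _) (Ce_tp aC') ordSK.
Qed.

End ClosureIsom.

Section OpeningIsom.
Variables (S S' : finType) (A : cmap S) (A' : cmap S') (n : nat).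
Hypothesis At : ternary_tree A n.
Hypothesis At' : ternary_tree A' n.
Hypothesis n0 : 0 < n.
Variables (p : cmap S) (p' : cmap S').
Hypothesis pA : partial_closure A p.
Hypothesis pA' : partial_closure A' p'.
Variables (lab : S -> 'I_4) (lab' : S' -> 'I_4).
Variables (C : cmap (outer_darts S)) (C' : cmap (outer_darts S')).
Hypothesis aC : attach_stems p lab C.
Hypothesis aC' : attach_stems p' lab' C'.
Local Notation old := (@old_dart _).

(** The outer face is recognized without a root, as the only face of length 4; hence every
    isomorphism of closures respects it. *)
Lemma order4_outer T (B : cmap T) q l (M : cmap (outer_darts T)) : ternary_tree B n ->
  partial_closure B q -> attach_stems q l M -> forall x,
  reflect (exists i, x = to_next T i) (fingraph.order (face M) x == 4).
Proof.
move=> Bt qB aM x; have oc y : fingraph.order (face M) y = #|cls (frel (face M)) y|.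
  by apply: eq_card => z; rewrite !inE.
rewrite oc; case: (C_outdP Bt n0 qB aM ord0 x) => [xi|nx].
  rewrite (C_order_out Bt n0 qB aM (i0 := ord0)); last by apply/(C_outdP Bt n0 qB aM).
  by left.
rewrite (C_order_in Bt n0 qB aM (i0 := ord0)); last by apply/negP => /(C_outdP Bt n0 qB aM).
by right.
Qed.

Lemma isom_old (F : outer_darts S -> outer_darts S') d : map_isom C C' F ->
  exists d', F (old d) = old d'.
Proof.
move=> [FB Fv Fe]; have ff := face_bij Fv Fe.
have nt x i : F (old x) <> to_next S' i.
  move=> E; have : exists i, F (old x) = to_next S' i by exists i.
  move/(order4_outer At' pA' aC'); rewrite (order_bij FB ff) => /(order4_outer At pA aC)[] //.
case E : (F (old d)) => [d'|[i [|]]]; first by exists d'.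
  by case: (nt d i).
case: (nt (erev p d) (ord_pred i)); rewrite -(Ce_old aC) Fe E.
exact: (Ce_tp aC' i).
Qed.

(** By [struct_unique] the isomorphism carries stem ends to stem ends, and the rotation of each tree
    is recovered by skipping them. *)
Lemma opening_isom F : map_isom C C' F -> exists2 f, map_isom A A' f & forall d, F (old d) = old (f d).
Proof.
move=> FF; have [FB Fv Fe] := FF; have FI := bij_inj FB; have ff := face_bij Fv Fe.
have /fin_all_exists[f fP] := fun d => @isom_old F d FF.
have fI : injective f.
  by move=> d d' E; apply: (@old_inj S); apply: FI; rewrite !fP E.
have cS : #|S| = #|S'|.
  by have := bij_eq_card FB; rewrite !card_sum; lia.
have fB : bijective f by apply: inj_card_bij => //; rewrite cS.
have [j oE] : exists j, F (to_next S ord0) = to_next S' j.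
  apply/(order4_outer At' pA' aC'); rewrite (order_bij FB ff).
  by apply/(order4_outer At pA aC); exists ord0.
have IE : F @: stem_ends A = stem_ends A'.
  apply: (struct_unique (o := to_next S' j) (C_planar At' n0 pA' aC' j)).
  - by rewrite -oE; apply: struct_isom FF (C_struct At n0 pA aC ord0).
  - exact: (C_struct At' n0 pA' aC' j).
  - by rewrite -oE; exact: (minimal_isom FF (C_minimal At n0 pA aC (i0 := ord0))).
  - exact: (C_minimal At' n0 pA' aC' (i0 := j)).
have lf d : (f d \in leaves A') = (d \in leaves A).
  have h1 := inIC A' (old (f d)); have h2 := inIC A (old d); rewrite /= in h1 h2.
  by rewrite -h1 -h2 -IE -fP mem_imset.
have sk x y : skip (vrot C) (stem_ends A) x y -> skip (vrot C') (stem_ends A') (F x) (F y).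
  elim=> {x y} [x|x y xI _ IH]; first by rewrite Fv; exact: Skip1.
  by apply: SkipS; rewrite -Fv // -IE mem_imset.
exists f => //; split=> // d.
- case: (boolP (d \in leaves A)) => dL.
    have dL' : f d \in leaves A' by rewrite lf.
    by move: dL dL'; rewrite !inleaves => /eqP-> /eqP->.
  have dL' : f d \notin leaves A' by rewrite lf.
  have := sk _ _ (C_skip At n0 pA aC dL); rewrite !fP => h1.
  have h2 := C_skip At' n0 pA' aC' dL'.
  apply: (@old_inj S'); apply: (skip_fun h1 h2); rewrite inIC /=; last by rewrite leaves_v.
  by rewrite lf leaves_v.
- apply: (@old_inj S'); rewrite -fP.
  by rewrite -(stuck_e At n0 pA) -(stuck_e At' n0 pA') -(Ce_old aC) Fe fP (Ce_old aC').
Qed.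

End OpeningIsom.

(** [closure_of] forgets where the darts of the tree are sent in [M]. The map [u] records it, so
    that isomorphisms of trees and of closures can be compared dart by dart. *)
Definition anchored (S D : finType) (A : cmap S) (M : cmap D) (u : S -> D) : Prop :=
  exists p lab C G, [/\ partial_closure A p, attach_stems p lab C, map_isom C M G &
    forall d, u d = G (old_dart d)].

Lemma closure_anchored (S D : finType) (A : cmap S) (M : cmap D) :
  closure_of A M -> exists u, anchored A M u.
Proof.
move=> [p [lab [C [pA aC /map_isoP[G GG]]]]]; exists (fun d => G (old_dart d)).
by exists p, lab, C, G; split.
Qed.

Section Anchored.
Variables (S S' D D' : finType) (A : cmap S) (A' : cmap S') (M : cmap D) (M' : cmap D').
Variables (u : S -> D) (u' : S' -> D') (n : nat).
Hypothesis n0 : 0 < n.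
Hypothesis At : ternary_tree A n.
Hypothesis At' : ternary_tree A' n.
Hypothesis Mu : anchored A M u.
Hypothesis Mu' : anchored A' M' u'.

Lemma anchored_closure f : map_isom A A' f -> exists2 F, map_isom M M' F & forall d, F (u d) = u' (f d).
Proof.
case: Mu => p [lab [C [G [pA aC GG uE]]]]; case: Mu' => p' [lab' [C' [G' [pA' aC' GG' uE']]]] ff.
have [p'' pA'' pp] := partial_closure_isom ff pA.
rewrite (partial_closure_unique At' n0 pA'' pA') in pp.
have [F FF FE] := attach_isom At n0 pA aC aC' pp.
have [H [HH GK HK]] := map_isom_inv GG.
exists (fun x => G' (F (H x))); first exact: map_isom_comp (map_isom_comp HH FF) GG'.
by move=> d; rewrite uE GK FE uE'.
Qed.

Lemma anchored_opening F : map_isom M M' F -> exists2 f, map_isom A A' f & forall d, F (u d) = u' (f d).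
Proof.
case: Mu => p [lab [C [G [pA aC GG uE]]]]; case: Mu' => p' [lab' [C' [G' [pA' aC' GG' uE']]]] FF.
have [H [HH GK HK]] := map_isom_inv GG'.
have [f ff fE] := opening_isom At At' n0 pA pA' aC aC' (map_isom_comp (map_isom_comp GG FF) HH).
by exists f => // d; rewrite uE uE' -fE HK.
Qed.

Lemma anchored_inj : injective u.
Proof.
case: Mu => p [lab [C [G [_ _ [GB _ _] uE]]]] x y; rewrite !uE => /(bij_inj GB).
exact: old_inj.
Qed.

Lemma anchored_outer : exists e : 'I_4 -> D, [/\ injective e,
  forall i, irreducible_triangulation M (e i) /\ inner_vertices M (e i) = n &
  forall x, fingraph.order (face M) x = 4 -> exists i, x = e i].
Proof.
case: Mu => p [lab [C [G [pA aC GG uE]]]]; have [GB Gv Ge] := GG.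
exists (fun i => G (to_next S i)); split.
- by move=> i j /(bij_inj GB)[].
- move=> i /=; split; first by exact (irreducible_bij GB Gv Ge (C_irreducible At n0 pA aC i)).
  by rewrite (inner_vertices_bij GB Gv Ge); exact: (C_inner_vertices At n0 pA aC).
apply: (forall_bij GB) => x; rewrite (order_bij GB (face_bij Gv Ge)) => /eqP.
by move/(order4_outer n0 At pA aC) => [i ->]; exists i.
Qed.

End Anchored.

Lemma closure_exists (S : finType) (A : cmap S) n : 0 < n -> ternary_tree A n ->
  exists C : cmap (outer_darts S), closure_of A C.
Proof.
move=> n0 At; have [p pA] := partial_closure_exists At n0.
have [lab [C aC]] := attach_exists At n0 pA; exists C, p, lab, C; split=> //.
by apply/map_isoP; exists id; split=> //; exists id.
Qed.

Lemma closure_isom_r (S D D' : finType) (A : cmap S) (M : cmap D) (M' : cmap D') F :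
  closure_of A M -> map_isom M M' F -> closure_of A M'.
Proof.
move=> [p [lab [C [pA aC /map_isoP[G GG]]]]] FF; exists p, lab, C; split=> //.
by apply/map_isoP; exists (fun x => F (G x)); exact: map_isom_comp GG FF.
Qed.

Lemma closure_isom_l (S S' D : finType) (A : cmap S) (A' : cmap S') (M : cmap D) f n :
  0 < n -> ternary_tree A n -> map_isom A A' f -> closure_of A M -> closure_of A' M.
Proof.
move=> n0 At ff cl; have [fB fv fe] := ff; have At' := tree_bij fB fv fe At.
have [C cC] := closure_exists n0 At'.
have [u Mu] := closure_anchored cl; have [u' Mu'] := closure_anchored cC.
have [F FF _] := anchored_closure n0 At At' Mu Mu' ff.
have [H [HH _ _]] := map_isom_inv FF; exact: closure_isom_r cC HH.
Qed.

(** Rooted classes consist of maps on ordinals; closures and openings on other finite types enter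
    them by renumbering. *)
Lemma ord_isom (D : finType) (m : cmap D) : exists (m' : cmap 'I_#|D|), map_isom m m' (@enum_rank D).
Proof.
pose tr (s : {perm D}) := perm (inj_comp (@enum_rank_inj D) (inj_comp (@perm_inj _ s) (@enum_val_inj D D))).
exists (tr (vrot m), tr (erev m)); split.
- by exists enum_val; [exact: enum_rankK|exact: enum_valK].
- by move=> d; rewrite /vrot /= permE /= enum_rankK.
- by move=> d; rewrite /erev /= permE /= enum_rankK.
Qed.

Lemma choice_function (T U : Type) (R : T -> U -> Prop) :
  (forall x, exists y, R x y) -> exists f, forall x, R x (f x).
Proof.
move=> H; exists (fun x => proj1_sig (constructive_indefinite_description _ (H x))) => x.
by case: constructive_indefinite_description.
Qed.

Lemma class_ofP (k k' : nat) (m : cmap 'I_k) (r : 'I_k) (m' : cmap 'I_k') (r' : 'I_k') :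
  class_of m r = class_of m' r' <-> exists2 f, map_isom m m' f & f r = r'.
Proof.
split=> [E|[f [fB fv fe] fr]].
  have /eqmodP/existsP[f /andP[/is_isoP h /eqP fr]] : (class_of m r = class_of m' r')%qT := E.
  by exists f.
apply/eqmodP/existsP; exists [ffun x => f x]; rewrite ffunE fr eqxx andbT.
apply/is_isoP; split=> [|d|d]; rewrite ?ffunE //.
by apply: (eq_bij fB) => x; rewrite ffunE.
Qed.

Lemma class_of_repr (c : rooted_class) : class_of (rmap (repr c)) (root_dart (repr c)) = c.
Proof. by rewrite -[RHS]reprK; case: (repr c) => k [m r]. Qed.

Lemma tree_class k (m : cmap 'I_k) r n : ternary_tree m n -> leaf m r ->
  rooted_ternary_tree n (repr (class_of m r)).
Proof.
move=> mt lr; have /class_ofP[f [fB fv fe] fr] := esym (class_of_repr (class_of m r)).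
by rewrite /rooted_ternary_tree (tree_bij fB fv fe mt) -fr (leaf_bij fB fv).
Qed.

Lemma triangulation_class k (m : cmap 'I_k) r n : irreducible_triangulation m r ->
  inner_vertices m r = n -> rooted_irreducible_triangulation n (repr (class_of m r)).
Proof.
move=> mi mn; have /class_ofP[f [fB fv fe] fr] := esym (class_of_repr (class_of m r)).
rewrite /rooted_irreducible_triangulation -fr (irreducible_bij fB fv fe mi).
by rewrite (inner_vertices_bij fB fv fe) mn eqxx.
Qed.

(** * The bijection between indexed rooted objects *)

Section Correspondence.
Variable n : nat.
Hypothesis n0 : 0 < n.
Implicit Types (a : rooted_ternary_trees n) (t : rooted_irreducible_triangulations n).

Notation tree a := (rmap (repr (val a))).
Notation tree_root a := (root_dart (repr (val a))).
Notation tri t := (rmap (repr (val t))).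
Notation tri_root t := (root_dart (repr (val t))).

Lemma treeP a : ternary_tree (tree a) n /\ leaf (tree a) (tree_root a).
Proof. exact/andP/(valP a). Qed.

Lemma triP t : irreducible_triangulation (tri t) (tri_root t) /\
  inner_vertices (tri t) (tri_root t) = n.
Proof. by case/andP: (valP t) => ? /eqP. Qed.

(** All data are packed together so that a single choice per object fixes the closure, the position
    of the tree in it and the numbering of the outer darts, for all indices at once. *)
Record closed_tree a := ClosedTree {
  ct_k : nat; ct_M : cmap 'I_ct_k;
  ct_u : 'I_(tag (repr (val a))) -> 'I_ct_k; ct_e : 'I_4 -> 'I_ct_k;
  ct_cl : closure_of (tree a) ct_M;
  ct_anch : anchored (tree a) ct_M ct_u;
  ct_inj : injective ct_e;
  ct_irr : forall i, irreducible_triangulation ct_M (ct_e i) /\ inner_vertices ct_M (ct_e i) = n;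
  ct_all : forall x, fingraph.order (face ct_M) x = 4 -> exists i, x = ct_e i }.

Record opened_tri t := OpenedTri {
  ot_k : nat; ot_A : cmap 'I_ot_k;
  ot_u : 'I_ot_k -> 'I_(tag (repr (val t))); ot_l : 'I_(2 * n + 2) -> 'I_ot_k;
  ot_tree : ternary_tree ot_A n;
  ot_cl : closure_of ot_A (tri t);
  ot_anch : anchored ot_A (tri t) ot_u;
  ot_inj : injective ot_l;
  ot_leaf : forall j, leaf ot_A (ot_l j);
  ot_all : forall x, leaf ot_A x -> exists j, x = ot_l j }.

Arguments ct_u [a] c _.
Arguments ct_e [a] c _.
Arguments ot_u [t] o _.
Arguments ot_l [t] o _.

Lemma closed_tree_exists a : exists _ : closed_tree a, True.
Proof.
have [At _] := treeP a; have [C cC] := closure_exists n0 At.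
have [M iM] := ord_isom C; have cM := closure_isom_r cC iM.
have [u Mu] := closure_anchored cM.
have [e [einj eirr eall]] := anchored_outer n0 At Mu.
by exists (ClosedTree cM Mu einj eirr eall).
Qed.

Lemma opened_tri_exists t : exists _ : opened_tri t, True.
Proof.
have [ti tn] := triP t; have [S [B [Bt cB]]] := closure_surjective n0 ti tn.
have [A iA] := ord_isom B; have cA := closure_isom_l n0 Bt iA cB.
have At : ternary_tree A n by have [fB fv fe] := iA; exact (tree_bij fB fv fe Bt).
have [u Mu] := closure_anchored cA.
have [cL _] := tree_counts At.
pose l (j : 'I_(2 * n + 2)) := enum_val (cast_ord (esym cL) j).
have linj : injective l by move=> i j /enum_val_inj/cast_ord_inj.
have ll j : leaf A (l j) by have := enum_valP (cast_ord (esym cL) j); rewrite in_set.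
have lall x : leaf A x -> exists j, x = l j.
  move=> lx; have xL : x \in leaves A by rewrite in_set.
  exists (cast_ord cL (enum_rank_in xL x)).
  by rewrite /l cast_ordK enum_rankK_in.
by exists (OpenedTri At cA Mu linj ll lall).
Qed.

Definition ct a := proj1_sig (constructive_indefinite_description _ (closed_tree_exists a)).
Definition ot t := proj1_sig (constructive_indefinite_description _ (opened_tri_exists t)).

(* The tree a and the opening of t are isomorphic, with the root of a sent to
   the j-th leaf, by an isomorphism that induces one between the closure of a
   and t, sending the i-th outer dart to the root. *)
Definition matched a i t j := exists f F,
  [/\ map_isom (tree a) (ot_A (ot t)) f, map_isom (ct_M (ct a)) (tri t) F,
      forall d, F (ct_u (ct a) d) = ot_u (ot t) (f d),
      F (ct_e (ct a) i) = tri_root t & f (tree_root a) = ot_l (ot t) j].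

Lemma matched_total a i : exists tj, matched a i tj.1 tj.2.
Proof.
have [At lr] := treeP a; have [Mi Mn] := ct_irr (ct a) i.
pose t : rooted_irreducible_triangulations n := exist (fun c : rooted_class => rooted_irreducible_triangulation n (repr c)) _ (triangulation_class Mi Mn).
have /class_ofP[F iF Fr] := esym (class_of_repr (val t)).
have [f iF' fE] := anchored_opening n0 At (ot_tree (ot t)) (ct_anch (ct a)) (ot_anch (ot t)) iF.
have [fB fv fe] := iF'.
have [j jE] : exists j, f (tree_root a) = ot_l (ot t) j.
  by apply: ot_all; rewrite (leaf_bij fB fv).
by exists (t, j), f, F; split.
Qed.

Lemma matched_onto t j : exists ai, matched ai.1 ai.2 t j.
Proof.
have At := ot_tree (ot t); have lj := ot_leaf (ot t) j.
pose a : rooted_ternary_trees n := exist (fun c : rooted_class => rooted_ternary_tree n (repr c)) _ (tree_class At lj).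
have [Bt _] := treeP a.
have /class_ofP[f iF fr] := class_of_repr (val a).
have [F iF' FE] := anchored_closure n0 Bt At (ct_anch (ct a)) (ot_anch (ot t)) iF.
have [[G FK GK] Fv Fe] := iF'.
have [i iE] : exists i, G (tri_root t) = ct_e (ct a) i.
  apply: ct_all; have [ti _] := triP t.
  have FB : bijective F by exists G.
  rewrite -(order_bij FB (face_bij Fv Fe)) GK.
  by case/and5P: ti => _ _ /eqP.
by exists (a, i), f, F; split; rewrite //= -iE GK.
Qed.

(** Both isomorphisms of closures send the same outer dart to the root of [t], so they coincide by
    rigidity. As [ot_u] is injective, they determine the leaf that is reached. *)
Lemma matched_functional a i t j t' j' : matched a i t j -> matched a i t' j' -> (t, j) = (t', j').
Proof.
move=> [f [F [iF IF FE Fr fr]]] [f' [F' [iF' IF' FE' Fr' fr']]].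
have tt' : t = t'.
  apply: val_inj; rewrite -(class_of_repr (val t)) -(class_of_repr (val t')).
  transitivity (class_of (ct_M (ct a)) (ct_e (ct a) i)); first by apply/esym/class_ofP; exists F.
  by apply/class_ofP; exists F'.
subst t'; congr (_, _); apply: (ot_inj (o := ot t)).
have [Mi _] := ct_irr (ct a) i; have Mc := irr_conn Mi.
have FF : F =1 F' by apply: (map_isom_eq (x := ct_e (ct a) i) Mc IF IF'); rewrite Fr Fr'.
by rewrite -fr -fr'; apply: (anchored_inj (ot_anch (ot t))); rewrite -FE -FE'.
Qed.

(** The same argument with the dart of the marked leaf, seen in the closure, in place of the outer
    dart. *)
Lemma matched_injective a i t j a' i' : matched a i t j -> matched a' i' t j -> (a, i) = (a', i').
Proof.
move=> [f [F [iF IF FE Fr fr]]] [f' [F' [iF' IF' FE' Fr' fr']]].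
have aa' : a = a'.
  apply: val_inj; rewrite -(class_of_repr (val a)) -(class_of_repr (val a')).
  transitivity (class_of (ot_A (ot t)) (ot_l (ot t) j)); first by apply/class_ofP; exists f.
  by apply/esym/class_ofP; exists f'.
subst a'; congr (_, _); apply: (ct_inj (c := ct a)).
have [Mi _] := ct_irr (ct a) i; have Mc := irr_conn Mi.
have FF : F =1 F'.
  by apply: (map_isom_eq (x := ct_u (ct a) (tree_root a)) Mc IF IF'); rewrite FE FE' fr fr'.
have [FB _ _] := IF; by apply: (bij_inj FB); rewrite Fr FF Fr'.
Qed.

End Correspondence.

Theorem theorem19 (n : nat) (hn : 1 <= n) :
  exists Phi : rooted_ternary_trees n * 'I_4 ->
               rooted_irreducible_triangulations n * 'I_(2 * n + 2),
    [/\ bijective Phi,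
        (* a rooted tree corresponds to the 4 rootings of its closure *)
        forall (a : rooted_ternary_trees n) (k k' : nat)
               (A : cmap 'I_k) (l : 'I_k) (M : cmap 'I_k'),
          val a = class_of A l -> closure_of A M ->
          exists e : 'I_4 -> 'I_k', injective e /\
            forall i, val (Phi (a, i)).1 = class_of M (e i)
      & (* a rooted triangulation corresponds to the 2n+2 rootings of a tree
           of which it is the closure *)
        forall (t : rooted_irreducible_triangulations n) (k' : nat)
               (M : cmap 'I_k') (r : 'I_k'),
          val t = class_of M r ->
          exists (k : nat) (A : cmap 'I_k) (l : 'I_(2 * n + 2) -> 'I_k),
            [/\ closure_of A M, injective l &
              forall j, exists (a : rooted_ternary_trees n) (i : 'I_4),
                val a = class_of A (l j) /\ Phi (a, i) = (t, j)]].
Proof.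
pose mt (ai : rooted_ternary_trees n * 'I_4)
  (tj : rooted_irreducible_triangulations n * 'I_(2 * n + 2)) := matched hn ai.1 ai.2 tj.1 tj.2.
(* [matched] is total and single-valued in both directions, so choices made on the two sides are
   inverse to each other. *)
have [Phi PhiP] := choice_function (R := mt) (fun ai => matched_total hn ai.1 ai.2).
have [Psi PsiP] := choice_function (R := fun tj ai => mt ai tj) (fun tj => matched_onto hn tj.1 tj.2).
have PhiK : cancel Phi Psi.
  move=> [a i]; have := PhiP (a, i); have := PsiP (Phi (a, i)).
  by rewrite /mt; case: (Psi _) => a' i' /= m1 m2; exact: matched_injective m1 m2.
have PsiK : cancel Psi Phi.
  move=> [t j]; have := PhiP (Psi (t, j)); have := PsiP (t, j).
  by rewrite /mt; case: (Phi _) => t' j' /= m1 m2; exact: matched_functional m2 m1.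
exists Phi; split; first by exists Psi.
(* Any closure [M] of any representative of [a] is isomorphic to the chosen one, and its outer darts
   are numbered through that isomorphism. *)
- move=> a k k' A l M aE cM; have [At lr] := treeP a.
  have /class_ofP[f iF _] := etrans (class_of_repr (val a)) aE.
  have [fB fv fe] := iF; have At' := tree_bij fB fv fe At.
  have [u' Mu'] := closure_anchored cM.
  have [F IF _] := anchored_closure hn At At' (ct_anch (ct hn a)) Mu' iF.
  have [FB _ _] := IF; exists (fun i => F (ct_e (ct hn a) i)); split.
    by move=> i j /(bij_inj FB); exact: ct_inj.
  move=> i; have [g [G [_ IG _ Gr _]]] := PhiP (a, i).
  rewrite -(class_of_repr (val _)); transitivity (class_of (ct_M (ct hn a)) (ct_e (ct hn a) i)).
    by apply/esym/class_ofP; exists G.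
  by apply/class_ofP; exists F.
move=> t k' M r tE; have /class_ofP[F IF _] := etrans (class_of_repr (val t)) tE.
exists (ot_k (ot hn t)), (ot_A (ot hn t)), (ot_l (ot hn t)); split.
- exact: closure_isom_r (ot_cl (ot hn t)) IF.
- exact: (ot_inj (o := ot hn t)).
move=> j; have := PsiP (t, j); rewrite /mt; case E: (Psi (t, j)) => [a i] /= m.
exists a, i; split; last by rewrite -E PsiK.
have [f [G [iF _ _ _ fr]]] := m.
by rewrite -(class_of_repr (val a)); apply/class_ofP; exists f.
Qed.
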